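(* Suppose $y\in\mathcal I_n$ is a vexillary involution with $\mathrm{sh}^{\mathrm O}(y)=\lambda$, and let $\mathcal P$ be an essential path for $y$ starting at the diagonal position $(j,j)$. Then $$2^{\mathrm{cyc}(y)}\,\overleftarrow{\mathfrak S}^{\mathrm O}_y=Q_\lambda(x_{-\infty\cdots j};-x^{\mathcal P}),$$ where $\mathrm{cyc}(y)$ is the number of 2-cycles of $y$.
   Context: $\mathcal I_n=\{y\in S_n:y^2=1\}$; $[n]=\{1,\dots,n\}$. Variables $x_i$ are indexed by $i\in\mathbb Z\setminus\{0\}$. A permutation is vexillary if it avoids the pattern $2143$. **Diagram and shape.** $D^{\mathrm O}(y)=\{(a,b)\in[n]\times[n]:a\ge b,\ b<y(a),\ a<y(b)\}$; $\mathrm{Ess}(D)=\{(a,b)\in D:(a,b+1)\notin D,\ (a+1,b)\notin D\}$; $\mathrm{sh}^{\mathrm O}(y)$ is the transpose of the partition obtained by sorting the nonzero row lengths of $D^{\mathrm O}(y)$ (it is a strict partition for $y$ vexillary). **Essential paths.** Order $\mathbb Z^2$ by $(a,b)\le(a',b')$ iff $a\ge a'$ and $b\le b'$. An essential path for a vexillary $y\in\mathcal I_n$ is a sequence $(a_1,b_1),\dots,(a_{n+1},b_{n+1})$ in $\{0,\dots,n\}^2$ with $(a_{r+1},b_{r+1})<(a_r,b_r)$ for $1\le r\le n$, $a_1=b_1$, and such that each element of $\mathrm{Ess}(D^{\mathrm O}(y))$ occurs as some $(a_r,b_r)$. (Necessarily the path ends at $(n,0)$, and each step either increases the first coordinate by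 1 or decreases the second by 1.) The $(n+1)$-tuple $x^{\mathcal P}$ has $x^{\mathcal P}_1=0$, and for $1\le r\le n$: $x^{\mathcal P}_{r+1}=x_{i+1}$ if the $r$th step moves from row $i$ to row $i+1$ (first coordinate), and $x^{\mathcal P}_{r+1}=-x_{b}$ if the $r$th step moves from column $b$ to column $b-1$ (second coordinate). **Multiparameter Schur $Q$-functions.** For a strict partition $\lambda$, $D'_\lambda=\{(a,b):1\le a\le\ell(\lambda),\ a\le b\le a+\lambda_a-1\}$. For a set $S$ of integers, a marked shifted tableau of shape $\lambda$ on $S$ is a filling $T$ of $D'_\lambda$ by letters $s',s$ ($s\in S$), ordered so that $s'<s$ and $s<t'$ whenever $s<t$ in $S$, with entries weakly increasing along rows and down columns, no unprimed letter repeated in a column, and no primed letter repeated in a row. Put $\lceil s\rceil=\lceil s'\rceil=s$, $\epsilon(s)=1$, $\epsilon(s')=-1$. With parameters $t=(t_1,t_2,\dots)$ satisfying $t_1=0$ (as is the case here), $Q_\lambda(x_{-\infty\cdots j};t)$ denotes Ivanov's multiparameter Schur $Q$-function in the variables $x_i$, $i\le j$, $i\neq 0$: $$Q_\lambda(x_{-\infty\cdots j};t)=\sum_T\prod_{(a,b)\in D'_\lambda}\big(x_{\lceil T(a,b)\rceil}-\epsilon(T(a,b))\,t_{b-a+1}\big),$$ the sum over marked shifted tableaux of shape $\lambda$ on $S=\{i\in\mathbb Z\setminus\{0\}:i\le j\}$ (a well-defined formal power series). Here $t=-x^{\mathcal P}$, i.e. $t_r=-x^{\mathcal P}_r$. **Back-stable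 involution Schubert polynomials.** Let $s_i=(i,i+1)$. The Demazure product $\circ$ on $S_n$ is the unique associative product with $w\circ s_i=ws_i$ if $\ell(ws_i)>\ell(w)$, and $w\circ s_i=w$ otherwise ($\ell$ = number of inversions). $\hat{\mathcal R}^{\mathrm O}(y)$ is the set of minimal-length words $a_1\cdots a_\ell$ with $y=s_{a_\ell}\circ\cdots\circ s_{a_1}\circ 1\circ s_{a_1}\circ\cdots\circ s_{a_\ell}$. A compatible sequence for $a$ is a sequence $i_1\le\cdots\le i_\ell$ of nonzero integers with $i_r\le a_r$ for all $r$ and $i_r<i_{r+1}$ whenever $a_r<a_{r+1}$; $C(a)$ is the set of these. $\overleftarrow{\mathfrak S}^{\mathrm O}_y=\sum_{a\in\hat{\mathcal R}^{\mathrm O}(y)}\sum_{i\in C(a)}x_{i_1}\cdots x_{i_\ell}$. *)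

(* Defs.v *)
From HB Require Import structures.
From mathcomp Require Import all_boot all_order all_algebra all_fingroup.
From mathcomp Require Import finmap multinomials.monalg.
From mathcomp Require Import mathcomp_extra boolp classical_sets functions.
From mathcomp Require Import cardinality fsbigop.

Set Implicit Arguments.
Unset Strict Implicit.
Unset Printing Implicit Defensive.

Import Order.TTheory GRing.Theory Num.Theory.
Local Open Scope ring_scope.

(* Permutations of [n] = {1, ..., n} are elements of 'S_n: the ordinal i : 'I_n
   stands for i + 1.  An ordinal i : 'I_n.-1 stands for the letter i + 1 in
   {1, ..., n - 1}, i.e. for the simple reflection s_(i+1) = (i+1, i+2). *)

Lemma ltn_predS n (i : 'I_n.-1) : (i.+1 < n)%N.
Proof. by case: n i => [|n] [i /=]. Qed.

Definition letter_pos n (i : 'I_n.-1) : 'I_n := Ordinal (ltnW (ltn_predS i)).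
Definition letter_posS n (i : 'I_n.-1) : 'I_n := Ordinal (ltn_predS i).

Definition srefl n (i : 'I_n.-1) : 'S_n := tperm (letter_pos i) (letter_posS i).

(* MathComp composes permutations from left to right, (s * t) x = t (s x), so
   the product "w s_i" of functional composition is [srefl i * w]. *)
Definition mulrefl n (w : 'S_n) (i : 'I_n.-1) : 'S_n := (srefl i * w)%g.

Definition inversions n (w : 'S_n) : {set 'I_n * 'I_n} :=
  [set p : 'I_n * 'I_n | (p.1 < p.2)%N && (w p.2 < w p.1)%N].

Definition perm_length n (w : 'S_n) : nat := #|inversions w|.

Definition demazure_refl n (w : 'S_n) (i : 'I_n.-1) : 'S_n :=
  if (perm_length w < perm_length (mulrefl w i))%N then mulrefl w i else w.

Section DemazureProduct.
Variable n : nat.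
Implicit Types (u v w : 'S_n) (i j : 'I_n.-1) (x y : 'I_n) (a : seq 'I_n.-1).

Lemma srefl_lt i x y :
    (x < y)%N -> (x, y) != (letter_pos i, letter_posS i) ->
  (srefl i x < srefl i y)%N.
Proof.
move=> ltxy; rewrite xpair_eqE negb_and /srefl => neq.
have neqv : ((x : nat) != i) || ((y : nat) != i.+1).
  by move: neq; rewrite -!val_eqE.
case: (tpermP (letter_pos i) (letter_posS i) x) => [ex|ex|/eqP nx1 /eqP nx2];
  case: (tpermP (letter_pos i) (letter_posS i) y) => [ey|ey|/eqP ny1 /eqP ny2];
  move: ltxy neqv; rewrite ?ex ?ey /= ?ltnn ?eqxx //=.
- move: ny2; rewrite -val_eqE /= => ny2 lt _.
  by rewrite ltn_neqAle eq_sym ny2.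
- by move=> lt _; apply: ltn_trans (ltnSn i) lt.
- by move=> lt _; apply: ltn_trans lt (ltnSn i).
- move: nx1; rewrite -val_eqE /= => nx1 lt _.
  by rewrite ltnS leq_eqVlt (negPf nx1) /= in lt.
Qed.

Lemma srefl_ltE i x y :
    (x, y) != (letter_pos i, letter_posS i) ->
    (y, x) != (letter_pos i, letter_posS i) ->
  (srefl i x < srefl i y)%N = (x < y)%N.
Proof.
move=> nxy nyx; case: (ltngtP x y) => [/srefl_lt|/srefl_lt|/val_inj->].
- exact.
- by move=> /(_ _ nyx)/ltnW; rewrite leqNgt => /negPf.
- by rewrite ltnn.
Qed.

Lemma mulreflK w i : mulrefl (mulrefl w i) i = w.
Proof. by rewrite /mulrefl mulgA /srefl tperm2 mul1g. Qed.

Lemma perm_length_asc w i :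
  (w (letter_pos i) < w (letter_posS i))%N ->
  (perm_length w < perm_length (mulrefl w i))%N.
Proof.
move=> asc; set p := (letter_pos i, letter_posS i).
pose f (q : 'I_n * 'I_n) := (srefl i q.1, srefl i q.2).
have f_inj : injective f.
  by move=> [x y] [x' y'] [/perm_inj-> /perm_inj->].
rewrite /perm_length -(card_imset _ f_inj); apply: proper_card.
apply/properP; split.
  apply/fintype.subsetP=> q /imsetP[[x y]]; rewrite inE /= => /andP[ltxy inv] ->{q}.
  rewrite inE /= /mulrefl !permM /srefl !tpermK inv andbT.
  apply: srefl_lt => //; apply: contraTneq inv => -[-> ->].
  by rewrite -leqNgt ltnW.
exists p.
  by rewrite inE /= /mulrefl !permM /srefl tpermL tpermR asc ltnSn.
apply/imsetP=> -[[x y]]; rewrite inE /= => /andP[ltxy _] [ex ey].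
have {}ex : x = letter_posS i.
  by rewrite -[x](tpermK (letter_pos i) (letter_posS i)) -/(srefl i) -ex tpermL.
have {}ey : y = letter_pos i.
  by rewrite -[y](tpermK (letter_pos i) (letter_posS i)) -/(srefl i) -ey tpermR.
by move: ltxy; rewrite ex ey /= ltnNge leqnSn.
Qed.

Lemma demazure_reflE w i :
  demazure_refl w i =
    if (w (letter_pos i) < w (letter_posS i))%N then mulrefl w i else w.
Proof.
rewrite /demazure_refl; case: (ltnP (w (letter_pos i))) => [asc|]; first by rewrite perm_length_asc.
rewrite leq_eqVlt => /orP[/eqP/val_inj/perm_inj/(congr1 val)/eqP|desc].
  by rewrite /= eqn_leq ltnn.
have := @perm_length_asc (mulrefl w i) i.
rewrite mulreflK /mulrefl !permM /srefl tpermL tpermR => /(_ desc)/ltnW.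
by rewrite leqNgt => /negPf->.
Qed.

Lemma demazure_word_ex v : exists a, foldl (@demazure_refl n) 1%g a == v.
Proof.
have [k] := ubnP (perm_length v); elim: k v => // k IHk v ltvk.
have [/existsP[i desc]|/existsPn asc] :=
  boolP [exists i : 'I_n.-1, v (letter_posS i) < v (letter_pos i)]%N.
  have asc : (mulrefl v i (letter_pos i) < mulrefl v i (letter_posS i))%N.
    by rewrite /mulrefl !permM /srefl tpermL tpermR.
  have [|a /eqP Da] := IHk (mulrefl v i).
    rewrite -ltnS; apply: leq_trans ltvk; rewrite ltnS.
    by have := perm_length_asc asc; rewrite mulreflK.
  by exists (rcons a i); rewrite foldl_rcons Da demazure_reflE asc mulreflK.
exists [::]; apply/eqP/permP => /= x; rewrite perm1.
have v_incr x1 x2 : (x1 < x2)%N -> (v x1 < v x2)%N.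
  case: x1 x2 => x1 lt1 [x2 lt2] /=; elim: x2 lt2 => // x2 IH lt2.
  have lt2' : (x2 < n.-1)%N by case: (n) lt2.
  have step : (v (Ordinal (ltnW lt2)) < v (Ordinal lt2))%N.
    have := asc (Ordinal lt2'); rewrite -leqNgt leq_eqVlt.
    have -> : letter_pos (Ordinal lt2') = Ordinal (ltnW lt2) by apply: val_inj.
    have -> : letter_posS (Ordinal lt2') = Ordinal lt2 by apply: val_inj.
    case/orP=> // /eqP/val_inj/perm_inj/(congr1 val)/eqP.
    by rewrite /= eqn_leq ltnn andbF.
  rewrite ltnS leq_eqVlt => /orP[/eqP e|lt12].
    by have -> : Ordinal lt1 = Ordinal (ltnW lt2) by apply: val_inj.
  exact: ltn_trans (IH (ltnW lt2) lt12) step.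
have v_ge (y : 'I_n) : (y <= v y)%N.
  case: y => y lty /=; elim: y lty => // y IH lty.
  by apply: leq_ltn_trans (IH (ltnW lty)) (v_incr _ _ _) => /=.
have v_le : (v x <= x)%N.
  rewrite leqNgt; apply/negP => ltx.
  pose A := [set z : 'I_n | (x <= z)%N].
  have sub : [set v z | z in A] \proper A.
    apply/properP; split.
      by apply/fintype.subsetP=> q /imsetP[z]; rewrite !inE => lez ->{q}; apply: leq_trans (v_ge z).
    exists x; rewrite ?inE //; apply/imsetP=> -[z]; rewrite inE leq_eqVlt.
    case/orP=> [/eqP/val_inj<- e|ltz e]; first by rewrite -e ltnn in ltx.
    by have := leq_ltn_trans (v_ge x) (v_incr _ _ ltz); rewrite -e ltnn.
  by have := proper_card sub; rewrite card_imset ?ltnn //; apply: perm_inj.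
by apply/val_inj/eqP; rewrite /= eqn_leq v_ge v_le.
Qed.

(* u o v is computed from any expression v = 1 o s_(a_1) o ... o s_(a_k); the
   lemmas below show that this is the unique associative product on 'S_n with
   unit 1 such that w o s_i = [demazure_refl w i]. *)
Definition demazure u v : 'S_n :=
  foldl (@demazure_refl n) u (xchoose (demazure_word_ex v)).

Let ldemazure_refl i w : 'S_n :=
  if ((w^-1)%g (letter_pos i) < (w^-1)%g (letter_posS i))%N
  then (w * srefl i)%g else w.

Let demazure_reflC i j w :
  demazure_refl (ldemazure_refl i w) j = ldemazure_refl i (demazure_refl w j).
Proof.
have sreflV k : ((@srefl n k)^-1 = srefl k)%g by rewrite /srefl tpermV.
have mulE k u x : (u * srefl k)%g x = srefl k (u x) by rewrite permM.
have invE k u x : ((mulrefl u k)^-1)%g x = srefl k ((u^-1)%g x).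
  by rewrite /mulrefl invMg permM sreflV.
have [/eqP[e1 e2]|n1] :=
  boolP ((w (letter_pos j), w (letter_posS j)) == (letter_pos i, letter_posS i)).
  have i1 : (w^-1)%g (letter_pos i) = letter_pos j by rewrite -e1 permK.
  have i2 : (w^-1)%g (letter_posS i) = letter_posS j by rewrite -e2 permK.
  rewrite {1}/ldemazure_refl i1 i2 /= ltnSn (demazure_reflE w) e1 e2 /= ltnSn.
  rewrite /ldemazure_refl !invE i1 i2 demazure_reflE !mulE e1 e2 /srefl !tpermL !tpermR.
  rewrite /= !ltnNge leqnSn /= /mulrefl /srefl -e1 -e2.
  by rewrite leqnSn -tpermJ conjgE mulKVg.
have [/eqP[e2 e1]|n2] :=
  boolP ((w (letter_posS j), w (letter_pos j)) == (letter_pos i, letter_posS i)).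
  have i1 : (w^-1)%g (letter_pos i) = letter_posS j by rewrite -e2 permK.
  have i2 : (w^-1)%g (letter_posS i) = letter_pos j by rewrite -e1 permK.
  have fixl : ldemazure_refl i w = w.
    by rewrite /ldemazure_refl i1 i2 /= ltnNge leqnSn.
  have fixr : demazure_refl w j = w.
    by rewrite demazure_reflE e1 e2 /= ltnNge leqnSn.
  by rewrite fixl fixr fixl.
have n1' : ((w^-1)%g (letter_pos i), (w^-1)%g (letter_posS i))
           != (letter_pos j, letter_posS j).
  by apply: contraNneq n1 => -[<- <-]; rewrite !permKV.
have n2' : ((w^-1)%g (letter_posS i), (w^-1)%g (letter_pos i))
           != (letter_pos j, letter_posS j).
  by apply: contraNneq n2 => -[<- <-]; rewrite !permKV.
have hl : ((w * srefl i)%g (letter_pos j) < (w * srefl i)%g (letter_posS j))%N =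
          (w (letter_pos j) < w (letter_posS j))%N by rewrite !mulE srefl_ltE.
have hr : ((mulrefl w j)^-1%g (letter_pos i) < (mulrefl w j)^-1%g (letter_posS i))%N =
          (w^-1%g (letter_pos i) < w^-1%g (letter_posS i))%N.
  by rewrite !invE srefl_ltE.
rewrite (demazure_reflE w) /ldemazure_refl.
case: (boolP (w^-1%g (letter_pos i) < _)%N) => b1;
  case: (boolP (w (letter_pos j) < _)%N) => b2;
  rewrite ?hr ?b1 ?(negPf b1) demazure_reflE ?hl ?b2 ?(negPf b2) //.
by rewrite /mulrefl mulgA.
Qed.

Let foldl_ldemazure i w a :
  foldl (@demazure_refl n) (ldemazure_refl i w) a =
  ldemazure_refl i (foldl (@demazure_refl n) w a).
Proof. by elim: a w => //= k a IHa w; rewrite demazure_reflC IHa. Qed.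

Let foldl_foldr w a b :
  foldl (@demazure_refl n) (foldr ldemazure_refl w a) b =
  foldr ldemazure_refl (foldl (@demazure_refl n) w b) a.
Proof. by elim: a w => //= k a IHa w; rewrite foldl_ldemazure IHa. Qed.

Let demazure_refl1 i : demazure_refl 1%g i = srefl i.
Proof. by rewrite demazure_reflE !perm1 ltnSn /mulrefl mulg1. Qed.

Let foldl1E a : foldl (@demazure_refl n) 1%g a = foldr ldemazure_refl 1%g a.
Proof.
elim/last_ind: a => // a i IHa; rewrite foldl_rcons foldr_rcons IHa.
have -> : ldemazure_refl i 1%g = demazure_refl 1%g i.
  by rewrite demazure_refl1 /ldemazure_refl invg1 !perm1 ltnSn mul1g.
exact: (foldl_foldr 1%g a [:: i]).
Qed.

Let demazureE u v :
  demazure u v = foldr ldemazure_refl v (xchoose (demazure_word_ex u)).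
Proof.
have Wv := eqP (xchooseP (demazure_word_ex v)).
have Wu := eqP (xchooseP (demazure_word_ex u)).
by rewrite /demazure -{1}Wu foldl1E foldl_foldr Wv.
Qed.

Lemma demazureA : associative demazure.
Proof.
move=> u v w; rewrite demazureE {1}/demazure.
by rewrite -foldl_foldr -demazureE.
Qed.

Lemma demazure1g : left_id 1%g demazure.
Proof. by move=> v; apply/eqP; apply: (xchooseP (demazure_word_ex v)). Qed.

Lemma demazureg1 : right_id 1%g demazure.
Proof.
move=> u; rewrite demazureE -foldl1E; apply/eqP.
exact: (xchooseP (demazure_word_ex u)).
Qed.

Lemma demazure_srefl w i : demazure w (srefl i) = demazure_refl w i.
Proof.
have Ww := eqP (xchooseP (demazure_word_ex w)).
rewrite demazureE -demazure_refl1 -[in RHS]Ww foldl1E.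
exact/esym/(foldl_foldr 1%g _ [:: i]).
Qed.

Lemma demazure_unique (op : 'S_n -> 'S_n -> 'S_n) :
    associative op -> right_id 1%g op ->
    (forall w i, op w (srefl i) = demazure_refl w i) ->
  op =2 demazure.
Proof.
move=> opA op1 op_refl u v; have [a /eqP <-] := demazure_word_ex v.
elim/last_ind: a => [|a i IHa]; first by rewrite /= op1 demazureg1.
rewrite foldl_rcons -{1}op_refl opA IHa op_refl.
by rewrite -[in RHS]demazure_srefl demazureA demazure_srefl.
Qed.

End DemazureProduct.

Local Open Scope classical_set_scope.

(* Polynomials and power series in the variables x_i.  All integers i are
   allowed as indices here, but x_0 never occurs: compatible sequences, alphabets
   of tableaux and path variables only involve nonzero indices. *)

Definition xvar (i : int) : {malg int[{cmonom int}]} := << ucm i >>.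

(* A formal power series is the function giving its coefficients. *)
Definition xseries : Type := {cmonom int} -> int.

(* The sum of a family of polynomials indexed by A, taken coefficientwise.  Each
   coefficient is a finitely supported sum, which is the right notion whenever
   every monomial occurs in finitely many members of the family; see
   [schubert_summable] and [ivanovQ_summable]. *)
Definition series_sum (I : choiceType) (A : set I)
    (F : I -> {malg int[{cmonom int}]}) : xseries :=
  fun m => \sum_(i \in A) (F i)@_m.

Lemma xvar_dvd (i : int) (g : {malg int[{cmonom int}]}) (m : {cmonom int}) :
  (xvar i * g)@_m != 0 -> i \in finsupp (cmonom_val m).
Proof.
rewrite mcoeff_neq0 => /msuppM_le[k1 [k2 []]].
rewrite /xvar msuppU1 => /fset1P-> _ ->.
by rewrite mem_finsupp; have := cmM i (ucm i) k2; rewrite cmUU => ->.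
Qed.

Lemma finite_words (T : choiceType) (L : seq T) (k : nat) :
  finite_set [set s : seq T | size s = k /\ {subset s <= L}].
Proof.
pose f (u : k.-tuple (seq_sub L)) : seq T := [seq val x | x <- u].
apply: (@sub_finite_set _ _ (f @` [set: k.-tuple (seq_sub L)])).
  move=> s /= [sz sL].
  have [u us] : exists u : seq (seq_sub L), [seq val x | x <- u] = s.
    elim: s {sz} sL => [|x s IHs] sL; first by exists [::].
    have [|u <-] := IHs; first by move=> z zs; apply: sL; rewrite inE zs orbT.
    have xL : x \in L by apply: sL; rewrite mem_head.
    by exists (SeqSub xL :: u).
  have uk : size u == k by rewrite -sz -us size_map.
  by exists (Tuple uk).
exact/finite_image/finite_finset.
Qed.

(* Back-stable involution Schubert polynomials *)

(* s_(a_l) o ... o s_(a_1) o 1 o s_(a_1) o ... o s_(a_l) *)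
Definition demazure_palindrome n (a : seq 'I_n.-1) : 'S_n :=
  foldl (fun w i => demazure (demazure (srefl i) w) (srefl i)) 1%g a.

Definition involution_words n (y : 'S_n) : set (seq 'I_n.-1) :=
  [set a | y = @demazure_palindrome n a /\
     forall b : seq 'I_n.-1, y = @demazure_palindrome n b -> (size a <= size b)%N].

(* The word a_1 ... a_l is a sequence of letters i : 'I_n.-1 standing for i + 1;
   sequences are indexed from 0. *)
Definition compatible n (a : seq 'I_n.-1) : set (seq int) :=
  let letter r := (nth 0 [seq (val k).+1 | k <- a] r)%N in
  [set i | [/\ size i = size a,
     (forall z, z \in i -> z != 0),
     (forall r, (r < size a)%N -> nth 0 i r <= (letter r)%:Z),
     (forall r, (r.+1 < size a)%N -> nth 0 i r <= nth 0 i r.+1) &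
     (forall r, (r.+1 < size a)%N -> (letter r < letter r.+1)%N ->
        nth 0 i r < nth 0 i r.+1)]].

Definition inv_schubert_index n (y : 'S_n) : set (seq 'I_n.-1 * seq int) :=
  [set ai | involution_words y ai.1 /\ compatible ai.1 ai.2].

Definition inv_schubert n (y : 'S_n) : xseries :=
  series_sum (inv_schubert_index y)
    (fun ai => \prod_(z <- ai.2) xvar z).

Lemma schubert_summable n (y : 'S_n) (m : {cmonom int}) :
  finite_set (inv_schubert_index y `&`
    [set ai | (\prod_(z <- ai.2) xvar z)@_m != 0]).
Proof.
have [[a1 [Da1 a1_min]]|no] := pselect (exists a, involution_words y a); last first.
  by apply: sub_finite_set (@finite_set0 _) => ai [[Ra _] _]; apply: no; exists ai.1.
apply: sub_finite_set (finite_setX (finite_words (enum 'I_n.-1) (size a1))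
  (finite_words (finsupp (cmonom_val m)) (size a1))).
move=> [a i] /= [[[Da a_min] [sz _ _ _ _]] /= nz].
have eq_sz : size a = size a1 by apply/eqP; rewrite eqn_leq a_min // a1_min.
split; split=> //; rewrite ?sz //; first by move=> x _; rewrite mem_enum.
move=> z zi; apply: (@xvar_dvd _ (\prod_(z' <- rem z i) xvar z')).
rewrite (perm_big _ (perm_to_rem zi)) big_cons in nz.
exact: nz.
Qed.

(* Multiparameter Schur Q-functions *)

(* (s, false) is the primed letter s' and (s, true) is the unprimed letter s. *)
Definition marked : Type := (int * bool)%type.

Definition marked_le (c d : marked) : bool :=
  (c.1 < d.1) || ((c.1 == d.1) && (c.2 ==> d.2)).

Definition marked_sign (c : marked) : {malg int[{cmonom int}]} :=
  if c.2 then 1 else -1.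

(* (a, b) is in D'_la, with rows and columns numbered from 1. *)
Definition shifted_box (la : seq nat) (a b : nat) : bool :=
  [&& 1 <= a, a <= size la, a <= b & b <= a + nth 0 la a.-1 - 1]%N.

(* A filling of D'_la is given by the list of its rows; the leftmost box of row a
   is (a, a). *)
Definition filling : Type := seq (seq (int * bool)).

Definition entry (T : filling) (a b : nat) : marked :=
  nth (0, false) (nth [::] T a.-1) (b - a)%N.

Record marked_shifted_tableau (S : set int) (la : seq nat) (T : filling) : Prop :=
  MarkedShiftedTableau {
    mst_shape : [seq size row | row <- T] = la;
    mst_alphabet : forall a b, shifted_box la a b -> S (entry T a b).1;
    mst_row_le : forall a b b', shifted_box la a b -> shifted_box la a b' ->
      (b <= b')%N -> marked_le (entry T a b) (entry T a b');
    mst_col_le : forall a a' b, shifted_box la a b -> shifted_box la a' b ->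
      (a <= a')%N -> marked_le (entry T a b) (entry T a' b);
    mst_col_unprimed : forall a a' b, shifted_box la a b -> shifted_box la a' b ->
      (a < a')%N -> entry T a b = entry T a' b -> ~~ (entry T a b).2;
    mst_row_primed : forall a b b', shifted_box la a b -> shifted_box la a b' ->
      (b < b')%N -> entry T a b = entry T a b' -> (entry T a b).2
  }.

Definition ivanov_weight (la : seq nat) (t : nat -> {malg int[{cmonom int}]})
    (T : filling) : {malg int[{cmonom int}]} :=
  \prod_(1 <= a < (size la).+1) \prod_(a <= b < a + nth 0%N la a.-1)
    (xvar (entry T a b).1 - marked_sign (entry T a b) * t (b - a + 1)%N).

(* Q_la(x_(-oo...j); t), for parameters t = (t_1, t_2, ...) with t_1 = 0; the
   value t 0 is irrelevant. *)
Definition ivanovQ (la : seq nat) (j : int) (t : nat -> {malg int[{cmonom int}]}) :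
    xseries :=
  series_sum
    [set T : seq (seq (int * bool)) |
       marked_shifted_tableau [set i : int | i != 0 /\ i <= j] la T]
    (ivanov_weight la t).

Lemma subrM0 (R : pzRingType) (x s y : R) : y = 0 -> x - s * y = x.
Proof. by move=> ->; rewrite mulr0 subr0. Qed.

Lemma shifted_prod_diag (R : comPzRingType) (la : seq nat) (F : nat -> nat -> R) a :
    (a < size la)%N -> (0 < nth 0%N la a)%N ->
  exists g, \prod_(1 <= a' < (size la).+1)
    \prod_(a' <= b < a' + nth 0%N la a'.-1) F a' b = F a.+1 a.+1 * g.
Proof.
move=> lta la_gt0.
rewrite (bigD1_seq a.+1) ?mem_index_iota ?iota_uniq //=.
rewrite big_ltn; last by rewrite -{1}[a.+1]addn0 ltn_add2l.
by rewrite -mulrA; eexists.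
Qed.

Lemma ivanovQ_summable (la : seq nat) (j : int)
    (t : nat -> {malg int[{cmonom int}]}) (m : {cmonom int}) : t 1%N = 0 ->
  finite_set ([set T : seq (seq (int * bool)) |
      marked_shifted_tableau [set i : int | i != 0 /\ i <= j] la T] `&`
    [set T | (ivanov_weight la t T)@_m != 0]).
Proof.
move=> t1; pose supp : seq int := finsupp (cmonom_val m).
pose L : seq (int * bool) :=
  [seq (zk, c) | zk <- [seq z + k%:Z | z <- supp, k <- iota 0 `|j - z|.+1],
                 c <- [:: false; true]].
apply: sub_finite_set (finite_image (reshape la) (finite_words L (sumn la))).
move=> T /= [mstT nz]; have sh := mst_shape mstT.
exists (flatten T); last by rewrite -sh -/(shape T) flattenK.
split=> [|c /flattenP[row]]; first by rewrite size_flatten /shape sh.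
move=> /(nthP [::])[a lta <-] /(nthP (0, false))[k ltk <-].
have ea : nth 0%N la a = size (nth [::] T a) by rewrite -sh (nth_map [::]).
have lta' : (a < size la)%N by rewrite -sh size_map.
have boxk k' : (k' < size (nth [::] T a))%N -> shifted_box la a.+1 (a.+1 + k').
  move=> lt; rewrite /shifted_box /= lta' leq_addr /= ea -addnBA; last exact: leq_ltn_trans lt.
  by rewrite leq_add2l -ltnS subn1 prednK //; apply: leq_ltn_trans lt.
have lt0 : (0 < size (nth [::] T a))%N by apply: leq_ltn_trans ltk.
have b0 := boxk _ lt0; have bk := boxk _ ltk; rewrite addn0 in b0.
set z := (entry T a.+1 a.+1).1; set x := nth _ _ k.
have ex : entry T a.+1 (a.+1 + k) = x by rewrite /entry addKn.
have zs : z \in supp.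
  have la_gt0 : (0 < nth 0%N la a)%N by rewrite ea.
  have [g Dg] := shifted_prod_diag
    (fun a b => xvar (entry T a b).1 - marked_sign (entry T a b) * t (b - a + 1)%N)
    lta' la_gt0.
  have D1 : t (a.+1 - a.+1 + 1)%N = 0 by rewrite subnn.
  have Dz := subrM0 (xvar z) (marked_sign (entry T a.+1 a.+1)) D1.
  move: nz; rewrite /ivanov_weight Dg /= -/z Dz.
  exact: xvar_dvd.
have := mst_row_le mstT b0 bk (leq_addr _ _); rewrite ex.
have := mst_alphabet mstT bk; rewrite ex => -[_ lexj].
have {}lexj : x.1 <= j by [].
move=> le_zx; have {}le_zx : z <= x.1.
  by case/orP: le_zx => [/ltW//|/andP[/eqP e _]]; rewrite /z e.
rewrite -/x [x]surjective_pairing; apply/allpairsP; exists x; split=> //.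
  apply/allpairsPdep; exists z, `|x.1 - z|%N; split=> //.
    rewrite mem_iota /= add0n ltnS -lez_nat !gez0_abs ?subr_ge0 ?lerD2r //.
    exact: le_trans lexj.
  by rewrite gez0_abs ?subr_ge0 // [RHS]addrC subrK.
by case: (x.2).
Qed.

(* Involutions, diagrams and shapes *)

Definition vexillary n (y : 'S_n) : Prop :=
  forall i1 i2 i3 i4 : 'I_n, (i1 < i2 < i3)%N -> (i3 < i4)%N ->
  ~ [&& y i2 < y i1, y i1 < y i4 & y i4 < y i3]%N.

Definition cyc n (y : 'S_n) : nat := #|[set C in porbits y | #|C| == 2%N]%SET|.

(* (i, j) stands for the position (i + 1, j + 1) of [n] x [n]. *)
Definition inv_diagram n (y : 'S_n) : {set 'I_n * 'I_n} :=
  [set p : 'I_n * 'I_n | [&& p.2 <= p.1, p.2 < y p.1 & p.1 < y p.2]%N]%SET.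

(* Ess(D), as a set of positions (a, b) with 1 <= a, b <= n *)
Definition essential_set n (D : {set 'I_n * 'I_n}) : set (nat * nat) :=
  [set q | exists2 p, p \in D /\ q = (p.1.+1, p.2.+1) &
     forall p', p' \in D ->
       (p'.1.+1, p'.2.+1) <> (q.1, q.2.+1) /\ (p'.1.+1, p'.2.+1) <> (q.1.+1, q.2)].

Definition transpose_partition (mu : seq nat) : seq nat :=
  [seq count (fun r => k < r)%N mu | k <- iota 0 (head 0 mu)%N].

Definition inv_shape n (y : 'S_n) : seq nat :=
  let rows := [seq #|[set b | (a, b) \in inv_diagram y]%SET| | a : 'I_n] in
  transpose_partition (sort geq [seq r <- rows | r != 0%N]).

(* Essential paths *)

Definition pos_le (p q : nat * nat) : bool := (q.1 <= p.1)%N && (p.2 <= q.2)%N.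

Record essential_path n (y : 'S_n) (P : seq (nat * nat)) : Prop := EssentialPath {
  ess_path_size : size P = n.+1;
  ess_path_bound : forall p, p \in P -> (p.1 <= n)%N /\ (p.2 <= n)%N;
  ess_path_decr : forall r, (r < n)%N ->
    pos_le (nth (0, 0)%N P r.+1) (nth (0, 0)%N P r) /\
    nth (0, 0)%N P r.+1 <> nth (0, 0)%N P r;
  ess_path_diag : (nth (0, 0)%N P 0).1 = (nth (0, 0)%N P 0).2;
  ess_path_ess : forall q, essential_set (inv_diagram y) q -> q \in P
}.

(* The variable attached to the step from p to q, which either increases the first
   coordinate by 1 or decreases the second one by 1. *)
Definition step_var (p q : nat * nat) : {malg int[{cmonom int}]} :=
  if q.1 == p.1.+1 then xvar q.1 else - xvar p.2.

(* x^P_r for 1 <= r <= size P, where the positions of P are numbered from 1; the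
   other values are irrelevant. *)
Definition path_var (P : seq (nat * nat)) (r : nat) : {malg int[{cmonom int}]} :=
  if (1 < r <= size P)%N
  then step_var (nth (0, 0)%N P r.-2) (nth (0, 0)%N P r.-1) else 0.

(* Main.v *)
(* Both sides are truncated to the variables of index >= -N, for N large with
   respect to the monomial m, and the nonzero indices >= -N are relabelled by
   natural numbers.

   On the Schubert side, involution words are chains of strict steps for the
   conjugation by the Demazure product, and the truncated series is a product of
   operators 1 + x_k d_i applied to the delta function at the identity, where d_i
   undoes such a step at a descent i.  These operators satisfy the Yang-Baxter
   equation, so exchanging x_k and x_(k+1) costs one more factor; this gives the
   divided difference recursion.

   On the Q-side, adding a letter to the alphabet acts on the row polynomials
   g_r = 2 prod_(2 <= s <= r) (X - t_s) by a signed sum over the rows that are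
   dropped (the strips of largest entries).  Iterating defines a symmetric function
   of the variables, multilinear and alternating in a sequence of polynomials; it
   factors when the first polynomial vanishes at all variables but one.

   The two sides meet by induction on the number of 2-cycles, each of which
   accounts for the factor 2 of one g_r.  The largest part r of the shape is the
   length of a longest arc (b, c) of y, chosen such that the path passes through
   (c - 1, b) after r - 1 steps; then
   g_r = 2 prod_(j < i < c) (X + x_i) prod_(b < i <= j) (X - x_i).
   Removing (b, c) removes the first box of each row of the diagram and creates no
   essential box.  If the arc is (lo, hi), outside of which y is the identity, both
   sides are x_lo prod_(lo < i < hi) (x_lo + x_i) times their values for the
   smaller involution; an arbitrary longest arc is moved there by divided
   differences, which strip the linear factors one by one. *)

Require Import Defs.
From mathcomp Require Import all_boot all_order all_algebra all_fingroup.
From mathcomp Require Import finmap multinomials.monalg.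
From mathcomp Require Import boolp classical_sets fsbigop.
From mathcomp Require Import ring zify.

Set Implicit Arguments.
Unset Strict Implicit.
Unset Printing Implicit Defensive.

Import Order.TTheory GRing.Theory Num.Theory.
Local Open Scope ring_scope.

(** * Q-functions by adding one variable at a time *)

(** The polynomial g_r encodes a row: x g_r(x) is the total weight of a row of length r filled with
    x' and x only, and the 2 is the free mark of its first box, where t_1 = 0. Summing out x turns g
    into ((X + x) g - 2x g(x)) / (X - x), so a factor X - x becomes X + x; evaluated at x_lo, these
    factors give the x_lo + x_i of the Q-side. On the Schubert side the same sums come from the
    Yang-Baxter equation. The operators d_i d_(i+1) and d_(i+1) d_i agree on the delta function,
    since the words i, i+1 and i+1, i lead to the same involution. So the factor of x_lo may be read
    in the opposite order, and moving it past the factor of x_i leaves 1 + (x_lo + x_i) d_i. The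
    obstacle is that the parameters t are made of the variables: exchanging x_k and x_(k+1) also
    changes the row polynomials. The choice of the arc (b, c) on the path resolves this: the
    polynomials of the shorter rows are read off the path before it reaches the arc, so they involve
    only the x_i with b < i < c. Exchanges of variables at or outside the ends of the arc then act
    on the first polynomial alone. *)

Section SignedStep.
Variables (R : comNzRingType) (V : Type).
Implicit Types (T : V -> V) (v : V -> R) (w : seq V -> R) (g h : V) (l : seq V).

(* [w] applied to [map T l], plus the terms where one entry is dropped: it is
   replaced by its [v]-value, with the sign of its distance to the end. *)
Fixpoint step T v w l : R :=
  if l is g :: l' then
    step T v (fun s => w (T g :: s)) l' + (-1) ^+ size l' * v g * w (map T l')
  else w [::].

Fixpoint drop_one T v w l : R :=
  if l is g :: l' then
    drop_one T v (fun s => w (T g :: s)) l' + (-1) ^+ size l' * v g * w (map T l')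
  else 0.

Lemma stepE T v w l : step T v w l = w (map T l) + drop_one T v w l.
Proof. by elim: l w => [|g l IHl] w /=; rewrite ?addr0 // IHl addrA. Qed.

Lemma eq_step T v w w' l : w =1 w' -> step T v w l = step T v w' l.
Proof.
by elim: l w w' => [|g l IHl] w w' ew /=; rewrite ew // (IHl _ (fun s => w' (T g :: s))).
Qed.

Lemma step_lin T v a w w' l :
  step T v (fun s => w s + a * w' s) l = step T v w l + a * step T v w' l.
Proof. by elim: l w w' => [|g l IHl] w w' //=; rewrite IHl; ring. Qed.

Lemma step_scale T v a w l : step T v (fun s => a * w s) l = a * step T v w l.
Proof. by elim: l w => [|g l IHl] w //=; rewrite IHl; ring. Qed.

Lemma step_eq0 T v w l : w =1 (fun=> 0) -> step T v w l = 0.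
Proof. by elim: l w => [|g l IHl] w ew /=; rewrite ew // IHl // mulr0 addr0. Qed.

Lemma step_sum T v (I : Type) (r : seq I) (c : I -> R) (w : I -> seq V -> R) l :
  step T v (fun s => \sum_(i <- r) c i * w i s) l = \sum_(i <- r) c i * step T v (w i) l.
Proof.
elim: r => [|i r IHr]; first by rewrite big_nil step_eq0 // => s; rewrite big_nil.
rewrite big_cons -IHr addrC -step_lin; apply: eq_step => s.
by rewrite big_cons addrC.
Qed.

Lemma eq_drop_one T T' v v' w l :
  T =1 T' -> v =1 v' -> drop_one T v w l = drop_one T' v' w l.
Proof.
move=> eT ev; elim: l w => [|g l IHl] w //=.
by rewrite IHl ev eT (eq_map eT).
Qed.

Lemma drop_one_map T T' v w l :
  drop_one T v w (map T' l) = drop_one (T \o T') (v \o T') w l.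
Proof. by elim: l w => [|g l IHl] w //=; rewrite IHl size_map -map_comp. Qed.

Lemma eq_drop_one_fun T v w w' l : w =1 w' -> drop_one T v w l = drop_one T v w' l.
Proof.
elim: l w w' => [|g l IHl] w w' ew //=; rewrite ew.
by rewrite (IHl _ (fun s => w' (T g :: s))).
Qed.

(** Each term on the left is evaluated at a list one shorter than [l], whence the global sign. It
    accounts for an entry dropped after a later one has gone: it is then one place closer to the
    end. *)
Lemma drop_one_sign T T' v w l :
  drop_one T v (fun s => (-1) ^+ size s * w (map T' s)) l =
  - (-1) ^+ size l * drop_one (T' \o T) v w l.
Proof.
have aux b : drop_one T v (fun s => (-1) ^+ (size s + b) * w (map T' s)) l =
  - (-1) ^+ (size l + b) * drop_one (T' \o T) v w l.
  elim: l w b => [|g l IHl] w b /=; first by rewrite mulr0.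
  have := IHl (fun r => w (T' (T g) :: r)) b.+1.
  rewrite (@eq_drop_one_fun _ _ _ (fun s => (-1) ^+ ((size s).+1 + b) *
     w (T' (T g) :: map T' s))) => [->|r]; last by rewrite addnS addSn.
  rewrite size_map addnS addSn !exprS -map_comp;
  ring.
rewrite -[size l in RHS]addn0 -aux; apply: eq_drop_one_fun => s.
by rewrite addn0.
Qed.

Lemma step_map T T' v w l :
  step T v w (map T' l) = w (map (T \o T') l) + drop_one (T \o T') (v \o T') w l.
Proof. by rewrite stepE drop_one_map -map_comp. Qed.

(** Split off the head [g]: both steps keep it, or exactly one drops it. Terms of the second kind
    involve the sum of the two values that [g] can take and, when the other step drops [h], a
    difference of two products, since the order of dropping changes the sign. The hypotheses on [v1]
    and [v2] say that both expressions are symmetric in the two steps. *)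
Lemma stepC T1 T2 v1 v2 w l :
    T1 \o T2 =1 T2 \o T1 ->
    (forall g, v1 g + v2 (T1 g) = v2 g + v1 (T2 g)) ->
    (forall g h, v1 g * v2 (T1 h) - v2 (T1 g) * v1 h =
                 v2 g * v1 (T2 h) - v1 (T2 g) * v2 h) ->
  step T1 v1 (step T2 v2 w) l = step T2 v2 (step T1 v1 w) l.
Proof.
move=> TC vD vA.
have expand U1 U2 u1 u2 f g s :
    step U1 u1 (step U2 u2 f) (g :: s) =
    step U1 u1 (step U2 u2 (fun s => f (U2 (U1 g) :: s))) s +
    (-1) ^+ size s * ((u1 g + u2 (U1 g)) * f (map (U2 \o U1) s) +
      drop_one (U2 \o U1) (fun h => u1 g * u2 (U1 h) - u2 (U1 g) * u1 h) f s).
  rewrite /= step_map.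
  rewrite (@eq_step _ _ _ (fun r => step U2 u2 (fun s => f (U2 (U1 g) :: s)) r +
     u2 (U1 g) * ((-1) ^+ size r * f (map U2 r)))); last by move=> r; ring.
  rewrite step_lin [X in _ * X]stepE drop_one_sign size_map -map_comp.
  have -> : drop_one (U2 \o U1) (fun h => u1 g * u2 (U1 h) - u2 (U1 g) * u1 h) f s =
      u1 g * drop_one (U2 \o U1) (u2 \o U1) f s - u2 (U1 g) * drop_one (U2 \o U1) u1 f s.
    by elim: s f => [|a s IHs] f /=; rewrite ?IHs; ring.
  by ring.
elim: l w => // g l IHl w; rewrite !expand IHl vD.
have TC' : T2 \o T1 =1 T1 \o T2 by move=> h; rewrite TC.
rewrite -(eq_drop_one _ _ TC' (vA g)) -(eq_map TC'); congr (_ + _).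
by apply: eq_step => s; apply: eq_step => r; have /= -> := TC g.
Qed.

End SignedStep.

(** * Multilinear and alternating functions of a sequence *)

Section Alternating.
Variables (R : comNzRingType) (V : lmodType R).
Implicit Types (T : V -> V) (v : V -> R) (w : seq V -> R).

Definition multilinear w := forall p (g h : V) c q,
  w (p ++ (g + c *: h) :: q) = w (p ++ g :: q) + c * w (p ++ h :: q).

Definition alternating w := forall p (g : V) q, w (p ++ g :: g :: q) = 0.

Lemma multilinear_cons w g : multilinear w -> multilinear (fun s => w (g :: s)).
Proof. by move=> wl p; apply: (wl (g :: p)). Qed.

Lemma alternating_cons w g : alternating w -> alternating (fun s => w (g :: s)).
Proof. by move=> wl p; apply: (wl (g :: p)). Qed.

Lemma multilinear_step T v w :
    (forall g h c, T (g + c *: h) = T g + c *: T h) ->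
    (forall g h c, v (g + c *: h) = v g + c * v h) ->
  multilinear w -> multilinear (step T v w).
Proof.
move=> lT lv lw p; elim: p w lw => [|k p IHp] w lw g h c q /=.
  rewrite lT lv; rewrite (@eq_step _ _ _ _ _ (fun s => w (T g :: s) + c * w (T h :: s))).
    by rewrite step_lin; ring.
  by move=> s; apply: (lw [::]).
rewrite IHp; last exact: multilinear_cons.
by rewrite !map_cat /= lT lw !size_cat /=; ring.
Qed.

(** Dropping one or the other of two equal neighbours leaves the same list, with opposite signs. *)
Lemma alternating_step T v w : alternating w -> alternating (step T v w).
Proof.
move=> aw p; elim: p w aw => [|k p IHp] w aw g q /=.
  rewrite step_eq0; last by move=> s; apply: (aw [::]).
  by rewrite exprS; ring.
rewrite IHp; last exact: alternating_cons.
by rewrite map_cat /= aw mulr0 addr0.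
Qed.

Lemma multilinear_head_sum w (I : Type) (r : seq I) (c : I -> R) (g : I -> V) s :
  multilinear w ->
  w (\sum_(i <- r) c i *: g i :: s) = \sum_(i <- r) c i * w (g i :: s).
Proof.
move=> lw; have w0 : w (0 :: s) = 0.
  have := lw [::] 0 0 (-1) s; rewrite scaler0 addr0 /= mulN1r subrr; exact.
elim: r => [|i r IHr]; first by rewrite !big_nil.
by rewrite !big_cons -IHr addrC (lw [::] _ _ _ s) addrC.
Qed.

Lemma alternating_subr_next w g h c s : multilinear w -> alternating w ->
  w (g + c *: h :: h :: s) = w (g :: h :: s).
Proof. by move=> lw aw; rewrite (lw [::]) /= (aw [::]) mulr0 addr0. Qed.

End Alternating.

(** * Summing out one variable *)

Section OneVariable.
Variable R : comNzRingType.
Implicit Types (x y z : R) (g h : {poly R}) (w : seq {poly R} -> R).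

Definition divdiff x g : {poly R} := Pdiv.CommonRing.rdivp (g - g.[x]%:P) ('X - x%:P).

Lemma divdiffE x g : divdiff x g * ('X - x%:P) = g - g.[x]%:P.
Proof.
rewrite /divdiff.
have [q ->] : exists q, g - g.[x]%:P = q * ('X - x%:P).
  by apply/factor_theorem; rewrite /root !hornerE subrr.
by rewrite Pdiv.RingMonic.rdivp_mull ?monicXsubC.
Qed.

Lemma monicXsubC_inj x : injective (fun g => g * ('X - x%:P)).
Proof.
exact: monic_rreg (monicXsubC x).
Qed.

(* Summing out the letters x' and x (the largest of the alphabet) replaces the
   row polynomial g by [tau x g]; [value x g] is the weight of a row filled by
   them entirely. *)
Definition tau x g : {poly R} := g + (2%:R * x) *: divdiff x g.
Definition value x g : R := x * g.[x].
Definition qstep x := step (tau x) (value x).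

Lemma tauE x g : tau x g * ('X - x%:P) = g * ('X + x%:P) - (2%:R * x * g.[x])%:P.
Proof.
rewrite mulrDl -scalerAl divdiffE -mul_polyC rmorphM /= rmorph_nat.
by rewrite [RHS]addrC !rmorphM /= !rmorph_nat; ring.
Qed.

Lemma divdiff_lin x g h c : divdiff x (g + c *: h) = divdiff x g + c *: divdiff x h.
Proof.
apply: (@monicXsubC_inj x); rewrite /= mulrDl -scalerAl !divdiffE !hornerE.
by rewrite -!mul_polyC rmorphD rmorphM /=; ring.
Qed.

Lemma tau_lin x g h c : tau x (g + c *: h) = tau x g + c *: tau x h.
Proof. by rewrite /tau divdiff_lin -!mul_polyC !rmorphM /= ; ring. Qed.

Lemma value_lin x g h c : value x (g + c *: h) = value x g + c * value x h.
Proof. by rewrite /value hornerD hornerZ; ring. Qed.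

Lemma tau_mulX x g : tau x (g * ('X - x%:P)) = g * ('X + x%:P).
Proof.
apply: (@monicXsubC_inj x); rewrite /= tauE hornerM hornerXsubC subrr !mulr0 polyC0 subr0.
by ring.
Qed.

Lemma value_mulX x g : value x (g * ('X - x%:P)) = 0.
Proof. by rewrite /value hornerM hornerXsubC subrr !mulr0. Qed.

Lemma qstepC x y w s : GRing.lreg (x - y) -> qstep x (qstep y w) s = qstep y (qstep x w) s.
Proof.
move=> xy.
have dE g a b : g.[a] = g.[b] + (a - b) * (divdiff b g).[a].
  have := congr1 (horner^~ a) (divdiffE b g).
  rewrite /= hornerM hornerXsubC hornerD hornerN hornerC => e.
  by rewrite [(a - b) * _]mulrC e; ring.
(* Symmetry of the divided difference (g(x) - g(y)) / (x - y); this is where [x - y] is cancelled.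
   The conditions of [stepC] then become ring identities. *)
have dC g : (divdiff y g).[x] = (divdiff x g).[y].
  apply: xy; have e1 : (x - y) * (divdiff y g).[x] = g.[x] - g.[y].
    by rewrite [g.[x]](dE g x y); ring.
  by rewrite e1 [g.[y]](dE g y x); ring.
apply: stepC => [g|g|g h].
- apply: (@monicXsubC_inj x); rewrite /= tauE.
  apply: (@monicXsubC_inj y); rewrite /= mulrBl.
  rewrite (_ : tau y g * ('X + x%:P) * ('X - y%:P) =
     (tau y g * ('X - y%:P)) * ('X + x%:P)); last by ring.
  rewrite tauE [RHS](_ : _ = (tau y (tau x g) * ('X - y%:P)) * ('X - x%:P)); last by ring.
  rewrite tauE [X in _ = X](_ : _ = (tau x g * ('X - x%:P)) * ('X + y%:P) -
    (2 * y * (tau x g).[y])%:P * ('X - x%:P)); last by ring.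
  rewrite tauE /tau !hornerE dC (dE g x y) dC !rmorphM !rmorphD !rmorphM /= !rmorphB.
  by rewrite !rmorph_nat /=; ring.
- by rewrite /value /tau !hornerE dC; ring.
- rewrite /value /tau !hornerD !hornerZ (dC g) (dC h) (dE g x y) (dE h x y) (dC g) (dC h).
  by ring.
Qed.

(** The head of [xs] is the largest letter and is summed out first; over the empty alphabet only the
    empty shape has a filling. *)
Fixpoint qfun (xs : seq R) : seq {poly R} -> R :=
  if xs is x :: xs' then qstep x (qfun xs') else fun s => (nilp s)%:R.

Lemma multilinear_qfun xs : multilinear (qfun xs).
Proof.
elim: xs => [|x xs IHxs]; first by move=> p g h c q /=; rewrite /nilp !size_cat !addnS mulr0 addr0.
by apply: multilinear_step => // *; rewrite ?tau_lin ?value_lin.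
Qed.

Lemma alternating_qfun xs : alternating (qfun xs).
Proof.
elim: xs => [|x xs IHxs]; first by move=> p g q /=; rewrite /nilp !size_cat !addnS.
exact: alternating_step.
Qed.

Lemma qfun_nil xs : qfun xs [::] = 1.
Proof. by elim: xs. Qed.

Lemma qfun_swap xs x y ys s : GRing.lreg (x - y) ->
  qfun (xs ++ x :: y :: ys) s = qfun (xs ++ y :: x :: ys) s.
Proof.
move=> xy; elim: xs s => [|z xs IHxs] s /=; first exact: qstepC.
exact: eq_step.
Qed.

(* The first factor vanishes at every variable but the innermost one, so the
   first argument can only be dropped at the last step. *)
Lemma qfun_vanish xs x0 h s :
  qfun (rcons xs x0) (h * \prod_(x <- xs) ('X - x%:P) :: s) =
  value x0 h * \prod_(x <- xs) (x0 + x) * qfun xs s.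
Proof.
elim: xs h s => [|x xs IHxs] h s.
  rewrite !big_nil !mulr1 /= /qstep /=; case: s => [|g s] /=.
    by rewrite add0r mul1r.
  by rewrite !mulr0 !addr0 step_eq0.
have -> : h * \prod_(z <- x :: xs) ('X - z%:P) =
    h * (\prod_(z <- xs) ('X - z%:P)) * ('X - x%:P) by rewrite big_cons; ring.
rewrite rcons_cons /= {1}/qstep /= value_mulX mulr0 mul0r addr0.
rewrite tau_mulX mulrAC big_cons.
rewrite (@eq_step _ _ _ _ _ (fun r => value x0 h * ((x0 + x) * \prod_(x <- xs) (x0 + x)) * qfun xs r)).
  by rewrite step_scale.
move=> r; rewrite IHxs /value hornerM hornerD hornerX hornerC; ring.
Qed.

End OneVariable.

(** * Branching rule for the row polynomials *)

Section Branching.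
Variables (R : comNzRingType) (x : R) (t : nat -> R).
Implicit Types (w : seq {poly R} -> R) (q r lo : nat) (la mu : seq nat).

(* The row polynomials: for t_1 = 0, [qfun xs (map gpoly la)] is Q_la(xs; t). *)
Definition gpoly r : {poly R} := 2%:R%:P * \prod_(2 <= s < r.+1) ('X - (t s)%:P).

Lemma horner_gpoly r a : (gpoly r).[a] = 2%:R * \prod_(2 <= s < r.+1) (a - t s).
Proof.
rewrite hornerM hornerC horner_prod; congr (_ * _).
by apply: eq_bigr => s _; rewrite hornerXsubC.
Qed.

Lemma gpolyS r : (0 < r)%N -> gpoly r.+1 = gpoly r * ('X - (t r.+1)%:P).
Proof. by case: r => // r _; rewrite /gpoly big_nat_recr //= mulrA. Qed.

(** Weight of the boxes q + 1, ..., r of a row of length [r], filled with the largest letter, above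
    a row of length [lo]. All but the first are unprimed. The first may carry either mark, with sum
    2x, unless q = lo > 0: it then lies above the last box of the next row, which also carries the
    largest letter, and the column condition forces a prime. *)
Definition strip_weight lo q r : R :=
  if q == r then 1
  else (if (q == lo) && (0 < lo)%N then x + t q.+1 else 2%:R * x) *
       \prod_(q.+2 <= s < r.+1) (x - t s).

Lemma strip_weightS lo q r : (q < r)%N ->
  strip_weight lo q r.+1 = (x - t r.+1) * strip_weight lo q r.
Proof.
move=> ltqr; rewrite /strip_weight (ltn_eqF ltqr) (ltn_eqF (leqW ltqr)).
by rewrite big_nat_recr ?ltnS //= mulrA mulrC.
Qed.

Lemma tau_gpolyS r : (0 < r)%N ->
  tau x (gpoly r.+1) = gpoly r.+1 + (x + t r.+1) *: gpoly r + (x - t r.+1) *: tau x (gpoly r).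
Proof.
move=> r_gt0; rewrite {1}gpolyS //.
rewrite (_ : gpoly r * _ = gpoly r * ('X - x%:P) + (x - t r.+1) *: gpoly r).
  by rewrite tau_lin tau_mulX gpolyS // -!mul_polyC rmorphD /=; ring.
by rewrite -!mul_polyC rmorphB /=; ring.
Qed.

Lemma strip_weightnn lo r : strip_weight lo r r = 1.
Proof. by rewrite /strip_weight eqxx. Qed.

Lemma sum_stripS m lo r : (m <= r)%N ->
  \sum_(m <= q < r.+2) strip_weight lo q r.+1 *: gpoly q =
  gpoly r.+1 + strip_weight lo r r.+1 *: gpoly r +
  (x - t r.+1) *: (\sum_(m <= q < r.+1) strip_weight lo q r *: gpoly q - gpoly r).
Proof.
move=> lemr; rewrite big_nat_recr 1?leqW //= big_nat_recr //= [in RHS]big_nat_recr //=.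
rewrite !strip_weightnn !scale1r addrK scaler_sumr addrC addrA -addrA.
rewrite -[RHS]addrA; congr (_ + _); rewrite addrC; congr (_ + _).
apply: eq_big_nat => q /andP[_ ltqr].
by rewrite scalerA strip_weightS.
Qed.

Lemma strip_weightSn lo r :
  strip_weight lo r r.+1 = if (r == lo) && (0 < lo)%N then x + t r.+1 else 2%:R * x.
Proof. by rewrite /strip_weight ltn_eqF // big_geq // mulr1. Qed.

Lemma tau_gpoly r : (0 < r)%N ->
  tau x (gpoly r) = \sum_(1 <= q < r.+1) strip_weight 0 q r *: gpoly q.
Proof.
elim: r => // r IHr _; case: (posnP r) => [->|r_gt0].
  rewrite big_nat1 strip_weightnn scale1r /gpoly big_geq // mulr1.
  by apply: (@monicXsubC_inj _ x); rewrite /= tauE hornerC !rmorphM /= rmorph_nat; ring.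
rewrite tau_gpolyS // sum_stripS // -IHr // strip_weightSn andbF.
by rewrite -!mul_polyC !rmorphD !rmorphN !rmorphM /= !rmorph_nat; ring.
Qed.

(** The multiple of g_lo that has the same value at [x] as g_r. *)
Definition next_coef lo r : R := \prod_(lo.+1 <= s < r.+1) (x - t s).

(** Compared with [tau_gpoly], the correction cancels all terms with q < lo and turns the
    coefficient 2x at q = lo into 2x - (x - t_(lo+1)) = x + t_(lo+1): the interlacing condition on
    strips and the forced prime. *)
Lemma tau_gpoly_next lo r : (0 < lo < r)%N ->
  tau x (gpoly r + - next_coef lo r *: gpoly lo) =
    \sum_(lo <= q < r.+1) strip_weight lo q r *: gpoly q.
Proof.
case/andP=> lo_gt0; elim: r => // r IHr; rewrite ltnS leq_eqVlt => /orP[/eqP <-|ltlor].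
  rewrite /next_coef big_nat1 tau_lin tau_gpolyS // sum_stripS // big_nat1.
  rewrite strip_weightSn eqxx lo_gt0 strip_weightnn.
  by rewrite -!mul_polyC !rmorphN !rmorphD !rmorphN /=; ring.
have r_gt0 : (0 < r)%N by apply: ltn_trans ltlor.
have -> : next_coef lo r.+1 = (x - t r.+1) * next_coef lo r.
  by rewrite /next_coef big_nat_recr 1?mulrC //= ltnW.
rewrite sum_stripS 1?ltnW // -IHr // !tau_lin tau_gpolyS //.
rewrite strip_weightSn (gtn_eqF ltlor) /=.
by rewrite -!mul_polyC !(rmorphN, rmorphD, rmorphM, rmorph_nat) /=; ring.
Qed.

Lemma value_gpoly_next lo r : (0 < lo < r)%N ->
  value x (gpoly r + - next_coef lo r *: gpoly lo) = 0.
Proof.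
case/andP=> lo_gt0 ltlor; rewrite value_lin /value !horner_gpoly /next_coef.
have -> : \prod_(2 <= s < r.+1) (x - t s) =
    \prod_(2 <= s < lo.+1) (x - t s) * \prod_(lo.+1 <= s < r.+1) (x - t s).
  by rewrite -big_cat_nat //= ?ltnS // ltnW.
by ring.
Qed.

(** Sum over the row lengths left when the boxes of the largest letter are removed. For positive
    parts, only the last row can become empty. Repeated lengths are kept in the sum; an alternating
    [w] vanishes on them. *)
Fixpoint branch (w : seq nat -> R) la : R :=
  if la is r :: la' then
    \sum_(head 0%N la' <= q < r.+1) strip_weight (head 0%N la') q r *
      branch (if q == 0%N then w else fun mu => w (q :: mu)) la'
  else w [::].

(** An alternating function does not see a multiple of the second polynomial subtracted from the
    first. The subtraction makes the first polynomial vanish at [x], so its row cannot be dropped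
    and [tau_gpoly_next] expands it. For the last row, the dropped term is the emptied row q = 0. *)
Lemma qstep_branch w la : multilinear w -> alternating w ->
    sorted gtn la -> all (leq 1) la ->
  qstep x w (map gpoly la) = branch (fun mu => w (map gpoly mu)) la.
Proof.
elim: la w => [|r [|lo la] IHla] w lw aw //.
  rewrite /= andbT => _ r_gt0; rewrite big_ltn //=.
  rewrite /qstep /= expr0 mul1r tau_gpoly // multilinear_head_sum // addrC; congr (_ + _).
    by rewrite /value horner_gpoly /strip_weight ltn_eqF //=; ring.
  by apply: eq_big_nat => q /andP[q_gt0 _]; rewrite (gtn_eqF q_gt0).
move=> /andP[ltlor so] /andP[r_gt0 pos].
have lo_gt0 : (0 < lo)%N by case/andP: pos.
have lor : (0 < lo < r)%N by rewrite lo_gt0.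
have lq : multilinear (qstep x w).
  by apply: multilinear_step => // *; rewrite ?tau_lin ?value_lin.
have aq : alternating (qstep x w) by apply: alternating_step.
rewrite [map _ _]/= -(alternating_subr_next _ _ (- next_coef lo r) _ lq aq).
have qcons g s : qstep x w (g :: s) = qstep x (fun l => w (tau x g :: l)) s +
    (-1) ^+ size s * value x g * w (map (tau x) s) by [].
rewrite qcons value_gpoly_next // mulr0 mul0r addr0 tau_gpoly_next //.
transitivity (\sum_(lo <= q < r.+1) strip_weight lo q r *
    qstep x (fun s => w (gpoly q :: s)) (map gpoly (lo :: la))).
  rewrite -step_sum; apply: eq_step => s; exact: multilinear_head_sum.
apply: eq_big_nat => q /andP[leloq _]; congr (_ * _).
have q_gt0 : (0 < q)%N by apply: leq_trans leloq.
rewrite IHla //; first by rewrite gtn_eqF.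
  exact: multilinear_cons.
exact: alternating_cons.
Qed.

End Branching.

(** * Marked shifted tableaux *)

Section Tableaux.
Local Notation letter := (int * bool)%type.
Implicit Types (c d : letter) (r : seq letter) (T : seq (seq letter)) (s : int).
Implicit Types (la mu : seq nat).

(* Weak order on marked letters, strict on primed letters in rows and on
   unprimed letters in columns. *)
Definition row_le c d := (c.1 < d.1) || ((c.1 == d.1) && d.2).
Definition col_le c d := (c.1 < d.1) || ((c.1 == d.1) && ~~ c.2).

(** The row [r2] starts one column to the right of the row [r1] above it, hence the index [k.+1]. *)
Definition col_ok r1 r2 :=
  (size r2 < size r1)%N &&
  all (fun k => col_le (nth (0, false) r1 k.+1) (nth (0, false) r2 k)) (iota 0 (size r2)).

Definition tableau T :=
  all (fun r => (r != [::]) && pairwise row_le r) T && sorted col_ok T.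

Lemma col_okP r1 r2 :
  reflect ((size r2 < size r1)%N /\ forall k, (k < size r2)%N ->
     col_le (nth (0, false) r1 k.+1) (nth (0, false) r2 k)) (col_ok r1 r2).
Proof.
apply: (iffP andP) => -[lt12 le12]; split=> //.
  by move=> k ltk; apply: (allP le12); rewrite mem_iota.
by apply/allP=> k; rewrite mem_iota add0n => /andP[_]; apply: le12.
Qed.

Lemma tableau_cons r T : tableau (r :: T) =
  [&& r != [::], pairwise row_le r, (if T is r2 :: _ then col_ok r r2 else true) & tableau T].
Proof.
rewrite /tableau /= -!andbA; case: (r != [::]) => //; case: (pairwise _ r) => //=.
case: T => [|r2 T] //=; case: (col_ok r r2); rewrite ?andbF //=.
Qed.

Lemma tableau_sizes T : tableau T -> sorted gtn (map size T).
Proof.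
case/andP=> _; rewrite sorted_map; apply: sub_sorted => r1 r2 /=.
by case/andP.
Qed.

Definition old s r := [seq c <- r | c.1 != s].
Definition new s r := [seq c <- r | c.1 == s].

Definition cut_rows s T := [seq r <- map (old s) T | r != [::]].
Definition strip_of s T := [seq (size (old s r), new s r) | r <- T].

(** The fillings whose weights add up to [strip_weight]. *)
Definition new_rows s lo q (n : nat) : seq (seq letter) :=
  if q == n then [:: [::]]
  else [seq (s, b) :: nseq (n - q).-1 (s, true) |
         b <- if (q == lo) && (0 < lo)%N then [:: false] else [:: false; true]].

Fixpoint strips s la : seq (seq (nat * seq letter)) :=
  if la is n :: la' then
    [seq p :: e | p <- [seq (q, r) | q <- index_iota (head 0%N la') n.+1,
                                     r <- new_rows s (head 0%N la') q n],
                  e <- strips s la']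
  else [:: [::]].

Definition remaining (e : seq (nat * seq letter)) := [seq q <- map fst e | q != 0%N].

Fixpoint glue (e : seq (nat * seq letter)) T :=
  if e is p :: e' then (head [::] T ++ p.2) :: glue e' (behead T) else [::].

(** [strips] bounds each row by its neighbour only, so remaining lengths may repeat; such strips
    belong to no tableau and are discarded by the sortedness test. *)
Fixpoint tableaux (al : seq int) la : seq (seq (seq letter)) :=
  if al is s :: al' then
    [seq glue e T | e <- strips s la,
       T <- if sorted gtn (remaining e) then tableaux al' (remaining e) else [::]]
  else if la is [::] then [:: [::]] else [::].

Lemma new_rowsP s lo q n r : (q <= n)%N ->
  reflect [/\ size r = (n - q)%N, all (fun c => c.1 == s) r, all snd (behead r)
     & (q < n)%N -> q = lo -> (0 < lo)%N -> ~~ (head (0, true) r).2]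
   (r \in new_rows s lo q n).
Proof.
rewrite /new_rows leq_eqVlt; case: eqP => /= [->|_] ltqn.
  rewrite inE; apply: (iffP eqP) => [->|[]]; rewrite ?subnn ?ltnn //=.
  by case: r.
apply: (iffP mapP) => [[b bin ->]|].
  rewrite /= size_nseq prednK ?subn_gt0 // eqxx /=; split=> //.
  - by rewrite all_nseq eqxx orbT.
  - by rewrite all_nseq orbT.
  - by move=> _ elo lo_gt0; move: bin; rewrite elo eqxx lo_gt0 inE => /eqP->.
case: r => [|[s' b] r] [/= sz]; first by move: ltqn; rewrite -subn_gt0 -sz.
case/andP=> /eqP-> alls allb bP; exists b.
  case: ifP => [/andP[/eqP elo lo_gt0]|_]; last by case: b {bP}.
  by rewrite inE; apply/eqP/negbTE/bP.
rewrite -sz /=; congr (_ :: _); elim: r alls allb {sz} => //= -[s1 b1] r IHr.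
by case/andP=> /eqP/= -> alls /andP[/= -> allb]; rewrite -IHr.
Qed.

Lemma strips_cons s n la q r e :
  ((q, r) :: e \in strips s (n :: la)) =
  [&& (head 0%N la <= q <= n)%N, r \in new_rows s (head 0%N la) q n & e \in strips s la].
Proof.
apply/allpairsP/and3P => [[[[q1 r1] e1] /= [p1 e1in [-> -> ->]]]|[qn rin ein]].
  case/allpairsPdep: p1 => q2 [r2 [q2in r2in [-> ->]]].
  by move: q2in; rewrite mem_index_iota ltnS.
exists ((q, r), e); split=> //=; apply/allpairsPdep; exists q, r.
by rewrite mem_index_iota ltnS.
Qed.

Lemma pairwise_new s r : all (fun c => c.1 == s) r -> pairwise row_le r = all snd (behead r).
Proof.
case: r => [|c r] //= /andP[/eqP cs].
elim: r c cs => [|d r IHr] c cs //= /andP[/eqP ds alls].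
rewrite -(IHr d ds alls) {1}/row_le cs ds ltxx eqxx /= -!andbA; congr (_ && _).
rewrite andbA; congr (_ && _).
have -> : all (row_le d) r = all (row_le c) r; last by rewrite andbb.
by apply: eq_all => e; rewrite /row_le cs ds.
Qed.

Lemma pairwise_old_new s r1 r2 :
    all (fun c => c.1 < s) r1 -> all (fun c => c.1 == s) r2 ->
  pairwise row_le (r1 ++ r2) = pairwise row_le r1 && all snd (behead r2).
Proof.
move=> lt1 eq2; rewrite pairwise_cat (pairwise_new eq2).
suff -> : allrel row_le r1 r2 by [].
apply/allrelP=> c d /(allP lt1) ltc /(allP eq2)/eqP eqd.
by rewrite /row_le eqd ltc.
Qed.

Lemma row_split s r : all (fun c => c.1 <= s) r -> pairwise row_le r -> old s r ++ new s r = r.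
Proof.
elim: r => //= c r IHr /andP[les alls] /andP[lec pw].
case: eqP => cs /=; last by rewrite IHr.
have eqs : all (fun d => d.1 == s) r.
  apply/allP=> d dr; have := allP lec _ dr; have /= les' := allP alls _ dr.
  rewrite /row_le cs => h; rewrite eq_le les' /=.
  by case/orP: h => [/ltW //|/andP[/eqP-> _]].
rewrite /old /new (eq_in_filter (a2 := pred0)); last first.
  move=> d dr /=; have /eqP ed : d.1 == s := allP eqs d dr.
  by rewrite ed eqxx.
by rewrite filter_pred0 /=; congr (_ :: _); apply/all_filterP.
Qed.

(** A maximal letter of the upper row can lie above a box of the lower row only if it is primed and
    the lower letter is maximal too. Only the first of the new letters can be primed, so this
    happens in at most one column, that of the last box of the lower row. *)
Lemma col_ok_cat s r1 n1 r2 n2 :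
    all (fun c => c.1 < s) r1 -> all (fun c => c.1 == s) n1 -> all snd (behead n1) ->
    all (fun c => c.1 < s) r2 -> all (fun c => c.1 == s) n2 -> r2 ++ n2 != [::] ->
  col_ok (r1 ++ n1) (r2 ++ n2) =
  [&& (size (r2 ++ n2) <= size r1)%N,
      (size (r2 ++ n2) == size r1) ==> (n1 != [::]) && ~~ (head (0, true) n1).2
    & (r2 == [::]) || col_ok r1 r2].
Proof.
move=> lt1 eq1 sn1 lt2 eq2 nz.
have z0 : (0, false) = (0, false) :> letter by [].
have nth1 k : (k < size r1)%N -> (nth (0, false) (r1 ++ n1) k).1 < s.
  by move=> ltk; rewrite nth_cat ltk; apply: (allP lt1); apply: mem_nth.
have nth1' k : (size r1 <= k < size (r1 ++ n1))%N -> (nth (0, false) (r1 ++ n1) k).1 = s.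
  case/andP=> lek ltk; rewrite nth_cat ltnNge lek /=; apply/eqP/(allP eq1)/mem_nth.
  by rewrite ltn_subLR // -size_cat.
have nth2 k : (k < size r2)%N -> (nth (0, false) (r2 ++ n2) k).1 < s.
  by move=> ltk; rewrite nth_cat ltk; apply: (allP lt2); apply: mem_nth.
have nth2' k : (size r2 <= k < size (r2 ++ n2))%N -> (nth (0, false) (r2 ++ n2) k).1 = s.
  case/andP=> lek ltk; rewrite nth_cat ltnNge lek /=; apply/eqP/(allP eq2)/mem_nth.
  by rewrite ltn_subLR // -size_cat.
have pr1 k : (size r1 < k < size (r1 ++ n1))%N -> (nth (0, false) (r1 ++ n1) k).2.
  case/andP=> lek ltk; rewrite nth_cat ltnNge ltnW //=.
  case: n1 {eq1 nth1 nth1'} sn1 ltk => [|c n1] /= sn1; first by rewrite cats0 => /(ltn_trans lek); rewrite ltnn.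
  rewrite size_cat /= => ltk; have -> : (k - size r1 = (k - size r1).-1.+1)%N by lia.
  have ltn1 : ((k - size r1).-1 < size n1)%N by lia.
  exact: (allP sn1 _ (mem_nth _ ltn1)).
have head1 : n1 != [::] -> nth (0, false) (r1 ++ n1) (size r1) = head (0, true) n1.
  by case: n1 {eq1 nth1 nth1' sn1 pr1} => // c n1 _; rewrite nth_cat ltnn subnn.
have sz2 : (0 < size (r2 ++ n2))%N by rewrite lt0n size_eq0.
apply/col_okP/and3P => [[lt21 le21]|[le21 /implyP hd ok]].
  have le_r1 : (size (r2 ++ n2) <= size r1)%N.
    rewrite leqNgt; apply/negP => ltr1.
    have ltk : (size r1 < size (r1 ++ n1))%N by apply: ltn_trans lt21.
    have := le21 _ ltr1; rewrite /col_le.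
    have e1 : (nth (0, false) (r1 ++ n1) (size r1).+1).1 = s by rewrite nth1' // leqW //=; apply: leq_ltn_trans lt21.
    have := pr1 (size r1).+1; rewrite ltnSn /= => -> //; last exact: leq_ltn_trans lt21.
    rewrite e1 andbF orbF => lts; have [lt2r|le2r] := ltnP (size r1) (size r2).
      by have := lt_trans lts (nth2 _ lt2r); rewrite ltxx.
    by rewrite nth2' ?ltxx // in lts; rewrite le2r.
  split=> //.
    apply/implyP=> /eqP e2.
    have lt1n : (size r1 < size (r1 ++ n1))%N by rewrite -e2.
    have n1nz : n1 != [::] by apply: contraTneq lt1n => ->; rewrite cats0 ltnn.
    have r1_gt0 : (0 < size r1)%N by rewrite -e2.
    have ltk : ((size r1).-1 < size (r2 ++ n2))%N by rewrite e2 prednK.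
    have := le21 _ ltk; rewrite prednK // /col_le nth1' ?leqnn //= head1 // n1nz.
    have [lt2r|le2r] := ltnP (size r1).-1 (size r2).
      by case/orP=> [/lt_trans/(_ (nth2 _ lt2r))|/andP[_ ->]] //; rewrite ltxx.
    by rewrite nth2' ?le2r // ltxx eqxx /= => ->.
  case: eqP => //= /eqP r2nz; apply/col_okP.
  have r2_gt0 : (0 < size r2)%N by rewrite lt0n size_eq0.
  have lt_k k : (k < size r2)%N -> (k.+1 < size r1)%N /\ col_le (nth (0, false) r1 k.+1) (nth (0, false) r2 k).
    move=> ltk; have := le21 k; rewrite size_cat ltn_addr // => /(_ isT).
    have e2 : nth (0, false) (r2 ++ n2) k = nth (0, false) r2 k by rewrite nth_cat ltk.
    have := nth2 _ ltk; rewrite e2 => lts.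
    have [ltk1|gek1] := ltnP k.+1 (size r1); first by rewrite nth_cat ltk1.
    rewrite /col_le nth1'.
      case/orP=> [/lt_trans/(_ lts)|/andP[/eqP es _]]; first by rewrite ltxx.
      by rewrite -es ltxx in lts.
    by rewrite gek1 /=; apply: leq_ltn_trans lt21; rewrite size_cat; lia.
  split; last by move=> k /lt_k[].
  by have [|+ _] := lt_k (size r2).-1; rewrite ?prednK.
have lt21 : (size (r2 ++ n2) < size (r1 ++ n1))%N.
  rewrite [X in (_ < X)%N]size_cat; move: le21; rewrite leq_eqVlt => /orP[/eqP e2|]; last by lia.
  have /andP[n1nz _] := hd (introT eqP e2).
  by rewrite e2 -[X in (X < _)%N]addn0 ltn_add2l lt0n size_eq0.
split=> // k ltk; have [ltkr2|gekr2] := ltnP k (size r2).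
  have r2nz : r2 != [::] by rewrite -size_eq0 -lt0n; apply: leq_ltn_trans ltkr2.
  rewrite (negPf r2nz) /= in ok; case/col_okP: ok => szr okk.
  by rewrite !nth_cat ltkr2 (leq_ltn_trans ltkr2 szr) okk.
have e2 : (nth (0, false) (r2 ++ n2) k).1 = s by rewrite nth2' // gekr2.
rewrite /col_le e2; have [ltk1|gek1] := ltnP k.+1 (size r1); first by rewrite nth1.
have ek1 : k.+1 = size r1 by apply/eqP; rewrite eqn_leq gek1 (leq_trans ltk le21).
have e12 : size (r2 ++ n2) == size r1 by rewrite eqn_leq le21 -ek1.
have /andP[n1nz hn1] := hd e12.
rewrite ek1 head1 // hn1 -(head1 n1nz) nth1' ?eqxx ?orbT // leqnn size_cat.
by rewrite -[X in (X < _)%N]addn0 ltn_add2l lt0n size_eq0.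
Qed.


Definition cuttable s T :=
  all (fun r => [&& r != [::], old s r ++ new s r == r & all (fun c => c.1 <= s) r]) T.

Lemma all_new s r : all (fun c => c.1 == s) (new s r).
Proof. exact: filter_all. Qed.

Lemma all_old s r : all (fun c => c.1 <= s) r -> all (fun c => c.1 < s) (old s r).
Proof.
move=> les; apply/allP=> c; rewrite mem_filter => /andP[ns /(allP les)].
by rewrite lt_neqAle ns.
Qed.

Lemma tableau_cut s T : cuttable s T -> sorted gtn (map size T) ->
  tableau T = (strip_of s T \in strips s (map size T)) && tableau (cut_rows s T).
Proof.
elim: T => // r T IHT; rewrite /cuttable [all _ _]/= => /andP[/and3P[rnz /eqP er les] cT] so.
have {}so' := path_sorted so; have {}IHT := IHT cT so'.
have szr : size r = (size (old s r) + size (new s r))%N by rewrite -size_cat er.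
have eq_cut : cut_rows s (r :: T) = if old s r != [::] then old s r :: cut_rows s T else cut_rows s T by [].
rewrite tableau_cons rnz /= -[X in pairwise _ X]er (pairwise_old_new (all_old les) (all_new s r)).
rewrite strips_cons IHT eq_cut.
case: T so {so'} cT IHT eq_cut => [|r2 T] so cT IHT eq_cut /=.
  rewrite szr leq_addr inE eqxx !andbT.
  have -> : (new s r \in new_rows s 0 (size (old s r)) (size (old s r) + size (new s r))) =
     all snd (behead (new s r)).
    apply/new_rowsP/idP => [|[_ _ //]|snw]; first exact: leq_addr.
    by split=> //; rewrite ?addKn ?all_new.
  rewrite andbC; congr (_ && _).
  by case: ifP => [|/negbFE/eqP->] //; rewrite tableau_cons => ->; rewrite andbT.
have [r2nz er2 les2] : [/\ r2 != [::], old s r2 ++ new s r2 = r2 & all (fun c => c.1 <= s) r2].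
  by move: cT; rewrite /= => /andP[/and3P[? /eqP ? ?] _].
have lt2 : (size r2 < size r)%N by move: so => /=; case/andP.
have r2_gt0 : (0 < size r2)%N by rewrite lt0n size_eq0.
have nrP := new_rowsP s (size r2) (new s r) (_ : (size (old s r) <= size r)%N).
have leor : (size (old s r) <= size r)%N by rewrite szr leq_addr.
have {}nrP := nrP leor.
have -> : (size r2 <= size (old s r) <= size r)%N = (size r2 <= size (old s r))%N by rewrite leor andbT.
case: (boolP (all snd (behead (new s r)))) => snw; last first.
  rewrite !andbF /=; apply/esym/negbTE/negP => /andP[/and3P[_ /nrP[_ _ n2 _] _] _].
  by rewrite n2 in snw.
have := col_ok_cat (all_old les) (all_new s r) snw (all_old les2) (all_new s r2).
rewrite er er2 => -> //.
have -> : (new s r \in new_rows s (size r2) (size (old s r)) (size r)) =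
  ((size r2 == size (old s r)) ==> (new s r != [::]) && ~~ (head (0, true) (new s r)).2).
  apply/nrP/implyP => [[_ _ _ hd] /eqP e|hd].
    have ltq : (size (old s r) < size r)%N by rewrite -e.
    by rewrite hd // andbT; apply: contraTneq ltq => n0; rewrite szr n0 addn0 ltnn.
  split=> //; first by rewrite szr addKn.
    exact: all_new.
  by move=> _ /esym/eqP e _; case/andP: (hd e).
case: leqP => //= leo; last by rewrite andbF.
have onz : old s r != [::] by rewrite -size_eq0 -lt0n; apply: leq_trans leo.
rewrite onz tableau_cons onz andbT /=.
case: (_ ==> _) => //=; last by rewrite andbF.
rewrite -/(strips s (size r2 :: map size T)).
case: (boolP (_ \in strips s _)) => [st|_]; last by rewrite /= !andbF.
case: (pairwise _ _) => //=.
case: (eqVneq (old s r2) [::]) => [o2|o2nz] /=.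
  (* A row without old letters is the last one: the row below it would have length at most 0. *)
  have -> : cut_rows s (r2 :: T) = [::].
    rewrite /cut_rows /= o2 /=; case: T st cT {so IHT eq_cut} => [|r3 T] // st cT.
    move: st; rewrite [strip_of _ _]/= strips_cons o2 [size [::]]/= leqn0 size_eq0.
    by case/and3P=> /andP[/eqP r30 _]; move: cT; rewrite r30 /= andbF.
  by [].
by rewrite /cut_rows /= o2nz /=.
Qed.

End Tableaux.

(** * Tableaux as chains of strips *)

Section TableauEnumeration.
Local Notation letter := (int * bool)%type.
Implicit Types (c d : letter) (r : seq letter) (T : seq (seq letter)) (s : int).
Implicit Types (la mu : seq nat) (e : seq (nat * seq letter)) (al : seq int).

(** A row that loses all its boxes is the last one. This lets [glue] match the remaining rows with
    the strips from the top. *)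
Fixpoint zero_last e :=
  if e is p :: e' then ((p.1 == 0%N) ==> nilp e') && zero_last e' else true.

Definition total (p : nat * seq letter) := (p.1 + size p.2)%N.

Lemma strips_wf s la e : all (leq 1) la -> e \in strips s la ->
  [/\ map total e = la, all (fun p => all (fun c => c.1 == s) p.2) e & zero_last e].
Proof.
elim: la e => [|n la IHla] e /=; first by rewrite inE => _ /eqP->.
move=> /andP[n_gt0 pos]; case: e => [|[q r] e]; first by case/allpairsP=> -[p e] [].
rewrite -/(strips s (n :: la)) strips_cons => /and3P[/andP[loq qn] rin ein].
have [te ne ze] := IHla e pos ein.
have [szr nr _ _] := new_rowsP _ _ _ qn rin.
rewrite /= te ne ze nr !andbT /total szr subnKC //; split=> //.
apply/implyP=> /eqP q0; move: loq; rewrite q0 -te; case: (e) te => // p e' te.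
by move: pos; rewrite -te /= => /andP[t_gt0 _]; rewrite leqn0 => /eqP t0; rewrite t0 in t_gt0.
Qed.

Lemma glueP s e T :
    zero_last e -> all (fun p => all (fun c => c.1 == s) p.2) e ->
    all (fun p => 0 < total p)%N e ->
    map size T = remaining e -> all (all (fun c => c.1 < s)) T ->
  [/\ strip_of s (glue e T) = e, cut_rows s (glue e T) = T,
      map size (glue e T) = map total e & cuttable s (glue e T)].
Proof.
have oldE t r : all (fun c => c.1 < s) t -> all (fun c => c.1 == s) r ->
    old s (t ++ r) = t /\ new s (t ++ r) = r.
  move=> lt_t eq_r; rewrite /old /new !filter_cat.
  have none (a : pred letter) l : all (predC a) l -> filter a l = [::].
    by rewrite all_predC has_filter negbK => /eqP.
  rewrite (none (fun c => c.1 == s) t) ?(none (fun c => c.1 != s) r) ?cats0 /=.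
  - by split; apply/all_filterP => //; apply: sub_all lt_t => c /lt_eqF /= ->.
  - by apply: sub_all eq_r => c /= ->.
  - by apply: sub_all lt_t => c /lt_eqF /= ->.
have cutE t r : all (fun c => c.1 < s) t -> all (fun c => c.1 == s) r ->
    all (fun c => c.1 <= s) (t ++ r).
  move=> lt_t eq_r; rewrite all_cat; apply/andP; split.
    by apply/allP=> c /(allP lt_t)/ltW.
  by apply/allP=> c /(allP eq_r)/eqP->.
elim: e T => [|[q r] e IHe] T /=; first by move=> _ _ _ /eqP; case: T.
move=> /andP[q0 ze] /andP[nr ne] /andP[p_gt0 pos]; rewrite /remaining /=.
case: eqP q0 => /= [q0 /nilP e0|qnz _].
  rewrite e0 /= => /eqP; case: T => // _ _; have [o n] := oldE [::] r isT nr.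
  rewrite /cut_rows /cuttable /= in o n *; rewrite o n /= q0; split=> //.
  rewrite eqxx (cutE [::]) // !andbT.
  by rewrite /total /= q0 in p_gt0; rewrite -size_eq0 -lt0n.
case: T => // t T [szt szT] /= /andP[ltt ltT]; have [o n] := oldE t r ltt nr.
have [IH1 IH2 IH3 IH4] := IHe T ze ne pos szT ltT.
rewrite /cut_rows /cuttable /= o n in IH1 IH2 IH3 IH4 *.
have tnz : t != [::] by rewrite -size_eq0 szt; apply/eqP.
have trnz : t ++ r != [::] by apply: contraNneq tnz; case: (t).
rewrite IH1 IH3 IH4 tnz trnz size_cat szt eqxx cutE //=.
by split=> //; congr (_ :: _).
Qed.

Lemma remaining_strip s T : remaining (strip_of s T) = map size (cut_rows s T).
Proof.
rewrite /remaining /strip_of /cut_rows -map_comp.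
elim: T => //= r T IHT; rewrite size_eq0.
by case: eqP => //= _; rewrite IHT.
Qed.

Lemma glue_cut s T : cuttable s T -> zero_last (strip_of s T) ->
  glue (strip_of s T) (cut_rows s T) = T.
Proof.
elim: T => //= r T IHT /andP[/and3P[_ /eqP er _] cT] /andP[z zT].
rewrite /cut_rows /=; case: eqP => /= [o0|_].
  move: z; rewrite o0 /= => /nilP; case: T {IHT cT zT} => //= _.
  by rewrite -[in RHS]er o0.
by rewrite er IHT.
Qed.

Lemma remaining_pos e : all (leq 1) (remaining e).
Proof. by apply/allP=> q; rewrite mem_filter lt0n => /andP[]. Qed.

Lemma mem_tableaux al la T : sorted >%R al -> sorted gtn la -> all (leq 1) la ->
  T \in tableaux al la <->
  [/\ map size T = la, tableau T & all (all (fun c => c.1 \in al)) T].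
Proof.
elim: al la T => [|s al IHal] la T so_al so_la pos.
  split=> [|[<- /andP[nz _] inT]].
    by case: la {so_la pos} => // /=; rewrite inE => /eqP->.
  case: T nz inT => // r T /= /andP[/andP[rnz _] _] /andP[rin _].
  by case: r rnz rin.
have lt_al z : z \in al -> z < s.
  by move=> zal; apply: (allP (order_path_min (rev_trans lt_trans) so_al)).
have so_al' := path_sorted so_al.
split=> [/allpairsPdep[e [T' [ein]]]|[szT tT inT]].
  case: ifP => // so_e T'in ->.
  have [szT' tT' inT'] := (IHal _ _ so_al' so_e (remaining_pos e)).1 T'in.
  have [te ne ze] := strips_wf pos ein.
  have ltT' : all (all (fun c => c.1 < s)) T'.
    by apply/allP=> r rT; apply/allP=> c cr; apply/lt_al/(allP (allP inT' _ rT)).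
  have tpos : all (fun p => 0 < total p)%N e by rewrite -te all_map in pos.
  have [eS eC eZ cG] := glueP ze ne tpos szT' ltT'.
  rewrite eZ te; split=> //.
    rewrite (tableau_cut cG); last by rewrite eZ te.
    by rewrite eS eC eZ te ein.
  elim: e T' {ein so_e T'in szT' tT' te ze tpos eS eC eZ cG ltT'} ne inT' => //= p e IHe T'.
  case/andP=> np ne inT'; rewrite all_cat.
  have inp : all (fun c => c.1 \in s :: al) p.2.
    by apply/allP=> c /(allP np)/eqP->; rewrite mem_head.
  have sub r : all (fun c => c.1 \in al) r -> all (fun c => c.1 \in s :: al) r.
    by apply: sub_all => c; rewrite inE => ->; rewrite orbT.
  case: T' inT' => [|r T'] /=; first by rewrite inp IHe.
  by case/andP=> rin T'in; rewrite sub // inp IHe.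
have cT : cuttable s T.
  apply/allP=> r rT; have /andP[nz _] := tT; have /andP[-> pw] := allP nz _ rT.
  have les : all (fun c => c.1 <= s) r.
    apply/allP=> c /(allP (allP inT _ rT)); rewrite inE => /orP[/eqP->//|/lt_al/ltW //].
  by rewrite row_split // eqxx les.
have so_T : sorted gtn (map size T) by rewrite szT.
have := tT; rewrite (tableau_cut cT so_T) szT => /andP[ein tC].
have [_ _ ze] := strips_wf pos ein.
apply/allpairsPdep; exists (strip_of s T), (cut_rows s T); split=> //; last by rewrite glue_cut.
have so_C := tableau_sizes tC; rewrite remaining_strip so_C.
apply/(IHal _ _ so_al' so_C); first by rewrite -remaining_strip remaining_pos.
split=> //; apply/allP=> r; rewrite mem_filter => /andP[_ /mapP[r0 r0T ->]].
apply/allP=> c; rewrite mem_filter => /andP[ns /(allP (allP inT _ r0T))].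
by rewrite inE (negPf ns).
Qed.

Lemma uniq_strips s la : uniq (strips s la).
Proof.
elim: la => //= n la IHla; apply: allpairs_uniq => //; last first.
  by move=> [p e] [p' e'] _ _ /= [-> ->].
apply: allpairs_uniq_dep => [|q _|]; first exact: iota_uniq.
  rewrite /new_rows; case: eqP => // _; rewrite map_inj_uniq => [|b b' [] //].
  by case: ifP.
by move=> [q r] [q' r'] _ _ /= [-> ->].
Qed.

Lemma uniq_tableaux al la : sorted >%R al -> all (leq 1) la -> uniq (tableaux al la).
Proof.
elim: al la => [|s al IHal] la so_al pos; first by case: la {pos}.
have lt_al z : z \in al -> z < s.
  by move=> zal; apply: (allP (order_path_min (rev_trans lt_trans) so_al)).
have so_al' := path_sorted so_al.
apply: allpairs_uniq_dep => [|e _|]; first exact: uniq_strips.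
  by case: ifP => // _; apply: IHal => //; apply: remaining_pos.
have inv e T : e \in strips s la ->
    T \in (if sorted gtn (remaining e) then tableaux al (remaining e) else [::]) ->
    strip_of s (glue e T) = e /\ cut_rows s (glue e T) = T.
  move=> ein; case: ifP => // so_e Tin.
  have [szT tT inT] := (mem_tableaux _ so_al' so_e (remaining_pos e)).1 Tin.
  have [te ne ze] := strips_wf pos ein.
  have ltT : all (all (fun c => c.1 < s)) T.
    by apply/allP=> r rT; apply/allP=> c cr; apply/lt_al/(allP (allP inT _ rT)).
  have tpos : all (fun p => 0 < total p)%N e by rewrite -te all_map in pos.
  by have [] := glueP ze ne tpos szT ltT.
move=> _ _ /allpairsPdep[e [T [ein Tin ->]]] /allpairsPdep[e' [T' [ein' Tin' ->]]] /= eg.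
have [i1 i2] := inv _ _ ein Tin; have [i1' i2'] := inv _ _ ein' Tin'.
have ee : e = e' by rewrite -[LHS]i1 eg.
have eT : T = T' by rewrite -[LHS]i2 eg.
by rewrite ee eT.
Qed.

End TableauEnumeration.

(** * Weights of tableaux *)

Section TableauWeights.
Local Notation letter := (int * bool)%type.
Variables (R : comNzRingType) (X : int -> R) (t : nat -> R).
Implicit Types (c d : letter) (r : seq letter) (T : seq (seq letter)) (s : int).
Implicit Types (la mu : seq nat) (e : seq (nat * seq letter)) (al : seq int).

Definition letter_sign c : R := if c.2 then 1 else -1.

Definition row_weight q r : R :=
  \prod_(i < size r) (X (nth (0, false) r i).1 -
                      letter_sign (nth (0, false) r i) * t (q + i).+1).

Definition weight T : R := \prod_(r <- T) row_weight 0 r.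

Lemma row_weight_nil q : row_weight q [::] = 1.
Proof. by rewrite /row_weight big_ord0. Qed.

Lemma row_weight_cons q c r :
  row_weight q (c :: r) = (X c.1 - letter_sign c * t q.+1) * row_weight q.+1 r.
Proof.
rewrite /row_weight big_ord_recl /= addn0; congr (_ * _).
by apply: eq_bigr => i _; rewrite /= addnS.
Qed.

Lemma row_weight_cat q r1 r2 :
  row_weight q (r1 ++ r2) = row_weight q r1 * row_weight (q + size r1) r2.
Proof.
elim: r1 q => [|c r1 IHr1] q /=; first by rewrite row_weight_nil mul1r addn0.
by rewrite !row_weight_cons IHr1 mulrA addnS.
Qed.

Definition strip_total e : R := \prod_(p <- e) row_weight p.1 p.2.

Lemma weight_glue e T : zero_last e -> map size T = remaining e ->
  weight (glue e T) = strip_total e * weight T.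
Proof.
rewrite /weight /strip_total.
elim: e T => [|[q r] e IHe] T /=; first by case: T => // _ _; rewrite !big_nil mulr1.
case/andP=> q0 ze; rewrite /remaining /= !big_cons.
case: eqP q0 => /= [-> /nilP e0|_ _].
  by rewrite e0 /= => /eqP; case: T => // _; rewrite !big_nil /= !mulr1.
case: T => // r1 T [sz szT] /=.
by rewrite IHe // row_weight_cat add0n sz big_cons; ring.
Qed.

Lemma sum_new_rows s lo q n : (q <= n)%N ->
  \sum_(r <- new_rows s lo q n) row_weight q r = strip_weight (X s) t lo q n.
Proof.
rewrite /new_rows /strip_weight leq_eqVlt; case: eqP => /= [_ _|_ ltqn].
  by rewrite big_seq1 row_weight_nil.
have nseqE p k : row_weight p (nseq k (s, true)) = \prod_(p.+1 <= i < (p + k).+1) (X s - t i).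
  elim: k p => [|k IHk] p; first by rewrite row_weight_nil addn0 big_geq.
  rewrite /= row_weight_cons IHk /letter_sign /= mul1r addSnnS [RHS]big_ltn //.
  by rewrite ltnS -addSnnS leq_addr.
have szE : (q.+1 + (n - q).-1 = n)%N by rewrite addSnnS prednK ?subn_gt0 // subnKC // ltnW.
rewrite big_map; case: ifP => _; rewrite !big_cons big_nil.
  by rewrite row_weight_cons nseqE szE /letter_sign /=; ring.
by rewrite !row_weight_cons nseqE szE /letter_sign /=; ring.
Qed.

Lemma sum_strips s la (w : seq nat -> R) :
  \sum_(e <- strips s la) strip_total e * w (remaining e) = branch (X s) t w la.
Proof.
elim: la w => [|n la IHla] w /=.
  by rewrite big_seq1 /strip_total big_nil mul1r.
rewrite big_allpairs_dep /= big_allpairs_dep /=; apply: eq_big_nat => q /andP[_ qn].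
rewrite -sum_new_rows // mulr_suml; apply: eq_bigr => r _.
rewrite -IHla mulr_sumr; apply: eq_bigr => e _.
rewrite /strip_total big_cons /remaining /= -/(remaining e) mulrA.
by case: eqP.
Qed.

(** Disposes of the terms of [branch] whose remaining lengths are not strict, to which no tableaux
    correspond: such a list has two equal neighbours. *)
Lemma weakly_decreasing_repeat (f : nat -> {poly R}) (w : seq {poly R} -> R) mu :
    sorted geq mu -> ~~ sorted gtn mu -> alternating w -> w (map f mu) = 0.
Proof.
move=> + + aw; suff: forall p, sorted geq mu -> ~~ sorted gtn mu -> w (p ++ map f mu) = 0.
  by move=> /(_ [::]).
elim: mu => // m [|m' mu] IHmu p //= /andP[le so].
rewrite negb_and -leqNgt => /orP[le'|ns].
  have -> : m' = m by apply/eqP; rewrite eqn_leq le le'.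
  exact: aw.
by rewrite -cat_rcons; apply: IHmu.
Qed.

Lemma strips_remaining_sorted s la e : sorted geq la -> e \in strips s la ->
  sorted geq (remaining e).
Proof.
move=> so ein; apply: (subseq_sorted (rev_trans leq_trans) (filter_subseq _ _)).
elim: la e so ein => [|n la IHla] e /=; first by rewrite inE => _ /eqP->.
move=> so; have so' := path_sorted so.
case: e => [|[q r] e]; first by case/allpairsP=> -[p e] [].
rewrite -/(strips s (n :: la)) strips_cons => /and3P[/andP[loq qn] rin ein] /=.
have := IHla e so' ein; case: la {IHla so so' rin} loq ein => [|m la] /= lom.
  by rewrite inE => /eqP->.
case: e => // -[q' r'] e; rewrite -/(strips s (m :: la)) strips_cons /=.
by case/and3P=> /andP[_ q'm] _ _ ->; rewrite andbT (leq_trans q'm).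
Qed.

Lemma sum_tableaux al la : sorted >%R al -> sorted gtn la -> all (leq 1) la ->
  \sum_(T <- tableaux al la) weight T = qfun (map X al) (map (gpoly t) la).
Proof.
elim: al la => [|s al IHal] la so_al so_la pos.
  by case: la {so_la pos} => [|n la] /=; rewrite ?big_seq1 ?big_nil /weight ?big_nil.
have so_al' := path_sorted so_al.
rewrite /= qstep_branch //; [|exact: multilinear_qfun|exact: alternating_qfun].
rewrite -sum_strips big_allpairs_dep /=; apply: eq_big_seq => e ein.
have [te ne ze] := strips_wf pos ein.
case: ifP => so_e; last first.
  rewrite big_nil weakly_decreasing_repeat ?mulr0 ?so_e //; last exact: alternating_qfun.
  by apply: strips_remaining_sorted ein; apply: sub_sorted so_la => m k /ltnW.
rewrite -IHal ?remaining_pos // mulr_sumr; apply: eq_big_seq => T Tin.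
have [szT _ _] := (mem_tableaux _ so_al' so_e (remaining_pos e)).1 Tin.
by rewrite weight_glue.
Qed.

End TableauWeights.

(** * Marked shifted tableaux and the truncation of the Q-function *)

Lemma row_le_marked c d : row_le c d = marked_le c d && ((c == d) ==> c.2).
Proof.
case: c d => [i b] [k b']; rewrite /row_le /marked_le xpair_eqE /=.
case: (ltgtP i k) => //= _.
by case: b b' => [] [].
Qed.

Lemma col_le_marked c d : col_le c d = marked_le c d && ((c == d) ==> ~~ c.2).
Proof.
case: c d => [i b] [k b']; rewrite /col_le /marked_le xpair_eqE /=.
case: (ltgtP i k) => //= _.
by case: b b' => [] [].
Qed.

Lemma col_le_trans : transitive col_le.
Proof.
move=> [k b'] [i b] [l b'']; rewrite /col_le /=.
case/orP=> [ltik|/andP[/eqP-> bf]]; last by case/orP=> [->//|/andP[-> _]]; rewrite bf orbT.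
by case/orP=> [/(lt_trans ltik)->//|/andP[/eqP<- _]]; rewrite ltik.
Qed.

Lemma entry_nth T i k : entry T i.+1 (i.+1 + k) = nth (0, false) (nth [::] T i) k.
Proof. by rewrite /entry addKn. Qed.

Lemma shifted_boxP (la : seq nat) i k : all (leq 1) la ->
  shifted_box la i.+1 (i.+1 + k) = (i < size la)%N && (k < nth 0 la i)%N.
Proof.
move=> pos; rewrite /shifted_box /= leq_addr /=.
case: ltnP => //= lti; have : (0 < nth 0 la i)%N by apply: (allP pos); apply: mem_nth.
by case: (nth 0%N la i) => // p _; lia.
Qed.

Lemma shifted_boxE (la : seq nat) a b : shifted_box la a b ->
  exists i k, a = i.+1 /\ b = (i.+1 + k)%N.
Proof.
case/and4P; case: a => // i _ _ leib _; exists i, (b - i.+1)%N.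
by rewrite subnKC.
Qed.

Lemma nth_gtn (la : seq nat) i : sorted gtn la -> (i.+1 < size la)%N ->
  (nth 0 la i.+1 < nth 0 la i)%N.
Proof. by move=> so lti; apply: (sortedP 0%N so). Qed.

(** [tableau] compares adjacent rows only. A column of a strict shape has no gaps, so the comparison
    of distant rows follows by transitivity of [col_le]. *)
Lemma mstP (S : set int) la T : sorted gtn la -> all (leq 1) la ->
  marked_shifted_tableau S la T <->
  [/\ [seq size row | row <- T] = la, tableau T &
      forall row, row \in T -> forall c, c \in row -> S c.1].
Proof.
move=> so pos.
have box i k : (i < size T)%N -> [seq size row | row <- T] = la ->
    shifted_box la i.+1 (i.+1 + k) = (k < size (nth [::] T i))%N.
  by move=> lti sz; rewrite shifted_boxP // -sz size_map lti (nth_map [::]).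
split=> [[sz alph rle cle cun rpr]|[sz tT alph]].
  split=> //; last first.
    move=> row /(nthP [::])[i lti <-] c /(nthP (0, false))[k ltk <-].
    by rewrite -entry_nth; apply: alph; rewrite box.
  apply/andP; split; last first.
    apply/(sortedP [::]) => i lti.
    have lti' := ltnW lti.
    have lts : (size (nth [::] T i.+1) < size (nth [::] T i))%N.
      have := @nth_gtn la i so; rewrite -sz size_map => /(_ lti).
      by rewrite !(nth_map [::]).
    apply/col_okP; split=> // k ltk.
    have b1 : shifted_box la i.+1 (i.+2 + k) by rewrite addSnnS box // (leq_ltn_trans ltk).
    have b2 : shifted_box la i.+2 (i.+2 + k) by rewrite box.
    rewrite -!entry_nth -addSnnS col_le_marked.
    rewrite (cle _ _ _ b1 b2) //=; apply/implyP => /eqP.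
    exact: (cun _ _ _ b1 b2).
  apply/allP=> row /(nthP [::])[i lti <-]; apply/andP; split.
    rewrite -size_eq0 -lt0n; have := allP pos (nth 0%N la i).
    rewrite -sz (nth_map [::]) //; apply; apply/(nthP 0%N).
    by exists i; rewrite ?size_map // (nth_map [::]).
  apply/(pairwiseP (0, false)) => k k'; rewrite !inE => ltk ltk' kk'.
  have b1 : shifted_box la i.+1 (i.+1 + k) by rewrite box.
  have b2 : shifted_box la i.+1 (i.+1 + k') by rewrite box.
  rewrite -!entry_nth row_le_marked (rle _ _ _ b1 b2) ?leq_add2l 1?ltnW //=.
  by apply/implyP => /eqP; apply: (rpr _ _ _ b1 b2); rewrite ltn_add2l.
have [nz cols] := andP tT.
have rows i : (i < size T)%N -> pairwise row_le (nth [::] T i).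
  by move=> lti; have /andP[] := allP nz _ (mem_nth [::] lti).
have boxT a b : shifted_box la a b -> exists i k,
    [/\ a = i.+1, b = (i.+1 + k)%N, (i < size T)%N & (k < size (nth [::] T i))%N].
  move=> bab; have [i [k [ea eb]]] := shifted_boxE bab.
  move: bab; rewrite ea eb shifted_boxP // => /andP[lti ltk].
  have ltiT : (i < size T)%N by rewrite -(size_map size) sz.
  by exists i, k; split=> //; move: ltk; rewrite -sz (nth_map [::]).
have rowE a b b' : shifted_box la a b -> shifted_box la a b' -> (b < b')%N ->
    row_le (entry T a b) (entry T a b').
  move=> /boxT[i [k [ea eb lti ltk]]] /boxT[i' [k' [ea' eb' lti' ltk']]].
  have ei : i' = i by move: ea; rewrite ea' => -[].
  rewrite ei in ea' eb' ltk' *; rewrite ea eb eb' !entry_nth ltn_add2l => kk'.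
  by apply: (pairwiseP (0, false) (rows _ lti)).
have colE a a' b : shifted_box la a b -> shifted_box la a' b -> (a < a')%N ->
    col_le (entry T a b) (entry T a' b).
  move=> /boxT[i [k [-> -> lti ltk]]] /boxT[i' [k' [-> eb lti' ltk']]]; rewrite ltnS => ltii'.
  elim: i' ltii' k' eb lti' ltk' => // i' IHi'; rewrite ltnS leq_eqVlt => leii' k' eb lti' ltk'.
  have /col_okP[szlt ok] := sortedP [::] cols _ lti'.
  have st : col_le (entry T i'.+1 (i.+1 + k)) (entry T i'.+2 (i.+1 + k)).
    by rewrite eb {1}addSnnS !entry_nth ok.
  case/orP: leii' => [/eqP <- //|ltii'] in st *.
  apply: col_le_trans st; apply: (IHi' ltii' k'.+1); rewrite ?addnS -?addSn //.
    exact: ltnW.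
  exact: leq_ltn_trans szlt.
split=> // [a b /boxT[i [k [-> -> lti ltk]]]|a b b' b1 b2|a a' b b1 b2|a a' b b1 b2 lt e|a b b' b1 b2 lt e].
- by rewrite entry_nth; apply: alph (mem_nth _ ltk); apply: mem_nth.
- rewrite leq_eqVlt => /orP[/eqP->|/(rowE _ _ _ b1 b2)].
    by rewrite /marked_le eqxx implybb orbT.
  by rewrite row_le_marked => /andP[].
- rewrite leq_eqVlt => /orP[/eqP->|/(colE _ _ _ b1 b2)].
    by rewrite /marked_le eqxx implybb orbT.
  by rewrite col_le_marked => /andP[].
- by have := colE _ _ _ b1 b2 lt; rewrite col_le_marked -e eqxx => /andP[].
- by have := rowE _ _ _ b1 b2 lt; rewrite row_le_marked -e eqxx => /andP[].
Qed.

Lemma ivanov_weightE la t T : [seq size row | row <- T] = la ->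
  ivanov_weight la t T = weight xvar t T.
Proof.
move=> sz; rewrite /ivanov_weight /weight (big_nth [::]) big_add1 /= -sz size_map.
apply: eq_big_nat => i /andP[_ lti]; rewrite (nth_map [::]) //.
rewrite -{1}[i.+1]add0n big_addn addKn /row_weight.
rewrite big_mkord; apply: eq_bigr => k _.
by rewrite addnC entry_nth addKn add0n addn1.
Qed.

(* The nonzero integers >= -N, enumerated increasingly from 0. *)
Definition index_of (N k : nat) : int := if (k < N)%N then k%:Z - N%:Z else k%:Z - N%:Z + 1.

Definition letters_upto (N j : nat) : seq int := rev (map (index_of N) (iota 0 (N + j))).

Lemma letters_uptoP N j (z : int) :
  (z \in letters_upto N j) = [&& z != 0, - N%:Z <= z & z <= j%:Z].
Proof.
rewrite mem_rev; apply/mapP/and3P => [[k] | [z0 lez lej]].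
  rewrite mem_iota add0n => /andP[_ ltk] ->; rewrite /index_of.
  by case: ltnP => ltkN; split; lia.
exists (if z < 0 then absz (z + N%:Z) else absz (z - 1 + N%:Z)).
  by rewrite mem_iota; case: ifP => ?; lia.
have {}z0 : z <> 0 by apply/eqP.
rewrite /index_of; case: (ltrP z 0) => zs.
  have -> : (absz (z + N%:Z)%R < N)%N by lia.
  by lia.
have -> : (absz (z - 1 + N%:Z)%R < N)%N = false by lia.
by lia.
Qed.

Lemma sorted_letters_upto N j : sorted >%R (letters_upto N j).
Proof.
rewrite rev_sorted sorted_map.
apply: (@sub_sorted _ ltn); last exact: iota_ltn_sorted.
by move=> k k' /= ltk; rewrite /index_of; case: ifP => ?; case: ifP => ?; lia.
Qed.

(** As t_1 = 0, the first box of a row contributes a bare variable, which must divide [m]; the other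
    letters of the row are at least as large. So letters below -N do not contribute to the
    coefficient of [m]. *)
Lemma ivanovQ_truncated la (j N : nat) t (m : {cmonom int}) :
    sorted gtn la -> all (leq 1) la -> t 1%N = 0 ->
    (forall z, z \in finsupp (cmonom_val m) -> - N%:Z <= z) ->
  ivanovQ la j t m =
    (qfun (map xvar (letters_upto N j)) (map (gpoly t) la))@_m.
Proof.
move=> so pos t1 suppN; rewrite /ivanovQ /series_sum -sum_tableaux //; last exact: sorted_letters_upto.
rewrite raddf_sum /=.
have subA T : T \in tableaux (letters_upto N j) la ->
    marked_shifted_tableau [set i : int | i != 0 /\ i <= j]%classic la T.
  move=> /(mem_tableaux T (sorted_letters_upto N j) so pos)[sz tT inT].
  apply/(mstP _ _ so pos); split=> // row rowT c cr.
  by have := allP (allP inT _ rowT) _ cr; rewrite letters_uptoP => /and3P[c0 _ cj].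
rewrite (fsbigE (tableaux (letters_upto N j) la)).
- rewrite big_seq_cond [RHS]big_seq; apply: eq_big => [T|T /andP[Tin _]].
    by apply/andP/idP => [[]//|Tin]; rewrite inE; split=> //; apply: subA.
  rewrite ivanov_weightE //.
  by have [] := (mem_tableaux T (sorted_letters_upto N j) so pos).1 Tin.
- exact: uniq_tableaux (sorted_letters_upto N j) pos.
- exact: subA.
move=> T /= /(mstP _ _ so pos)[sz tT inT]; apply: contraNeq; rewrite ivanov_weightE // => nz.
apply/(mem_tableaux T (sorted_letters_upto N j) so pos); split=> //.
apply/allP=> row rowT; apply/allP=> c cr; rewrite letters_uptoP.
have [c0 cj] : c.1 != 0 /\ c.1 <= j%:Z := inT row rowT c cr.
rewrite c0 cj andbT /=.
have [nzT _] := andP tT; have := allP nzT _ rowT.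
move: nz; rewrite /weight (perm_big _ (perm_to_rem rowT)) big_cons /=.
case: row {rowT} cr => // d row cr; rewrite row_weight_cons t1 mulr0 subr0 -mulrA => nz.
case/and3P=> _ alld _; apply: (@le_trans _ _ d.1).
  by apply: suppN; apply: xvar_dvd nz.
move: cr; rewrite inE => /orP[/eqP->//|/(allP alld)].
by rewrite /row_le => /orP[/ltW|/andP[/eqP->]].
Qed.

(** * Operators on involutions *)

Record invol := Invol { inv_fun :> nat -> nat; invK : involutive inv_fun }.

Lemma invol_eq (y z : invol) : y =1 z -> y = z.
Proof.
case: y z => [y yK] [z zK] /= /funext eyz; rewrite eyz in yK *.
by congr Invol; apply: Prop_irrelevance.
Qed.

Definition sw (i k : nat) : nat := if k == i then i.+1 else if k == i.+1 then i else k.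

Ltac case_sw :=
  repeat match goal with
  | |- context [@eq_op _ ?a ?b] =>
      lazymatch constr:((a, b)) with
      | context [if _ then _ else _] => fail | _ => idtac end;
      let H := fresh in case: (@eqP _ a b) => H /=; try (exfalso; lia)
  end.

Lemma swK i : involutive (sw i).
Proof. by move=> k; rewrite /sw; case_sw; lia. Qed.

Lemma swC i j k : (i.+1 < j)%N -> sw i (sw j k) = sw j (sw i k).
Proof. by move=> ij; rewrite /sw; case_sw; lia. Qed.

Lemma sw_braid i k : sw i (sw i.+1 (sw i k)) = sw i.+1 (sw i (sw i.+1 k)).
Proof. by rewrite /sw; case_sw; lia. Qed.

Lemma inv_sym (y : invol) k l : y k = l -> y l = k.
Proof. by move=> <-; rewrite invK. Qed.

Lemma inv_eqC (y : invol) k l : (y k == l) = (y l == k).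
Proof. by apply/eqP/eqP => /inv_sym. Qed.

Lemma inv_neq (y : invol) k l : k <> l -> y k <> y l.
Proof. by move=> ne e; apply: ne; rewrite -(invK y k) e invK. Qed.

(* The involution z with s_i o z o s_i = y, when i is a descent of y. *)
Definition down_fun i (y : nat -> nat) k :=
  if y i == i.+1 then sw i (y k) else sw i (y (sw i k)).

Lemma down_funK i (y : invol) : involutive (down_fun i y).
Proof.
move=> k; rewrite /down_fun; case: eqP => [e|_]; last by rewrite swK invK swK.
have e' : y i.+1 = i by rewrite -e invK.
have yE l : y (sw i l) = sw i (y l).
  have f1 := @inv_sym y l i; have f2 := @inv_sym y l i.+1.
  rewrite /sw; case: (@eqP _ l i) => [->|ni]; first by rewrite e' e; case_sw; lia.
  case: (@eqP _ l i.+1) => [->|ni']; first by rewrite e' e; case_sw; lia.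
  by case_sw; lia.
by rewrite yE swK invK.
Qed.

Definition down i (y : invol) : invol := Invol (@down_funK i y).

Definition desc i (y : nat -> nat) := (y i.+1 < y i)%N.

Lemma down_l i (y : invol) : down i y i = if y i == i.+1 then i else sw i (y i.+1).
Proof.
rewrite /down /= /down_fun; case: eqP => [->|_]; first by rewrite /sw eqxx; case: eqP => ?; lia.
by rewrite {2}/sw eqxx.
Qed.

Lemma down_r i (y : invol) : down i y i.+1 = if y i == i.+1 then i.+1 else sw i (y i).
Proof.
rewrite /down /= /down_fun; case: eqP => [e|_]; last first.
  by rewrite {2}/sw eqxx; case: eqP => ?; first lia.
by rewrite -{1}e invK /sw eqxx.
Qed.

Lemma down_out i (y : invol) k : k <> i -> k <> i.+1 -> down i y k = sw i (y k).
Proof.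
move=> ni ni'; rewrite /down /= /down_fun; case: ifP => // _.
by rewrite {2}/sw; do !case: eqP => ?.
Qed.

Ltac case_pair y k l :=
  let e := fresh in let e' := fresh in
  case: (@eqP _ (y k) l) => e;
  [have e' := inv_sym e | have e' : y l <> k by move/inv_sym]; try (exfalso; lia).

Ltac case_y y i :=
  case_pair y i i.+1; case_pair y i i.+2; case_pair y i.+1 i.+2;
  case: (@eqP _ (y i) i) => ?; try (exfalso; lia);
  case: (@eqP _ (y i.+1) i.+1) => ?; try (exfalso; lia);
  case: (@eqP _ (y i.+2) i.+2) => ?; try (exfalso; lia).

Lemma down_conj i (y : invol) k : y i <> i.+1 -> down i y k = sw i (y (sw i k)).
Proof. by move=> ne; rewrite /down /= /down_fun; case: eqP. Qed.

Lemma down_conjK i (y : invol) : y i <> i.+1 -> down i y i <> i.+1 -> down i (down i y) = y.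
Proof. by move=> ne ne'; apply: invol_eq => k; rewrite (down_conj k ne') (down_conj _ ne) !swK. Qed.

(** * Relations between the removals of a letter *)

Section DownRelations.
Variable y : invol.

Lemma desc_down i : desc i y -> desc i (down i y) = false.
Proof.
rewrite /desc down_l down_r /sw => d.
have f1 := @inv_sym y i i.+1.
by case_sw; lia.
Qed.

Lemma desc_downC i j : (i.+1 < j)%N ->
  desc i y && desc j (down i y) = desc j y && desc i (down j y).
Proof.
move=> ij; rewrite /desc !(@down_out i y j, @down_out i y j.+1, @down_out j y i, @down_out j y i.+1); try lia.
rewrite /sw !(inv_eqC y i) !(inv_eqC y i.+1).
have f1 := @inv_sym y j i; have f2 := @inv_sym y j.+1 i.
have f3 := @inv_sym y j i.+1; have f4 := @inv_sym y j.+1 i.+1.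
have f5 := @inv_sym y i j; have f6 := @inv_sym y i j.+1.
have f7 := @inv_sym y i.+1 j; have f8 := @inv_sym y i.+1 j.+1.
have g1 : y i <> y i.+1 by apply: inv_neq; lia.
have g2 : y j <> y j.+1 by apply: inv_neq; lia.
by case_sw; lia.
Qed.

Lemma downC i j : (i.+1 < j)%N -> down i (down j y) = down j (down i y).
Proof.
move=> ij; apply: invol_eq => k; rewrite {1 3}/down /= /down_fun.
have -> : (down j y i == i.+1) = (y i == i.+1).
  by rewrite down_out; try lia; rewrite /sw; case_sw; lia.
have -> : (down i y j == j.+1) = (y j == j.+1).
  by rewrite down_out; try lia; rewrite /sw; case_sw; lia.
rewrite /down /= /down_fun.
have sC l : sw i (sw j l) = sw j (sw i l) by apply: swC.
by case: (y i == i.+1); case: (y j == j.+1); rewrite ?sC.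
Qed.

(** A check of the relative positions of i, i + 1, i + 2 and their images. It makes both sides of
    [lower_braid] vanish together, and [down_braid] compares them otherwise. *)
Lemma desc_braid i :
  [&& desc i y, desc i.+1 (down i y) & desc i (down i.+1 (down i y))] =
  [&& desc i.+1 y, desc i (down i.+1 y) & desc i.+1 (down i (down i.+1 y))].
Proof.
have o1 Y : down i Y i.+2 = sw i (Y i.+2) by apply: down_out; lia.
have o2 Y : down i.+1 Y i = sw i.+1 (Y i) by apply: down_out; lia.
rewrite /desc !(down_l, down_r, o1, o2).
have h1 : y i <> y i.+1 by apply: inv_neq; lia.
have h2 : y i <> y i.+2 by apply: inv_neq; lia.
have h3 : y i.+1 <> y i.+2 by apply: inv_neq; lia.
rewrite /sw; case_y y i; case_sw; lia.
Qed.

Lemma down_braid i : desc i y -> desc i.+1 (down i y) -> desc i (down i.+1 (down i y)) ->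
  down i (down i.+1 (down i y)) = down i.+1 (down i (down i.+1 y)).
Proof.
move=> d1 d2 d3; apply: invol_eq => k; move: d1 d2 d3.
have o1 Y : down i Y i.+2 = sw i (Y i.+2) by apply: down_out; lia.
have o2 Y : down i.+1 Y i = sw i.+1 (Y i) by apply: down_out; lia.
rewrite /desc !(down_l, down_r, o1, o2).
have h1 : y i <> y i.+1 by apply: inv_neq; lia.
have h2 : y i <> y i.+2 by apply: inv_neq; lia.
have h3 : y i.+1 <> y i.+2 by apply: inv_neq; lia.
case: (@eqP _ k i) => [->|n0].
  rewrite !(down_l, down_r, o1, o2).
  rewrite /sw; case_y y i; case_sw; lia.
case: (@eqP _ k i.+1) => [->|n1].
  rewrite !(down_l, down_r, o1, o2).
  rewrite /sw; case_y y i; case_sw; lia.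
case: (@eqP _ k i.+2) => [->|n2].
  rewrite !(down_l, down_r, o1, o2).
  rewrite /sw; case_y y i; case_sw; lia.
have o3 Y : down i Y k = sw i (Y k) by apply: down_out.
have o4 Y : down i.+1 Y k = sw i.+1 (Y k) by apply: down_out.
rewrite !(o3, o4).
by move=> _ _ _; rewrite sw_braid.
Qed.

End DownRelations.

(** * NilCoxeter relations and the Yang-Baxter equation *)

Section Operators.
Variable R : comNzRingType.
Implicit Types (F G : invol -> R) (c x z : R) (y : invol).

Definition lower i F y : R := if desc i y then F (down i y) else 0.
Definition hop i c F y : R := F y + c * lower i F y.

Lemma lower_lin i c F G : lower i (fun y => F y + c * G y) = fun y => lower i F y + c * lower i G y.
Proof. by apply/funext=> y; rewrite /lower; case: ifP => _; rewrite ?mulr0 ?addr0. Qed.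

Lemma lower2 i F : lower i (lower i F) = fun=> 0.
Proof.
apply/funext=> y; rewrite /lower; case: ifP => // d.
by rewrite desc_down.
Qed.

Lemma lowerC i j F : (i.+1 < j)%N -> lower i (lower j F) = lower j (lower i F).
Proof.
move=> ij; apply/funext=> y; rewrite /lower.
have := desc_downC y ij; rewrite (downC y ij).
by case: (desc i y); case: (desc j y) => //= e; first [rewrite e | rewrite -e].
Qed.

Lemma lower_braid i F :
  lower i (lower i.+1 (lower i F)) = lower i.+1 (lower i (lower i.+1 F)).
Proof.
apply/funext=> y; have e := desc_braid y i; have b := @down_braid y i; move: e b.
rewrite /lower; case: (desc i y); case: (desc i.+1 (down i y));
  case: (desc i (down i.+1 (down i y))); case: (desc i.+1 y);
  case: (desc i (down i.+1 y)); case: (desc i.+1 (down i (down i.+1 y))) => //= _ b.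
by rewrite b.
Qed.

Lemma hop_hop i j c d F : hop i c (hop j d F) =
  fun y => F y + d * lower j F y + c * lower i F y + c * d * lower i (lower j F) y.
Proof.
by apply/funext=> y; rewrite /hop (lower_lin i d F (lower j F)); ring.
Qed.

Lemma hopD i c d F : hop i c (hop i d F) = hop i (c + d) F.
Proof. by rewrite hop_hop lower2; apply/funext=> y; rewrite /hop; ring. Qed.

Lemma hop0 i F : hop i 0 F = F.
Proof. by apply/funext=> y; rewrite /hop; ring. Qed.

Lemma hopC i j c d F : (i.+1 < j)%N -> hop i c (hop j d F) = hop j d (hop i c F).
Proof. by move=> ij; rewrite !hop_hop lowerC //; apply/funext=> y; ring. Qed.

(** Expand both sides. The squares vanish, the linear and quadratic terms agree because the middle
    parameter is c + d, and the cubic ones agree by the braid relation. *)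
Lemma yang_baxter i c d F :
  hop i c (hop i.+1 (c + d) (hop i d F)) = hop i.+1 d (hop i (c + d) (hop i.+1 c F)).
Proof.
apply/funext=> y; rewrite hop_hop [in RHS]hop_hop.
rewrite /hop !lower_lin !lower2 !lower_braid; ring.
Qed.

Fixpoint row_desc i n c F := if n is n'.+1 then hop i c (row_desc i.+1 n' c F) else F.
Fixpoint row_asc i n c F := if n is n'.+1 then row_asc i.+1 n' c (hop i c F) else F.

Lemma hop_row_desc j i n c d F : (j.+1 < i)%N ->
  hop j d (row_desc i n c F) = row_desc i n c (hop j d F).
Proof. by elim: n i => //= n IHn i ji; rewrite hopC // IHn // ltnW. Qed.

Lemma hop_row_asc j i n c d F : (j.+1 < i)%N ->
  hop j d (row_asc i n c F) = row_asc i n c (hop j d F).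
Proof. by elim: n i F => //= n IHn i F ji; rewrite IHn 1?ltnW // hopC. Qed.

(** The ascending product is carried out through the descending one by Yang-Baxter moves. Each
    product loses its factor at the letter [i], and these two merge into one with parameter x +
    c. *)
Lemma row_desc_asc i n x c F :
  row_desc i n.+1 c (row_asc i n.+1 x F) =
  row_asc i.+1 n x (hop i (x + c) (row_desc i.+1 n c F)).
Proof.
elim: n i F => [|n IHn] i F; first by rewrite /= hopD addrC.
have -> : row_desc i n.+2 c (row_asc i n.+2 x F) =
  hop i c (row_desc i.+1 n.+1 c (row_asc i.+1 n.+1 x (hop i x F))) by [].
rewrite IHn hop_row_asc //.
have -> : row_desc i.+2 n c (hop i x F) = hop i x (row_desc i.+2 n c F).
  by rewrite hop_row_desc.
by rewrite addrC yang_baxter (addrC c).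
Qed.

Lemma row_desc_ascC i n x c F :
  row_desc i n c (row_asc i n x F) = row_asc i n x (row_desc i n c F).
Proof. by case: n => // n; rewrite row_desc_asc /= hopD. Qed.

Lemma row_descK i n c F : row_desc i n c (row_asc i n (- c) F) = F.
Proof.
elim: n i F => // n IHn i F; rewrite row_desc_asc addNr hop0.
by rewrite -row_desc_ascC IHn.
Qed.

(** A descending product is the inverse of the ascending one with the opposite parameter, and
    ascending and descending products commute. *)
Lemma row_descC i n x c F : row_desc i n x (row_desc i n c F) = row_desc i n c (row_desc i n x F).
Proof.
have ascK H : row_asc i n (- c) (row_desc i n c H) = H.
  by rewrite -row_desc_ascC row_descK.
by rewrite -[LHS](row_descK i n c) -[row_asc _ _ _ _]row_desc_ascC ascK.
Qed.

End Operators.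

(* Order-preserving relabellings between the labels other than b and c and an
   interval shortened by one at both ends. *)
Definition close_up (b c v : nat) : nat :=
  if (v < b)%N then v.+1 else if (v < c)%N then v else v.-1.
Definition open_up (b c k : nat) : nat :=
  if (k <= b)%N then k.-1 else if (k < c)%N then k else k.+1.

Ltac case_lt :=
  repeat match goal with
  | |- context [if (?a <= ?b)%N then _ else _] =>
      lazymatch constr:((a, b)) with
      | context [if _ then _ else _] => fail | _ => idtac end;
      case: (leqP a b) => ? /=; try (exfalso; lia)
  | |- context [@eq_op _ ?a ?b] =>
      lazymatch constr:((a, b)) with
      | context [if _ then _ else _] => fail | _ => idtac end;
      let H := fresh in case: (@eqP _ a b) => H /=; try (exfalso; lia)
  end.

(** The values of [close_up] other than at b and c are positive, so label 0 is fixed by hand. When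
    (b, c) is not an arc, the identity keeps the function an involution. *)
Definition remove_fun (b c : nat) (y : nat -> nat) (k : nat) :=
  if (y b == c) && (b < c)%N then
    if k == 0%N then 0%N else close_up b c (y (open_up b c k))
  else k.

Lemma open_upK b c k : (b < c)%N -> (0 < k)%N -> close_up b c (open_up b c k) = k.
Proof. by move=> bc k0; rewrite /close_up /open_up; case_lt; lia. Qed.

Lemma close_upK b c v : (b < c)%N -> v <> b -> v <> c -> open_up b c (close_up b c v) = v.
Proof. by move=> bc vb vc; rewrite /close_up /open_up; case_lt; lia. Qed.

Lemma open_up_neq b c k : (b < c)%N -> (0 < k)%N -> open_up b c k <> b /\ open_up b c k <> c.
Proof. by move=> bc k0; rewrite /open_up; case_lt; lia. Qed.

Lemma close_up_gt0 b c v : (b < c)%N -> v <> b -> v <> c -> (0 < close_up b c v)%N.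
Proof. by move=> bc vb vc; rewrite /close_up; case_lt; lia. Qed.

(** * Removal of an arc *)

Section Remove.
Variables (b c : nat) (y : invol).
Hypotheses (bc : (b < c)%N) (ybc : y b = c).

Lemma inv_avoid k : k <> b -> k <> c -> y k <> b /\ y k <> c.
Proof.
move=> kb kc; split=> e; [apply: kc|apply: kb]; first by rewrite -ybc -e invK.
by rewrite -(invK y k) e -ybc invK.
Qed.

Lemma remove_funE k : (0 < k)%N -> remove_fun b c y k = close_up b c (y (open_up b c k)).
Proof. by rewrite /remove_fun ybc eqxx bc lt0n => /negbTE ->. Qed.

End Remove.

Lemma remove_funK b c (y : invol) : involutive (remove_fun b c y).
Proof.
move=> k; have [/andP[/eqP ybc bc]|no] := boolP ((y b == c) && (b < c)%N); last first.
  by rewrite /remove_fun (negPf no).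
have [->|kp] := posnP k; first by rewrite /remove_fun ybc eqxx bc.
rewrite (remove_funE bc ybc kp).
have [n1 n2] := open_up_neq bc kp; have [m1 m2] := inv_avoid ybc n1 n2.
by rewrite remove_funE // ?close_up_gt0 // close_upK // invK open_upK.
Qed.

Definition remove (b c : nat) (y : invol) : invol := Invol (@remove_funK b c y).

Lemma removeE b c (y : invol) k : (b < c)%N -> y b = c -> (0 < k)%N ->
  remove b c y k = close_up b c (y (open_up b c k)).
Proof. by move=> bc yb k0; apply: (remove_funE bc yb k0). Qed.

Lemma remove0 b c (y : invol) : remove b c y 0%N = 0%N.
Proof. by rewrite /remove /= /remove_fun; case: ifP. Qed.

Lemma remove_eq b c b' c' (y z : invol) : (b < c)%N -> (b' < c')%N -> y b = c -> z b' = c' ->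
  (forall k, (0 < k)%N -> close_up b c (y (open_up b c k)) = close_up b' c' (z (open_up b' c' k))) ->
  remove b c y = remove b' c' z.
Proof.
move=> bc bc' yb zb e; apply: invol_eq => k.
have [->|k0] := posnP k; first by rewrite !remove0.
by rewrite !removeE // e.
Qed.

(** When an end of an arc is moved by one, the involution left after its removal stays the same.
    This allows an arc to be moved step by step. *)
Lemma remove_down_r b m (v : invol) : (b < m)%N -> v b = m.+1 ->
  down m v b = m /\ remove b m (down m v) = remove b m.+1 v.
Proof.
move=> bm vb; have vm : v m <> m.+1 by rewrite -vb; apply: inv_neq; lia.
have dE k : down m v k = sw m (v (sw m k)) by apply: down_conj.
have db : down m v b = m by rewrite dE /sw; case_lt; rewrite ?vb; case_lt; lia.
split=> //; apply: remove_eq => //; first by lia.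
move=> k k0; rewrite dE.
have -> : sw m (open_up b m k) = open_up b m.+1 k by rewrite /sw /open_up; case_lt; lia.
have [n1 n2] := @open_up_neq b m.+1 k (leqW bm) k0.
have [m1 m2] := inv_avoid vb n1 n2; move: (v _) m1 m2 => u m1 m2.
by rewrite /close_up /sw; case_lt; lia.
Qed.

Lemma remove_down_l b c (v : invol) : (b.+1 < c)%N -> v b = c ->
  down b v b.+1 = c /\ remove b.+1 c (down b v) = remove b c v.
Proof.
move=> bm vb; have vm : v b <> b.+1 by lia.
have dE k : down b v k = sw b (v (sw b k)) by apply: down_conj.
have db : down b v b.+1 = c by rewrite dE /sw; case_lt; rewrite ?vb; case_lt; lia.
split=> //; apply: remove_eq => //; first by lia.
move=> k k0; rewrite dE.
have -> : sw b (open_up b.+1 c k) = open_up b c k by rewrite /sw /open_up; case_lt; lia.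
have [n1 n2] := @open_up_neq b c k (ltnW bm) k0.
have [m1 m2] := inv_avoid vb n1 n2; move: (v _) m1 m2 => u m1 m2.
by rewrite /close_up /sw; case_lt; lia.
Qed.

Lemma desc_remove b c j (w : invol) : (b < c)%N -> (c <= j)%N -> w b = c ->
  desc j.+1 w = desc j (remove b c w).
Proof.
move=> bc cj wb; rewrite /desc !removeE //; try lia.
have -> : open_up b c j = j.+1 by rewrite /open_up; case_lt; lia.
have -> : open_up b c j.+1 = j.+2 by rewrite /open_up; case_lt; lia.
have [m1 m2] := inv_avoid (k := j.+1) wb ltac:(lia) ltac:(lia).
have [m3 m4] := inv_avoid (k := j.+2) wb ltac:(lia) ltac:(lia).
have ne : w j.+1 <> w j.+2 by apply: inv_neq; lia.
by rewrite /close_up; case_lt; lia.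
Qed.

Lemma remove_down b c j (w : invol) : (b < c)%N -> (c <= j)%N -> w b = c ->
  down j.+1 w b = c /\ remove b c (down j.+1 w) = down j (remove b c w).
Proof.
move=> bc cj wb.
have db : down j.+1 w b = c by rewrite down_out ?wb /sw; try lia; case_lt; lia.
split=> //; apply: invol_eq => k.
have [->|k0] := posnP k; first by rewrite remove0 down_out ?remove0 /sw; try lia; case_lt; lia.
rewrite removeE // /down /= /down_fun.
have [m1 m2] := inv_avoid (k := j.+1) wb ltac:(lia) ltac:(lia).
have e : (remove_fun b c w j == j.+1) = (w j.+1 == j.+2).
  rewrite -[remove_fun b c w]/(inv_fun (remove b c w)) removeE //; try lia.
  have -> : open_up b c j = j.+1 by rewrite /open_up; case_lt; lia.
  by rewrite /close_up; case_lt; lia.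
have cs v : v <> b -> v <> c -> close_up b c (sw j.+1 v) = sw j (close_up b c v).
  by move=> vb vc; rewrite /close_up /sw; case_lt; lia.
rewrite e -[remove_fun b c w]/(inv_fun (remove b c w)).
have [n1 n2] := @open_up_neq b c k bc k0; have [p1 p2] := inv_avoid wb n1 n2.
case: eqP => _; first by rewrite removeE // cs.
have sk : (0 < sw j k)%N by rewrite /sw; case_lt; lia.
rewrite removeE //; have -> : open_up b c (sw j k) = sw j.+1 (open_up b c k).
  by rewrite /open_up /sw; case_lt; lia.
have [q1 q2] : sw j.+1 (open_up b c k) <> b /\ sw j.+1 (open_up b c k) <> c.
  by rewrite /sw; case_lt; lia.
by have [r1 r2] := inv_avoid wb q1 q2; rewrite cs.
Qed.

(** * Truncated Schubert polynomials *)

Section TruncatedSchubert.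
Variable R : comNzRingType.
Implicit Types (F G : invol -> R) (c u : R) (x : nat -> R) (y z w : invol).

Definition is_id (y : nat -> nat) : Prop := forall k, y k = k.
Definition delta y : R := `[< is_id y >]%:R.

Lemma delta_neq y k : y k <> k -> delta y = 0.
Proof. by move=> yk; rewrite /delta asboolF // => /(_ k). Qed.

Lemma down_id i y : desc i y -> is_id (down i y) <-> forall k, y k = sw i k.
Proof.
move=> d; split=> [idd k|ysw k].
  have yi : y i = i.+1.
    apply/eqP/negPn/negP => /negPf ne; have := idd i.
    rewrite down_l ne => /(congr1 (sw i)); rewrite swK => e.
    have := idd i.+1; rewrite down_r ne => /(congr1 (sw i)); rewrite swK => e'.
    by move: d; rewrite /desc e e' /sw; case_sw; lia.
  have := idd k; rewrite /down /= /down_fun yi eqxx => /(congr1 (sw i)).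
  by rewrite swK.
have yi : y i = i.+1 by rewrite ysw /sw eqxx.
by rewrite /down /= /down_fun yi eqxx ysw swK.
Qed.

Lemma lower_delta i y : lower i delta y = `[< forall k, y k = sw i k >]%:R.
Proof.
rewrite /lower; case: ifP => d.
  by rewrite /delta; congr (_%:R); apply/congr1/asbool_equiv_eq/down_id.
rewrite asboolF // => ysw; move/negP: d; apply.
by rewrite /desc !ysw /sw; case_sw; lia.
Qed.

Lemma lower_lower_delta i j y : j = i.+1 \/ i = j.+1 ->
  lower i (lower j delta) y = `[< forall k, y k = sw i (sw j (sw i k)) >]%:R.
Proof.
move=> ij; rewrite {1}/lower; case: ifP => d.
  rewrite lower_delta; congr (_%:R); apply/congr1/asbool_equiv_eq; split=> ysw k; last first.
    have ne : (y i == i.+1) = false by rewrite ysw; case: ij => ->; rewrite /sw; case_sw.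
    by rewrite /down /= /down_fun ne ysw !swK.
  case: (@eqP _ (y i) i.+1) => yi; last first.
    have := ysw (sw i k); rewrite /down /= /down_fun; case: eqP => // _.
    by rewrite swK => <-; rewrite swK.
  have yi' := inv_sym yi.
  have := ysw i; have := ysw i.+1; rewrite down_l down_r yi eqxx.
  by case: ij => ->; rewrite /sw; case_sw; lia.
rewrite asboolF // => ysw; move/negP: d; apply.
by rewrite /desc !ysw; case: ij => ->; rewrite /sw; case_sw; lia.
Qed.

(** The words i, i+1 and i+1, i both lead to the transposition of i and i + 2: the first two letters
    of an involution word may be exchanged. *)
Lemma hop_delta_comm i u c : hop i u (hop i.+1 c delta) = hop i.+1 c (hop i u delta).
Proof.
rewrite !hop_hop; apply/funext=> y; rewrite !lower_lower_delta; [|by right|by left].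
have -> : `[< forall k, y k = sw i (sw i.+1 (sw i k)) >] =
  `[< forall k, y k = sw i.+1 (sw i (sw i.+1 k)) >].
  by apply/asbool_equiv_eq; split=> ysw k; rewrite ysw sw_braid.
ring.
Qed.

Lemma row_desc_delta i n u : row_desc i n u delta = row_asc i n u delta.
Proof.
elim: n i => // n IHn i; rewrite /= IHn; case: n {IHn} => // n /=.
by rewrite hop_row_asc // hop_delta_comm.
Qed.

(* The Fomin-Kirillov factors of the labels lo, ..., lo + k - 1.  The outermost
   factor belongs to the largest label, since the last letter of a word is the one
   removed from y first and its index is the largest. *)
Fixpoint rows lo hi x k F :=
  if k is k'.+1 then
    row_desc (lo + k') (hi - (lo + k').+1) (x (lo + k')%N) (rows lo hi x k' F)
  else F.

Lemma rowsS lo hi x k F : rows lo hi x k.+1 F =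
  row_desc (lo + k) (hi - (lo + k).+1) (x (lo + k)%N) (rows lo hi x k F).
Proof. by []. Qed.

Definition schub lo hi x := rows lo hi x (hi - lo) delta.

Lemma eq_rows lo hi x x' k F : (forall i, (lo <= i < lo + k)%N -> x i = x' i) ->
  rows lo hi x k F = rows lo hi x' k F.
Proof.
elim: k => //= k IHk e; rewrite IHk => [|i ik]; last by apply: e; lia.
by rewrite e //; lia.
Qed.

(** The factor of k + 1 is the longer one, starting at letter [k], times 1 - x_(k+1) d_k. The two
    long factors commute, so exchanging the variables only changes this correction. The factors of
    larger labels commute with d_k. *)
Lemma schub_swap lo hi x k y : (lo <= k)%N -> (k.+1 < hi)%N ->
  schub lo hi (x \o sw k) y = hop k (x k.+1 - x k) (schub lo hi x) y.
Proof.
move=> lok kh; rewrite /schub.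
have -> : (hi - lo = (k - lo).+2 + (hi - k.+2))%N by lia.
elim: (hi - k.+2)%N y => [|m IHm] y.
  rewrite addn0 /= addnS subnKC // /sw !eqxx (_ : (k.+1 == k) = false); last by lia.
  have -> : (hi - k.+1 = (hi - k.+2).+1)%N by lia.
  rewrite (@eq_rows lo hi (x \o sw k) x); last first.
    by move=> i ik /=; rewrite /sw; case_sw.
  set n := (hi - k.+2)%N; set G := rows _ _ _ _ _.
  have e c H : row_desc k.+1 n c H = hop k (- c) (row_desc k n.+1 c H).
    by rewrite /= hopD addNr hop0.
  rewrite !e [in LHS]row_descC hopD.
  by congr (hop _ _ _ _); ring.
have {}IHm : rows lo hi (x \o sw k) ((k - lo).+2 + m) delta =
    hop k (x k.+1 - x k) (rows lo hi x ((k - lo).+2 + m) delta).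
  by apply/funext=> z; apply: IHm.
rewrite addnS (rowsS lo hi x) (rowsS lo hi (x \o sw k)) IHm -hop_row_desc; last by lia.
by congr (hop _ _ (row_desc _ _ _ _) _); rewrite /= /sw; case_sw.
Qed.

Lemma schub_down lo hi x k y : (lo <= k)%N -> (k.+1 < hi)%N -> desc k y ->
  (x k - x k.+1) * schub lo hi x (down k y) = schub lo hi x y - schub lo hi (x \o sw k) y.
Proof. by move=> lok kh d; rewrite schub_swap // /hop /lower d; ring. Qed.

(** What is left of the factors of lo, ..., lo + k after the factors 1 + x_lo d_i with i > lo + k
    have been moved outside. *)
Fixpoint tops lo hi x k : invol -> R :=
  let i := (lo + k.+1)%N in
  if k is k'.+1 then
    hop (lo + k) (x lo + x (lo + k)%N)
      (row_desc i (hi - i.+1) (x (lo + k)%N) (tops lo hi x k'))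
  else hop lo (x lo) delta.

(** On [delta] the factor of [lo] can be read in ascending order. Then [row_desc_asc] carries it
    past each further factor, leaving one operator with parameter x_lo + x_(lo+k) behind. *)
Lemma rows_tops lo hi x k : (lo + k.+1 < hi)%N ->
  rows lo hi x k.+1 delta = row_asc (lo + k.+1) (hi - (lo + k.+1).+1) (x lo) (tops lo hi x k).
Proof.
elim: k => [|k IHk] lk.
  rewrite /= addn0 row_desc_delta addn1 (_ : (hi - lo.+1 = (hi - lo.+2).+1)%N) //; lia.
rewrite rowsS IHk; last by lia.
have -> : (hi - (lo + k.+1).+1 = (hi - (lo + k.+2).+1).+1)%N by lia.
by rewrite row_desc_asc /= !addnS.
Qed.

(** The letters used exceed [i]: they do not move the label [m], and they keep its image above
    [i]. *)
Lemma tops_above_aux i (n : nat) c F m :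
    (forall z, (i < z m)%N -> F z = 0) -> (m < i)%N ->
  forall j z, (i < j)%N -> (i < z m)%N -> row_desc j n c F z = 0.
Proof.
move=> F0 mi; elim: n => [|n IHn] j z ij iz /=; first exact: F0.
rewrite /hop IHn //; last by lia.
rewrite /lower; case: ifP => _; last by ring.
rewrite IHn ?mulr0 ?addr0 //; first by lia.
by rewrite down_out; try lia; rewrite /sw; case_sw; lia.
Qed.

Lemma tops_above lo hi x k z : (lo + k.+1 < z lo)%N -> tops lo hi x k z = 0.
Proof.
elim: k z => [|k IHk] z lz /=.
  rewrite /hop lower_delta (@delta_neq _ lo); last by lia.
  by rewrite asboolF ?mulr0 ?addr0 // => /(_ lo); rewrite /sw eqxx; lia.
have aux w : (lo + k.+1 < w lo)%N ->
    row_desc (lo + k.+2) (hi - (lo + k.+2).+1) (x (lo + k.+1)%N) (tops lo hi x k) w = 0.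
  by move=> lw; apply: (@tops_above_aux (lo + k.+1) _ _ _ lo) => //; lia.
rewrite /hop aux; last by lia.
rewrite /lower; case: ifP => _; last by ring.
rewrite aux; first by ring.
by rewrite down_out; try lia; rewrite /sw; case_sw; lia.
Qed.

Lemma row_desc_remove (b c : nat) n u (C : R) F G (w : invol) : (b < c)%N -> w b = c ->
    (forall w, w b = c -> (forall k, (k < b)%N -> w k = k) -> F w = C * G (remove b c w)) ->
    (forall k, (k < b)%N -> w k = k) ->
  forall j, (c <= j)%N -> row_desc j.+1 n u F w = C * row_desc j n u G (remove b c w).
Proof.
move=> bc wb FG wf; elim: n w wb wf => [|n IHn] w wb wf j cj /=; first exact: FG.
rewrite /hop IHn //; last by lia.
rewrite /lower (desc_remove bc cj wb).
have [db <-] := remove_down bc cj wb.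
case: ifP => _; last by ring.
rewrite IHn //; [by ring| |by lia].
by move=> k kb; rewrite down_out; try lia; rewrite wf // /sw; case_sw; lia.
Qed.

(** The arc at [lo] is as long as the operators inside [tops] allow. By [tops_above], the outermost
    1 + (x_lo + x_i) d_i must then act by its second term, which shortens the arc by one. The
    descending factors in between act beyond the arc, hence on the involution without it, by letters
    shifted by one. *)
Lemma tops_at lo hi x k z : (lo + k.+1 < hi)%N ->
    z lo = (lo + k.+1)%N -> (forall i, (i < lo)%N -> z i = i) ->
  tops lo hi x k z = x lo * \prod_(lo.+1 <= m < lo + k.+1) (x lo + x m) *
     rows lo.+1 hi.-1 x k delta (remove lo (lo + k.+1)%N z).
Proof.
elim: k z => [|k IHk] z lk zlo zf.
  rewrite /= /hop lower_delta (@delta_neq _ lo); last by lia.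
  rewrite addn1 big_geq // add0r mulr1; congr (_ * _); rewrite /delta; congr (_%:R).
  apply/congr1/asbool_equiv_eq; rewrite addn1 in zlo; split=> [zsw i|rid i].
    have [->|i0] := posnP i; first by rewrite remove0.
    rewrite removeE // zsw /sw /close_up /open_up; case_lt; lia.
  have zlo' := inv_sym zlo.
  rewrite /sw; case: (@eqP _ i lo) => [->//|n1]; case: (@eqP _ i lo.+1) => [->//|n2].
  have [il|li] := ltnP i lo; first exact: zf.
  have := rid i.-1; rewrite removeE //; last by lia.
  have -> : open_up lo lo.+1 i.-1 = i by rewrite /open_up; case_lt; lia.
  have := inv_neq (y := z) n1; have := inv_neq (y := z) n2; rewrite zlo zlo'.
  by rewrite /close_up; case_lt; lia.
have above w : (lo + k.+1 < w lo)%N ->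
    row_desc (lo + k.+2) (hi - (lo + k.+2).+1) (x (lo + k.+1)%N) (tops lo hi x k) w = 0.
  move=> lw; apply: (@tops_above_aux (lo + k.+1) _ _ _ lo) => //; try lia.
  by move=> w'; apply: tops_above.
rewrite [tops _ _ _ _ _]/= /hop above ?add0r; last by lia.
have zi : z (lo + k.+2)%N = lo by apply: inv_sym.
have d : desc (lo + k.+1) z.
  rewrite /desc -addnS zi; have : z (lo + k.+1)%N <> z (lo + k.+2)%N by apply: inv_neq; lia.
  rewrite zi; have [//|] := ltnP lo (z (lo + k.+1)%N); rewrite leq_eqVlt => /orP[/eqP->//|lt].
  by have := zf _ lt; rewrite invK; lia.
rewrite /lower d.
have [||dlo rE] := @remove_down_r lo (lo + k.+1) z; [by lia|by rewrite zlo; lia|].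
have df i : (i < lo)%N -> down (lo + k.+1) z i = i.
  by move=> il; rewrite down_out; try lia; rewrite zf // /sw; case_sw; lia.
have -> : (lo + k.+2 = (lo + k.+1).+1)%N by lia.
rewrite (@row_desc_remove lo (lo + k.+1) _ _ (x lo * \prod_(lo.+1 <= m < lo + k.+1) (x lo + x m))
  _ (rows lo.+1 hi.-1 x k delta)) //; try lia; last first.
  by move=> w wlo wf; apply: IHk => //; lia.
rewrite rE big_nat_recr /=; last by lia.
have -> : (lo.+1 + k = lo + k.+1)%N by lia.
have -> : (hi.-1 - (lo + k.+1).+1 = hi - (lo + k.+1).+2)%N by lia.
by ring.
Qed.

Lemma schub_top lo hi x y : (lo.+1 < hi)%N -> y lo = hi.-1 ->
    (forall i, (i < lo)%N -> y i = i) ->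
  schub lo hi x y = x lo * \prod_(lo.+1 <= m < hi.-1) (x lo + x m) *
     schub lo.+1 hi.-1 x (remove lo hi.-1 y).
Proof.
move=> lh ylo yf; rewrite /schub; case: hi lh ylo => // h lh ylo.
have [k ek] : exists k, (h - lo = k.+1)%N by exists (h - lo).-1; lia.
have -> : (h.+1 - lo = k.+2)%N by lia.
have eh : (lo + k.+1 = h)%N by lia.
have e0 : (h.+1 - (lo + k.+1).+1 = 0)%N by lia.
have r0 i c (F : invol -> R) : row_desc i 0 c F = F by [].
have a0 i c (F : invol -> R) : row_asc i 0 c F = F by [].
rewrite rowsS e0 r0 rows_tops ?eh // subnn a0 tops_at ?eh //=.
by rewrite (_ : (h - lo.+1 = k)%N); last by lia.
Qed.

Lemma schub_id lo hi x y : is_id y -> schub lo hi x y = 1.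
Proof.
move=> yid; have hopid i c F : F y = 1 -> hop i c F y = 1.
  by move=> Fy; rewrite /hop /lower /desc !yid ltnNge leqnSn /= mulr0 addr0.
have rowid n i c F : F y = 1 -> row_desc i n c F y = 1.
  by elim: n i => //= n IHn i Fy; apply/hopid/IHn.
rewrite /schub; elim: (hi - lo)%N => [|k IHk] /=; first by rewrite /delta asboolT.
by apply: rowid.
Qed.

End TruncatedSchubert.

(** * Longest arcs of vexillary involutions *)

Section VexillaryDiagrams.
Local Open Scope nat_scope.

Definition vex (y : nat -> nat) : Prop := forall i1 i2 i3 i4,
  i1 < i2 < i3 -> i3 < i4 -> ~ [&& y i2 < y i1, y i1 < y i4 & y i4 < y i3].

Definition half_diagram (y : nat -> nat) a x := [&& x <= a, x < y a & a < y x].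

Definition essential (y : nat -> nat) a x :=
  [&& half_diagram y a x, ~~ half_diagram y a x.+1 & ~~ half_diagram y a.+1 x].

Definition fixes_outside lo hi (y : nat -> nat) := forall k, ~~ (lo <= k < hi) -> y k = k.

Lemma interval_injection (g : nat -> nat) m n p q : injective g -> p < q ->
  (forall k, m < k < n -> p < g k < q) -> n - m <= q - p.
Proof.
move=> gI pq gin.
have := @uniq_leq_size _ (map g (iota m.+1 (n - m.+1))) (iota p.+1 (q - p.+1)).
rewrite map_inj_uniq // iota_uniq => /(_ isT).
rewrite size_map !size_iota => le; suff: n - m.+1 <= q - p.+1 by lia.
apply: le => z /mapP[k]; rewrite !mem_iota => kin ->.
by have := gin k; lia.
Qed.

Section LongestArc.
Variables (y : invol) (b c : nat).
Hypotheses (y_vex : vex y) (bc : b < c) (yb : y b = c) (ymax : forall k, y k + b <= c + k).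

Lemma arc_right : y c = b. Proof. exact: inv_sym. Qed.

Lemma y_inj : injective y. Proof. exact: inv_inj (@invK y). Qed.

Lemma before_arc k : k < b -> y k < c.
Proof. by move=> kb; have := ymax k; lia. Qed.

Lemma after_arc k : c < k -> b < y k.
Proof. by move=> ck; have := ymax (y k); rewrite invK; lia. Qed.

Lemma no_arc_left k : k < y k -> y k < b -> False.
Proof.
move=> ky yb'; apply: (y_vex (i1 := k) (i2 := y k) (i3 := b) (i4 := c)) => //; first by rewrite ky.
by rewrite invK yb arc_right; lia.
Qed.

Lemma no_arc_right k : c < k -> k < y k -> False.
Proof.
move=> ck ky; apply: (y_vex (i1 := b) (i2 := c) (i3 := k) (i4 := y k)) => //; first by rewrite bc.
by rewrite invK yb arc_right; lia.
Qed.

(* Take the arc (e, f) with e < v and f largest.  If y e > y v, the interval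
   (f, c) injects into (v, b), which makes (e, f) longer than (b, c). *)
Lemma crossing_left e v : e < v -> v < b -> b < y e -> y e < y v.
Proof.
move=> ev vb bye; rewrite ltnNge; apply/negP => le.
have exf : exists f, y f < v by exists (y e); rewrite invK.
have bnd f : y f < v -> f <= v + c by have := ymax (y f); rewrite invK; lia.
case: (ex_maxnP exf bnd) => f yf fmax.
have ef : y e <= f by apply: fmax; rewrite invK.
have fc : f < c by rewrite -(invK y f); apply: before_arc; lia.
have qf : y v < f.
  have : y v <> y e by move/y_inj; lia.
  by lia.
have : c - f <= b - v.
  apply: (interval_injection y_inj vb) => g /andP[fg gc].
  have ygb : y g < b.
    have nb : y g <> b by rewrite -arc_right => /y_inj; lia.
    have [//|le'] := ltnP (y g) b; exfalso.
    apply: (y_vex (i1 := y v) (i2 := f) (i3 := g) (i4 := c)) => //; first by rewrite qf.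
    by rewrite invK arc_right; lia.
  have nv : y g <> v by move=> e'; have := invK y g; rewrite e'; lia.
  have : ~~ (y g < v) by apply/negP => /fmax; lia.
  by lia.
have := ymax (y f); rewrite invK; lia.
Qed.

Lemma crossing_right v f : c < v -> v < f -> y f < c -> y v < y f.
Proof.
move=> cv vf yfc; rewrite ltnNge; apply/negP => le.
have exe : exists e, v < y e by exists (y f); rewrite invK.
case: (ex_minnP exe) => e ye emin.
have ef : e <= y f by apply: emin; rewrite invK.
have be : b < e by rewrite -(invK y e); apply: after_arc; lia.
have eq' : e < y v.
  have : y v <> y f by move/y_inj; lia.
  by lia.
have : e - b <= v - c.
  apply: (interval_injection y_inj cv) => g /andP[bg ge].
  have ygc : c < y g.
    have nc : y g <> c by rewrite -yb => /y_inj; lia.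
    have [//|le'] := ltnP c (y g); exfalso.
    apply: (y_vex (i1 := b) (i2 := g) (i3 := e) (i4 := y v)) => //; first by rewrite bg.
    by rewrite invK yb; lia.
  have nv : y g <> v by move=> e'; have := invK y g; rewrite e'; lia.
  have : ~~ (v < y g) by apply/negP => /emin; lia.
  by lia.
have := ymax e; lia.
Qed.

Lemma half_diagram_last a x : c <= a -> half_diagram y a x = false.
Proof.
rewrite leq_eqVlt => /orP[/eqP<-|ca]; apply/negP => /and3P[xa xya ayx].
  by rewrite arc_right in xya; have := before_arc xya; lia.
have [xc|] := ltnP x c.
  have := @crossing_right a (y x) ca ayx; rewrite invK => /(_ xc); lia.
rewrite leq_eqVlt => /orP[/eqP cx|cx]; first by rewrite -cx arc_right in ayx; lia.
by apply: (no_arc_right cx); lia.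
Qed.

Lemma close_up_ltn u v : u <> b -> u <> c -> v <> b -> v <> c ->
  (close_up b c u < close_up b c v) = (u < v).
Proof. by move=> ub uc vb vc; rewrite /close_up; case_lt; lia. Qed.

Lemma close_up_leq u v : u <> b -> u <> c -> v <> b -> v <> c ->
  (close_up b c u <= close_up b c v) = (u <= v).
Proof. by move=> ub uc vb vc; rewrite leqNgt close_up_ltn // -leqNgt. Qed.

Lemma half_diagram_open a x : 0 < a -> 0 < x ->
  half_diagram (remove b c y) a x = half_diagram y (open_up b c a) (open_up b c x).
Proof.
move=> a0 x0; rewrite /half_diagram !removeE //.
rewrite -{1 2}(open_upK bc x0) -{1 3}(open_upK bc a0).
have [n1 n2] := open_up_neq bc a0; have [m1 m2] := open_up_neq bc x0.
have [p1 p2] := inv_avoid yb n1 n2; have [q1 q2] := inv_avoid yb m1 m2.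
by rewrite close_up_leq // !close_up_ltn.
Qed.

Lemma half_diagram_left a x : a <= b -> half_diagram y a x = (x <= a) && (b < y x).
Proof.
move=> ab; apply/and3P/andP => [[xa xya ayx]|[xa byx]].
  split=> //; rewrite ltnNge; apply/negP => le.
  have ne : y x <> b by move=> e; have := invK y x; rewrite e yb; lia.
  by apply: (@no_arc_left x); lia.
have [<-|xa'] := eqVneq x a; first by split; lia.
split; [by []| |by lia].
have [->|ab'] := eqVneq a b; first by rewrite yb; lia.
have := @crossing_left x a; lia.
Qed.

(** By [crossing_left], the boxes of a row in columns up to b are consecutive. The relabelling moves
    these columns by one to the right and so erases the first box. A box beyond column b stays in
    place and has the box in column b before it. The rows a <= b move too, but by
    [half_diagram_left] they depend on a only through x <= a. *)
Lemma half_diagram_remove a x : half_diagram (remove b c y) a x =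
  half_diagram y a x && has (half_diagram y a) (iota 0 x).
Proof.
have hasP' : reflect (exists2 x', x' < x & half_diagram y a x') (has (half_diagram y a) (iota 0 x)).
  by apply: (iffP hasP) => -[x']; rewrite ?mem_iota => ? ?; exists x' => //; rewrite mem_iota.
have [x0|x0] := posnP x; first by rewrite x0 andbF /half_diagram remove0 ltn0 !andbF.
have [a0|a0] := posnP a; first by rewrite a0 /half_diagram leqNgt x0.
rewrite half_diagram_open //.
have [ca|ac] := leqP c a.
  by rewrite !half_diagram_last //; rewrite /open_up; case_lt; lia.
have [ab|ba] := leqP a b.
  have -> : open_up b c a = a.-1 by rewrite /open_up; case_lt.
  have [xb|bx] := leqP x b; last first.
    rewrite [in RHS]half_diagram_left // [x <= a]leqNgt (leq_ltn_trans ab) //=.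
    have ao : a.-1 < open_up b c x by rewrite /open_up; case_lt; lia.
    by rewrite /half_diagram leqNgt ao.
  have -> : open_up b c x = x.-1 by rewrite /open_up; case_lt.
  rewrite !half_diagram_left //; last by lia.
  have -> : (x.-1 <= a.-1) = (x <= a) by lia.
  have [xa|//] := leqP x a; rewrite /=.
  apply/idP/andP => [bx|[bx /hasP'[x' x'x]]].
    split; last by apply/hasP'; exists x.-1; [lia|rewrite half_diagram_left // bx andbT; lia].
    have [->|xb'] := eqVneq x b; first by rewrite yb.
    by have := @crossing_left x.-1 x; lia.
  rewrite half_diagram_left // => /andP[_ bx'].
  have [<-//|ne] := eqVneq x' x.-1.
  by have := @crossing_left x' x.-1; lia.
have -> : open_up b c a = a by rewrite /open_up; case_lt; lia.
have [xb|bx] := leqP x b; last first.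
  have [xc|cx] := ltnP x c; last first.
    have ao : a < open_up b c x by rewrite /open_up; case_lt; lia.
    by rewrite /half_diagram [x <= a]leqNgt (leq_trans ac cx) /= [_ <= a]leqNgt ao.
  have -> : open_up b c x = x by rewrite /open_up; case_lt; lia.
  have [h|//] := boolP (half_diagram y a x); rewrite /=; apply/esym; apply/hasP'; exists b => //.
  by move: h => /and3P[]; rewrite /half_diagram yb; lia.
have -> : open_up b c x = x.-1 by rewrite /open_up; case_lt.
apply/idP/andP => [/and3P[xa xya ayx]|[/and3P[xa xya ayx] /hasP'[x' x'x /and3P[xa' xya' ayx']]]].
  split; last by apply/hasP'; exists x.-1; [lia|rewrite /half_diagram; lia].
  have ne : y a <> x.-1 by move=> e; lia.
  have lt : y x.-1 < y x.
    have [->|xb'] := eqVneq x b; first by rewrite yb; apply: before_arc; lia.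
    by apply: crossing_left; lia.
  have ne' : y a <> x by move=> e; have := invK y a; rewrite e; lia.
  by rewrite /half_diagram; lia.
rewrite /half_diagram; have [e|ne] := eqVneq x' x.-1; first by rewrite -e; lia.
by have := @crossing_left x' x.-1; lia.
Qed.

(** A neighbour of (a, x) in the old diagram would survive. On the right, (a, x) precedes it. Below,
    an earlier box (a, x') of the same row gives the earlier box (a + 1, x'), because y x' = a + 1
    would contradict x < y (a + 1). *)
Lemma essential_remove a x : essential (remove b c y) a x -> essential y a x.
Proof.
rewrite /essential !half_diagram_remove => /and3P[/andP[d /hasP[x']]].
rewrite mem_iota add0n => /andP[_ x'x] d' nr nd; rewrite d andTb; apply/andP; split.
  apply: contra nr => d1; rewrite d1 andTb; apply/hasP; exists x => //.
  by rewrite mem_iota; lia.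
apply: contra nd => d2; rewrite d2 andTb; apply/hasP; exists x'; first by rewrite mem_iota; lia.
move: d' d2 d => /and3P[? ? lt] /and3P[? ? ?] /and3P[? ? ?].
have ne : y x' <> a.+1 by move=> e; have := invK y x'; rewrite e; lia.
by rewrite /half_diagram; lia.
Qed.

Lemma nonempty_row a : has (half_diagram y a) (iota 0 a.+1) = (a < c) && (b < y a).
Proof.
apply/hasP/andP => [[x]|[ac bya]].
  rewrite mem_iota => _ d; have ac : a < c.
    by rewrite ltnNge; apply/negP => ca; rewrite (half_diagram_last _ ca) in d.
  split=> //; rewrite ltnNge; apply/negP => le.
  have ne : y a <> b by move=> e; have := invK y a; rewrite e yb; lia.
  case/and3P: d => xa xya ayx.
  have bx : b < y x.
    rewrite ltnNge; apply/negP => le'.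
    have ne' : y x <> b by move=> e; have := invK y x; rewrite e yb; lia.
    by apply: (@no_arc_left x); lia.
  by have := @crossing_left x (y a); rewrite invK; lia.
have [ab|ba] := ltnP a b.
  by exists a; rewrite ?mem_iota ?leqnn // /half_diagram; lia.
by exists b; rewrite ?mem_iota /half_diagram ?yb; lia.
Qed.

Lemma remove_vex : vex (remove b c y).
Proof.
move=> i1 i2 i3 i4 /andP[i12 i23] i34.
have [i10|i10] := posnP i1; first by rewrite i10 remove0 ltn0.
have i20 : 0 < i2 by lia. have i30 : 0 < i3 by lia. have i40 : 0 < i4 by lia.
have op k l : 0 < k -> 0 < l -> (open_up b c k < open_up b c l) = (k < l).
  by move=> k0 l0; rewrite /open_up; case_lt; lia.
have av k : 0 < k -> y (open_up b c k) <> b /\ y (open_up b c k) <> c.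
  by move=> k0; have [n1 n2] := open_up_neq bc k0; apply: inv_avoid.
rewrite !removeE // !close_up_ltn; try by [apply: (av _ _).1 | apply: (av _ _).2].
by apply: y_vex; rewrite !op // i12.
Qed.

Lemma remove_fixes lo hi : lo <= b -> c < hi -> fixes_outside lo hi y ->
  fixes_outside lo.+1 hi.-1 (remove b c y).
Proof.
move=> lob chi fix_y k kout.
have [->|k0] := posnP k; first by rewrite remove0.
rewrite removeE // fix_y ?open_upK //.
by rewrite /open_up; case_lt; lia.
Qed.

(** This makes the shape strict. Arcs beside (b, c) do not exist, arcs inside are shorter, and those
    crossing one end lose one unit of length by the relabelling. *)
Lemma remove_shorter k : remove b c y k + b < c + k.
Proof.
have [->|k0] := posnP k; first by rewrite remove0; lia.
rewrite removeE //; have [n1 n2] := open_up_neq bc k0; have := open_upK bc k0.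
have [m1 m2] := inv_avoid yb n1 n2.
move: (open_up b c k) n1 n2 m1 m2 => l n1 n2 m1 m2 <-.
have [yl|ly] := leqP (y l) l.
  have : close_up b c (y l) <= close_up b c l by rewrite close_up_leq.
  by lia.
have := ymax l; have := @no_arc_left l ly; have := @no_arc_right l; have := @before_arc l.
by rewrite /close_up; case_lt; lia.
Qed.

End LongestArc.

End VexillaryDiagrams.

(** * Shapes, 2-cycles and paths under removal of a longest arc *)

Section ShapesAndPaths.
Local Open Scope nat_scope.

Definition row_len (y : nat -> nat) a := count (half_diagram y a) (iota 0 a.+1).
Definition row_count (H : nat) (y : nat -> nat) k := count (fun a => k < row_len y a) (iota 0 H).
Definition arcs (H : nat) (y : nat -> nat) := count (fun a => a < y a) (iota 0 H).

Definition has_shape H la (y : nat -> nat) :=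
  (forall k, nth 0 la k = row_count H y k) /\ all (leq 1) la.

Lemma count_not_first (p : pred nat) n :
  count (fun x => p x && has p (iota 0 x)) (iota 0 n) = (count p (iota 0 n)).-1.
Proof.
elim: n => // n IHn; rewrite -addn1 iotaD !count_cat IHn /= !addn0 add0n has_count.
by case: (p n); lia.
Qed.

Section RemoveLongest.
Variables (y : invol) (b c : nat).
Hypotheses (y_vex : vex y) (bc : b < c) (yb : y b = c) (ymax : forall k, y k + b <= c + k).

Lemma row_len_remove a : row_len (remove b c y) a = (row_len y a).-1.
Proof.
rewrite /row_len -count_not_first; apply: eq_count => x.
exact: half_diagram_remove.
Qed.

Lemma row_count_remove H k : row_count H (remove b c y) k = row_count H y k.+1.
Proof. by apply: eq_count => a; rewrite row_len_remove; lia. Qed.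

(** Left ends of arcs are the diagonal boxes. Such a box survives if and only if its row has an
    earlier box, and by vexillarity this means that there is an earlier left end: two consecutive
    disjoint arcs form a 2143. So only the first left end is lost. *)
Lemma arcs_remove H : arcs H (remove b c y) = (arcs H y).-1.
Proof.
rewrite /arcs -count_not_first; apply: eq_count => a /=.
have dE (z : invol) : (a < z a) = half_diagram z a a by rewrite /half_diagram leqnn; lia.
rewrite (dE (remove b c y)) (dE y) half_diagram_remove //.
rewrite -dE; case: ltnP => //= aya.
apply: eq_in_has => e; rewrite mem_iota add0n => /andP[_ ea].
rewrite /half_diagram; apply/idP/idP => [|eye]; first by lia.
have ne : y e <> a by move=> ye; have := invK y e; rewrite ye; lia.
have [|le] := ltnP a (y e); first by lia.
exfalso; apply: (y_vex (i1 := e) (i2 := y e) (i3 := a) (i4 := y a)); try lia.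
by rewrite !invK; lia.
Qed.

(** The nonempty rows are the a < c with y a > b. The a < c with y a <= b are the images of the
    labels below b, all of which are below c by [before_arc]. *)
Lemma row_count_first H : c < H -> row_count H y 0 = c - b.
Proof.
move=> cH; have -> : row_count H y 0 = count (fun a => (a < c) && (b < y a)) (iota 0 H).
  by apply: eq_count => a; rewrite -has_count (nonempty_row y_vex bc yb ymax).
have -> : H = c + (H - c) by lia.
rewrite iotaD count_cat [X in _ + X](_ : _ = 0) ?addn0; last first.
  by apply/eqP; rewrite eqn0Ngt -has_count; apply/hasPn => a; rewrite mem_iota; lia.
have -> : count (fun a => (a < c) && (b < y a)) (iota 0 c) = count (predC (fun a => y a <= b)) (iota 0 c).
  by apply: eq_in_count => a; rewrite mem_iota /= => ac; lia.
have e := count_predC (fun a => y a <= b) (iota 0 c); rewrite size_iota in e.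
suff eb : count (fun a => y a <= b) (iota 0 c) = b by lia.
rewrite -size_filter -(size_map y) -[RHS](size_iota 0); apply/perm_size/uniq_perm.
- by rewrite map_inj_uniq ?filter_uniq ?iota_uniq //; apply: y_inj.
- exact: iota_uniq.
move=> k; apply/mapP/idP => [[a]|]; rewrite mem_iota.
  rewrite mem_filter mem_iota => /andP[le /andP[_ ac]] ->.
  have ne : y a <> b by move=> ya; have := invK y a; rewrite ya yb; lia.
  by lia.
move=> kb; exists (y k); last by rewrite invK.
by rewrite mem_filter invK mem_iota; have := @before_arc _ _ _ bc yb ymax k; lia.
Qed.

End RemoveLongest.

Lemma longest_arc (y : invol) hi : (forall k, hi <= k -> y k = k) -> ~ is_id y ->
  exists b, b < y b /\ forall k, y k + b <= y b + k.
Proof.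
move=> fix_y nid.
have lt_hi k : k < y k -> y k < hi.
  by move=> ky; rewrite ltnNge; apply/negP => /fix_y; rewrite invK; lia.
pose P m := has (fun b => y b == b + m) (iota 0 hi) && (0 < m).
have exP : exists m, P m.
  have [k yk] : exists k, y k <> k.
    by apply: contrapT => no; apply: nid => k; apply: contrapT => yk; apply: no; exists k.
  have up k' : k' < y k' -> exists m, P m.
    move=> ky; exists (y k' - k'); apply/andP; split; last by lia.
    by apply/hasP; exists k'; rewrite ?mem_iota; have := lt_hi _ ky; lia.
  have [/up//|yk'|e] := ltngtP k (y k); last by case: yk.
  by apply: (up (y k)); rewrite invK.
have bnd m : P m -> m <= hi.
  by case/andP=> /hasP[k _ /eqP yk] m0; have := @lt_hi k; rewrite yk; lia.
case: (ex_maxnP exP bnd) => m /andP[/hasP[b _ /eqP yb] m0] mmax.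
exists b; split=> [|k]; first by lia.
have [ky|] := ltnP k (y k); last by lia.
have := mmax (y k - k); rewrite /P => h.
have : y k - k <= m.
  apply: h; apply/andP; split; last by lia.
  by apply/hasP; exists k; rewrite ?mem_iota; have := lt_hi _ ky; lia.
by lia.
Qed.

Definition path_step (p q : nat * nat) : Prop :=
  q = (p.1.+1, p.2) \/ (0 < p.2 /\ q = (p.1, p.2.-1)).

Lemma path_diff (p : nat -> nat * nat) r s : (p 0).1 = (p 0).2 ->
  (forall s, s.+1 < r -> path_step (p s) (p s.+1)) -> s < r -> (p s).1 = (p s).2 + s.
Proof.
move=> p0 st; elim: s => [|s IHs] sr; first by rewrite p0 addn0.
by have := IHs (ltnW sr); case: (st s sr) => [->|[? ->]] /=; lia.
Qed.

Lemma path_mono (p : nat -> nat * nat) r s u :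
  (forall s, s.+1 < r -> path_step (p s) (p s.+1)) -> s + u < r ->
  (p s).1 <= (p (s + u)).1 /\ (p (s + u)).2 <= (p s).2.
Proof.
move=> st; elim: u => [|u IHu] sr; first by rewrite addn0.
rewrite addnS in sr *; have [] := IHu (ltnW sr).
by case: (st _ sr) => [->|[? ->]] /=; lia.
Qed.

(* The longest arcs parallel and adjacent to a given one form a run
   (b0 + i, b0 + i + r), i <= T; its inner corner (b0 + r - 1, b0 + T) is an
   essential box, and every path leaving it meets one of the arcs. *)
Lemma path_longest_arc (y : invol) hi (p : nat -> nat * nat) b0 r :
    (forall k, hi <= k -> y k = k) -> 0 < r -> y b0 = b0 + r -> (forall k, y k <= k + r) ->
    (p 0).1 = (p 0).2 -> (forall s, s.+1 < r -> path_step (p s) (p s.+1)) ->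
    (forall a x, essential y a x -> exists2 s, s < r & p s = (a.+1, x.+1)) ->
  exists2 b, p r.-1 = (b + r, b.+1) & y b = b + r.
Proof.
move=> fix_y r0 yb0 ymax p0 st ess.
have exb : exists b, y b == b + r by exists b0; apply/eqP.
case: (ex_minnP exb) => {yb0} {}b0 /eqP yb0 bmin.
have exT : exists T, y (b0 + T.+1) != b0 + T.+1 + r.
  by exists hi; rewrite fix_y; lia.
case: (ex_minnP exT) => T yT Tmin.
have run i : i <= T -> y (b0 + i) = b0 + i + r.
  case: i => [|i iT]; first by rewrite addn0.
  by apply/eqP/negPn/negP => /Tmin; lia.
have Tr : T < r.
  by rewrite ltnNge; apply/negP => /run; rewrite -yb0 invK; lia.
have eb : essential y (b0 + r).-1 (b0 + T).
  apply/and3P; split.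
  - rewrite /half_diagram run //; apply/and3P; split; [by lia| |by lia].
    rewrite ltnNge; apply/negP => le; move: (invK y (b0 + r).-1) le.
    move: (y (b0 + r).-1) => u yu ub.
    have [ult|leu] := ltnP u b0.
      have : ~~ (y u == u + r) by apply/negP => /bmin; lia.
      by have := ymax u; lia.
    have := run (u - b0); rewrite subnKC // yu; lia.
  - apply/negP => /and3P[le1 _]; move: (ymax (b0 + T).+1) yT; rewrite addnS.
    move: (invK y (b0 + T).+1); move: (y (b0 + T).+1) => w yw wle wne wge.
    have wlt : w - (b0 + r) <= T by lia.
    have wE : b0 + (w - (b0 + r)) + r = w by lia.
    by have := inv_sym (run _ wlt); rewrite wE yw; lia.
  have yc : y (b0 + r) = b0 by rewrite -yb0 invK.
  by apply/negP; rewrite /half_diagram prednK ?yc; lia.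
have [s sr ps] := ess _ _ eb.
have sE : s = r.-1 - T by have := path_diff p0 st sr; rewrite ps /=; lia.
have lt1 : s + T < r by lia.
have [m1 m2] := path_mono st lt1; have d := path_diff p0 st lt1.
rewrite (_ : s + T = r.-1) in m1 m2 d; last by lia.
rewrite ps /= in m1 m2.
case: (p r.-1) m1 m2 d => A B /= m1 m2 d.
have vT : A - (b0 + r) <= T by lia.
by exists (b0 + (A - (b0 + r))); [congr (_, _); lia | exact: run].
Qed.

End ShapesAndPaths.

(** * Inserting an arc on both sides *)

Section ArcInsertion.
Variable R : comNzRingType.
Implicit Types (x : nat -> R) (y z : invol) (p : nat -> nat * nat) (gs : seq {poly R}).

(** Lets the factor x_k - x_(k+1) be cancelled from a divided difference identity. *)
Definition regular_family x := forall i k, i <> k -> GRing.lreg (x i - x k).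

Lemma regular_sw x k : regular_family x -> regular_family (x \o sw k).
Proof. by move=> reg i l il; apply: reg => /(can_inj (swK k)). Qed.

Definition variables (lo j : nat) x : seq R := map x (rev (iota lo (j - lo))).

Lemma variables_sw lo j k x gs : regular_family x -> (lo <= k)%N -> (k.+1 < j)%N ->
  qfun (variables lo j (x \o sw k)) gs = qfun (variables lo j x) gs.
Proof.
move=> reg lok kj.
have vE (x' : nat -> R) : variables lo j x' =
    map x' (rev (iota k.+2 (j - k.+2))) ++ x' k.+1 :: x' k :: map x' (rev (iota lo (k - lo))).
  rewrite /variables -[x' k.+1 :: _]/(map x' [:: k.+1, k & rev (iota lo (k - lo))]) -map_cat.
  congr map; rewrite (_ : (j - lo = (k - lo) + (2 + (j - k.+2)))%N); last by lia.
  rewrite iotaD rev_cat subnKC // iotaD rev_cat addn2 -catA.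
  by rewrite /rev /=.
rewrite !vE /= qfun_swap; last by apply: reg; rewrite /sw; case_sw.
have out s : (forall i, i \in s -> i <> k /\ i <> k.+1) -> map (x \o sw k) s = map x s.
  by move=> ks; apply/eq_in_map => i /ks[n1 n2] /=; rewrite /sw; case_sw.
rewrite !out; try by move=> i; rewrite mem_rev mem_iota; lia.
by congr (qfun (_ ++ x _ :: x _ :: _) _); rewrite /sw; case_sw.
Qed.

Definition hook j b c x : {poly R} :=
  \prod_(j <= i < c) ('X + (x i)%:P) * \prod_(b.+1 <= i < j) ('X - (x i)%:P).

(** For an arc starting at [lo], the hook vanishes at every variable but x_lo, which is innermost,
    so [qfun_vanish] applies. *)
Lemma qfun_hook_top lo j hi x gs : (lo < j <= hi.-1)%N ->
  qfun (variables lo j x) (hook j lo hi.-1 x :: gs) =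
  x lo * \prod_(lo.+1 <= m < hi.-1) (x lo + x m) * qfun (variables lo.+1 j x) gs.
Proof.
case/andP=> loj jhi.
have -> : variables lo j x = rcons (variables lo.+1 j x) (x lo).
  rewrite /variables -map_rcons -rev_cons.
  by rewrite (_ : (j - lo = (j - lo.+1).+1)%N) //; lia.
have prev (s : seq nat) : perm_eq (rev s) s by rewrite perm_rev.
have varsE (F : R -> {poly R}) : \prod_(u <- variables lo.+1 j x) F u = \prod_(lo.+1 <= i < j) F (x i).
  by rewrite big_map (perm_big _ (prev _)) /index_iota.
have varsE' (F : R -> R) : \prod_(u <- variables lo.+1 j x) F u = \prod_(lo.+1 <= i < j) F (x i).
  by rewrite big_map (perm_big _ (prev _)) /index_iota.
rewrite /hook -(varsE (fun u => 'X - u%:P)) qfun_vanish; congr (_ * _).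
rewrite /value horner_prod -mulrA; congr (_ * _).
have -> : \prod_(lo.+1 <= m < hi.-1) (x lo + x m) =
    \prod_(lo.+1 <= m < j) (x lo + x m) * \prod_(j <= m < hi.-1) (x lo + x m).
  by rewrite -big_cat_nat.
rewrite varsE' mulrC; congr (_ * _).
by apply: eq_bigr => i _; rewrite hornerD hornerX hornerC.
Qed.

Lemma eq_variables lo j x x' : (forall i, (lo <= i < j)%N -> x i = x' i) ->
  variables lo j x = variables lo j x'.
Proof. by move=> e; apply/eq_in_map => i; rewrite mem_rev mem_iota => ?; apply: e; lia. Qed.

(* Moving the arc (b, c) outwards to (lo, hi - 1), the divided differences act
   on both sides; they strip the factors X - x_i and X + x_i off the first
   argument one at a time. *)
Lemma schub_insert lo hi j B C (K : R) (gs : (nat -> R) -> seq {poly R}) :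
    (forall x x', (forall i, (B <= i < C)%N -> x i = x' i) -> gs x = gs x') ->
  forall n b c y, (n = (b - lo) + (hi.-1 - c))%N ->
    (lo <= b < B)%N -> (C <= c < hi)%N -> (b < j <= c)%N ->
    y b = c -> (forall k, (k < b)%N -> (y k < c)%N) -> (forall k, (c < k)%N -> (b < y k)%N) ->
    (forall k, (k < lo)%N -> y k = k) ->
    (forall x, regular_family x ->
       K * schub lo.+1 hi.-1 x (remove b c y) = qfun (variables lo.+1 j x) (gs x)) ->
  forall x, regular_family x ->
    K * schub lo hi x y = qfun (variables lo j x) (hook j b c x :: gs x).
Proof.
move=> gs_loc; elim=> [|n IHn] b c y en bB cC bj yb left right fix_y yrem x reg.
  have eb : b = lo by lia. have ec : c = hi.-1 by lia.
  rewrite eb ec in yb yrem *; rewrite qfun_hook_top; last by lia.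
  rewrite schub_top //; last by lia.
  by rewrite mulrCA yrem.
have linear (g h : {poly R}) (d : R) vars : qfun vars (d *: g + h :: gs x) =
    d * qfun vars (g :: gs x) + qfun vars (h :: gs x).
  have := @multilinear_qfun _ vars [::] h g d (gs x).
  by rewrite /= addrC => ->; rewrite addrC.
have [lob|blo] := ltnP lo b.
  have [k kE] : exists k, b = k.+1 by exists b.-1; lia.
  rewrite kE in yb left right yrem bB bj en lob *.
  (* Since [k] is not a descent of [y], [down k] is a conjugation that lengthens the arc to (k, c).
     It has a descent at [k], and applying [down k] again recovers [y]. *)
  have yk : y k <> k.+1 by move=> /inv_sym; lia.
  have vE i : down k y i = sw k (y (sw k i)) by apply: down_conj.
  have vk : down k y k = c by rewrite vE /sw eqxx yb; case_sw; lia.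
  have kc : (k.+1 < c)%N by lia.
  have dv : down k (down k y) = y.
    have vk' : down k y k <> k.+1 by rewrite vk; lia.
    exact: down_conjK.
  have desc_v : desc k (down k y).
    rewrite /desc vk vE /sw; have := left k (leqnn _).
    by have -> : (k.+1 == k) = false by [lia]; rewrite eqxx; case_sw; lia.
  have [] := remove_down_l kc vk; rewrite dv => _ rE.
  have IH := IHn k c (down k y).
  have {}IH : forall x, regular_family x ->
      K * schub lo hi x (down k y) = qfun (variables lo j x) (hook j k c x :: gs x).
    apply: IH => //; try lia.
    - move=> i ik; rewrite vE; have := left i (ltnW ik).
      by rewrite /sw; case_sw; case_sw; lia.
    - move=> i ci; rewrite vE; have := right i ci.
      by rewrite /sw; case_sw; case_sw; lia.
    - move=> i il; have si : sw k i = i by rewrite /sw; case_sw.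
      by rewrite vE si fix_y.
    by rewrite -rE.
  have reg' := regular_sw (k := k) reg.
  have nk : k <> k.+1 by lia.
  apply: (reg _ _ nk); rewrite mulrCA -[in LHS]dv schub_down //; try lia.
  rewrite mulrBr !IH // variables_sw //; try lia.
  rewrite (gs_loc (x \o sw k) x); last by move=> i iB /=; rewrite /sw; case_sw.
  (* The two hooks differ in one factor, X - x_(k+1) against X - x_k. *)
  apply/(canLR (addrK _)); rewrite -linear; congr (qfun _ (_ :: _)).
  rewrite /hook (big_ltn (m := k.+1)) ?[in RHS](big_ltn (m := k.+1)); try lia.
  have e1 : \prod_(j <= i < c) ('X + ((x \o sw k) i)%:P) = \prod_(j <= i < c) ('X + (x i)%:P).
    by apply: eq_big_nat => i ij /=; rewrite /sw; case_sw.
  have e2 : \prod_(k.+2 <= i < j) ('X - ((x \o sw k) i)%:P) = \prod_(k.+2 <= i < j) ('X - (x i)%:P).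
    by apply: eq_big_nat => i ij /=; rewrite /sw; case_sw.
  rewrite e1 e2 /= (_ : sw k k.+1 = k); last by rewrite /sw; case_sw.
  by rewrite -mul_polyC rmorphB /=; ring.
have yc : y c <> c.+1 by rewrite (inv_sym yb); lia.
have vE i : down c y i = sw c (y (sw c i)) by apply: down_conj.
have sb : sw c b = b by rewrite /sw; case_sw; lia.
have vb : down c y b = c.+1 by rewrite vE sb yb /sw eqxx.
have yc' : y c = b by apply: inv_sym.
have vc : down c y c.+1 = b by apply: inv_sym.
have bc : (b < c)%N by lia.
have dv : down c (down c y) = y.
  have vc' : down c y c <> c.+1 by move=> /inv_sym; rewrite vc; lia.
  exact: down_conjK.
have desc_v : desc c (down c y).
  rewrite /desc vc vE; have := right c.+1 (leqnn _).
  by rewrite /sw; case_sw; case_sw; lia.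
have [] := remove_down_r bc vb; rewrite dv => _ rE.
have IH : forall x, regular_family x ->
    K * schub lo hi x (down c y) = qfun (variables lo j x) (hook j b c.+1 x :: gs x).
  apply: (IHn b c.+1 (down c y)) => //; try lia.
  - move=> i ib; rewrite vE; have := left i ib.
    by rewrite /sw; case_sw; case_sw; lia.
  - move=> i ci; rewrite vE; have := right i (ltnW ci).
    by rewrite /sw; case_sw; case_sw; lia.
  - move=> i il; have si : sw c i = i by rewrite /sw; case_sw.
    by rewrite vE si fix_y.
  by rewrite -rE.
have reg' := regular_sw (k := c) reg.
have nc : c <> c.+1 by lia.
apply: (reg _ _ nc); rewrite mulrCA -[in LHS]dv schub_down //; try lia.
rewrite mulrBr !IH //.
rewrite (@eq_variables lo j (x \o sw c) x); last by move=> i ij /=; rewrite /sw; case_sw.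
rewrite (gs_loc (x \o sw c) x); last by move=> i iB /=; rewrite /sw; case_sw.
(* Here the differing factors are X + x_c and X + x_(c+1). *)
apply/(canLR (addrK _)); rewrite -linear; congr (qfun _ (_ :: _)).
rewrite /hook (big_nat_recr c) ?[in RHS](big_nat_recr c); try lia.
have e1 : \prod_(j <= i < c) ('X + ((x \o sw c) i)%:P) = \prod_(j <= i < c) ('X + (x i)%:P).
  by apply: eq_big_nat => i ij /=; rewrite /sw; case_sw.
have e2 : \prod_(b.+1 <= i < j) ('X - ((x \o sw c) i)%:P) = \prod_(b.+1 <= i < j) ('X - (x i)%:P).
  by apply: eq_big_nat => i ij /=; rewrite /sw; case_sw.
rewrite /= e1 e2 (_ : sw c c = c.+1); last by rewrite /sw; case_sw.
by rewrite -mul_polyC rmorphB /=; ring.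
Qed.

End ArcInsertion.

Lemma row_count_id H (y : nat -> nat) k : is_id y -> row_count H y k = 0%N.
Proof.
move=> yid; apply/eqP; rewrite eqn0Ngt -has_count; apply/hasPn => a _.
rewrite (_ : row_len y a = 0%N) //; apply/eqP; rewrite eqn0Ngt -has_count.
by apply/hasPn => x _; rewrite /half_diagram !yid; lia.
Qed.

Lemma shape_head lo hi H la (y : invol) : (hi <= H)%N -> fixes_outside lo hi y -> vex y ->
    has_shape H la y ->
  (is_id y /\ la = [::]) \/
  [/\ (0 < head 0 la)%N, exists b, y b = (b + head 0 la)%N & forall k, (y k <= k + head 0 la)%N].
Proof.
move=> hiH fix_y vy [la_row la_pos].
have hd : head 0%N la = row_count H y 0 by rewrite -la_row nth0.
have [yid|nid] := pselect (is_id y).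
  left; split=> //; rewrite (row_count_id _ _ yid) in hd.
  by case: (la) la_pos hd => //= n l /andP[+ _] n0; rewrite n0.
right; have fix' k : (hi <= k)%N -> y k = k by move=> hk; apply: fix_y; lia.
have [b [byb ymax]] := longest_arc fix' nid.
have cH : (y b < H)%N.
  by rewrite ltnNge; apply/negP => hc; have := fix' (y b); rewrite invK; lia.
have max' k : (y k + b <= y b + k)%N by [].
rewrite hd (row_count_first vy byb (erefl _) max' cH).
by split; [lia | exists b; lia | move=> k; have := ymax k; lia].
Qed.

(** * The identity for involutions of the labels *)

Section SchubQfun.
Variable R : comNzRingType.
Implicit Types (x : nat -> R) (y : invol) (p : nat -> nat * nat).

(** The parameter t_s = -x^P_s, attached to the step from p (s - 2) to p (s - 1). Positions count
    from 1 and labels from 0, so entering row i + 1 involves label i and leaving column b involves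
    label b - 1. *)
Definition path_param p x s : R :=
  if (p s.-1).1 == (p s.-2).1.+1 then - x (p s.-2).1 else x (p s.-2).2.-1.

Lemma gpoly_path p j r s x : p 0%N = (j, j) ->
    (forall s, (s.+1 < r)%N -> path_step (p s) (p s.+1)) -> (s < r)%N ->
  gpoly (path_param p x) s.+1 = 2%:R%:P *
    (\prod_(j <= i < (p s).1) ('X + (x i)%:P) * \prod_((p s).2 <= i < j) ('X - (x i)%:P)).
Proof.
move=> p0 st; elim: s => [|s IHs] sr.
  by rewrite /gpoly p0 /= !big_geq ?mulr1.
rewrite gpolyS // IHs 1?ltnW // -!mulrA; congr (_ * _).
have [] := path_mono st (s := 0) (u := s) (ltnW sr); rewrite add0n p0 /= => m1 m2.
rewrite /path_param /=; case: (st _ sr) => [e|[q0 e]]; rewrite e /=.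
  by rewrite eqxx [in RHS]big_nat_recr //= rmorphN /=; ring.
rewrite (_ : (_ == _) = false); last by lia.
rewrite [in RHS](big_ltn (m := (p s).2.-1)); last by lia.
by rewrite prednK //; ring.
Qed.

Lemma gpoly_path_local p j r s x x' : p 0%N = (j, j) ->
    (forall s, (s.+1 < r)%N -> path_step (p s) (p s.+1)) -> (s < r)%N ->
    (forall i, ((p s).2 <= i < (p s).1)%N -> x i = x' i) ->
  gpoly (path_param p x) s.+1 = gpoly (path_param p x') s.+1.
Proof.
move=> p0 st sr ex.
have [] := path_mono st (s := 0) (u := s) sr; rewrite add0n p0 /= => m1 m2.
rewrite !(gpoly_path x p0 st sr) (gpoly_path x' p0 st sr); congr (_ * (_ * _)).
  by apply: eq_big_nat => i ij; rewrite ex //; lia.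
by apply: eq_big_nat => i ij; rewrite ex //; lia.
Qed.

(** The path and its starting point stay fixed in the induction on [la], while lo and hi move
    inwards. The bound [H] keeps the range of the row counts constant. Only the positions before
    step [head 0 la] are constrained, so the smaller shape uses an initial part of the path. *)
Theorem schub_qfun la lo hi H y p j : (hi <= H)%N -> fixes_outside lo hi y -> vex y ->
    has_shape H la y -> p 0%N = (j, j) ->
    (forall s, (s.+1 < head 0%N la)%N -> path_step (p s) (p s.+1)) ->
    (forall a z, essential y a z -> exists2 s, (s < head 0%N la)%N & p s = (a.+1, z.+1)) ->
  [/\ sorted gtn la, size la = arcs H y & forall x, regular_family x ->
    2%:R ^+ size la * schub lo hi x y =
      qfun (variables lo j x) (map (gpoly (path_param p x)) la)].
Proof.
elim: la lo hi y => [|r la IHla] lo hi y hiH fix_y vy sh p0 st ess.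
  have [[yid _]|[//]] := shape_head hiH fix_y vy sh.
  split=> // [|x _]; last by rewrite schub_id // qfun_nil mulr1.
  by apply/esym/eqP; rewrite eqn0Ngt -has_count; apply/hasPn => a _; rewrite yid ltnn.
have [[_ //]|[/= r0 [b0 yb0] ymax]] := shape_head hiH fix_y vy sh.
have fix' k : (hi <= k)%N -> y k = k by move=> hk; apply: fix_y; lia.
have p0' : (p 0%N).1 = (p 0%N).2 by rewrite p0.
have [b pr yb] := path_longest_arc fix' r0 yb0 ymax p0' st ess.
set c := (b + r)%N in pr yb; have bc : (b < c)%N by rewrite /c; lia.
have ymaxc k : (y k + b <= c + k)%N by have := ymax k; rewrite /c; lia.
have yc : y c = b by apply: inv_sym.
have chi : (c < hi)%N by rewrite ltnNge; apply/negP => /fix'; lia.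
have lob : (lo <= b)%N by rewrite leqNgt; apply/negP => bl; have := fix_y b; lia.
have cH : (c < H)%N by lia.
have fix_r := remove_fixes bc yb lob chi fix_y.
have vr := remove_vex vy bc yb.
have sh' : has_shape H la (remove b c y).
  case: sh => la_row /= /andP[_ pos]; split=> // k.
  by rewrite row_count_remove // -la_row.
have hiH' : (hi.-1 <= H)%N by lia.
have [hd_lt hd_max] : (head 0 la < r)%N /\ forall k, (remove b c y k <= k + head 0 la)%N.
  have [[yid ->]|[h0 [b1 yb1] hmax]] := shape_head hiH' fix_r vr sh'.
    by split=> // k; rewrite yid; lia.
  split=> //; have := remove_shorter vy bc yb ymaxc b1.
  by rewrite yb1 /c; lia.
have st' s : (s.+1 < head 0 la)%N -> path_step (p s) (p s.+1) by move=> ?; apply: st => /=; lia.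
(* The path meets a box (a, z) after a - z steps, and a is less than the image of z, hence less than
   z + [head 0 la]. *)
have ess' a z : essential (remove b c y) a z -> exists2 s, (s < head 0 la)%N & p s = (a.+1, z.+1).
  move=> ea; have [s sr ps] := ess _ _ (essential_remove vy bc yb ymaxc ea).
  exists s => //; have := path_diff p0' st sr; rewrite ps /= => d.
  case/and3P: ea => /and3P[za _ az] _ _; have := hd_max z; lia.
have [so sz IH] := IHla lo.+1 hi.-1 (remove b c y) hiH' fix_r vr sh' p0 st' ess'.
have rr : (r.-1 < r)%N by lia.
have [] := path_mono st (s := 0) (u := r.-1) rr; rewrite add0n p0 pr /= => m1 m2.
split.
- by case: (la) so hd_lt => //= m l -> ->.
- rewrite /= sz arcs_remove // prednK // -has_count; apply/hasP.
  by exists b; rewrite ?mem_iota ?yb //; lia.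
move=> x reg.
(* A smaller part m is read off the first m - 1 steps, which stay within the rows and columns
   reached at p (r - 1). *)
have loc x1 x2 : (forall i, (b.+1 <= i < c)%N -> x1 i = x2 i) ->
    map (gpoly (path_param p x1)) la = map (gpoly (path_param p x2)) la.
  move=> e; apply/eq_in_map => m mla.
  have m0 : (0 < m)%N by case: sh' => _ /allP /(_ m mla).
  have mr : (m < r)%N.
    apply: leq_ltn_trans hd_lt; move: mla so; case: (la) => //= l l'.
    rewrite inE => /orP[/eqP->//|ml] so; apply: ltnW.
    by apply: (allP (order_path_min (rev_trans ltn_trans) so)).
  have mr' : (m.-1 < r)%N by lia.
  rewrite -(prednK m0); apply: (gpoly_path_local p0 st mr') => i iin; apply: e.
  have mr2 : (m.-1 + (r.-1 - m.-1) < r)%N by lia.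
  have [] := path_mono st mr2; rewrite subnKC; last by lia.
  by rewrite pr /=; lia.
have := @schub_insert R lo hi j b.+1 c (2%:R ^+ size la)
  (fun x => map (gpoly (path_param p x)) la) loc _ b c y (erefl _).
have lobb : (lo <= b < b.+1)%N by rewrite lob ltnSn.
have cchi : (c <= c < hi)%N by rewrite leqnn.
have bjc : (b < j <= c)%N by rewrite m2.
move=> /(_ lobb cchi bjc yb (before_arc bc yb ymaxc) (after_arc bc yb ymaxc)) ins.
rewrite /= exprS -mulrA ins //; last by move=> k kl; apply: fix_y; lia.
rewrite -(prednK r0) (gpoly_path x p0 st rr) pr /= -/(hook j b c x).
set h := hook j b c x; set gs := map _ la.
have -> : 2%:R%:P * h = h + 1 *: h by rewrite scale1r rmorphMn /= mulr_natl mulr2n.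
have /= -> := @multilinear_qfun _ (variables lo j x) [::] h h 1 gs.
by ring.
Qed.

End SchubQfun.

(** * Involutions of [n], words and compatible sequences *)

Section Embedding.
Local Open Scope nat_scope.
Variables (n : nat) (N : nat).
Implicit Types (y : 'S_n) (i j : 'I_n).

(* Label k stands for the index k - N + 1 when k >= N and for k - N when k < N:
   the index 0 is skipped (see [index_of]). *)
Definition shift_perm y k : nat :=
  if insub (k - N) is Some i then if N <= k then N + (y i : 'I_n) else k else k.

Lemma shift_permE y i : shift_perm y (N + i) = N + y i.
Proof. by rewrite /shift_perm addKn leq_addr valK. Qed.

Lemma shift_perm_out y k : ~~ (N <= k < N + n) -> shift_perm y k = k.
Proof.
move=> out; rewrite /shift_perm; case: insubP => [i lti ei|]; last by [].
by case: ifP => // le; have := ltn_ord i; lia.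
Qed.

Lemma shift_permP k : (exists i, k = N + i) \/ ~~ (N <= k < N + n).
Proof.
case: (boolP (N <= k < N + n)) => [h|]; last by right.
have lti : k - N < n by lia.
by left; exists (Ordinal lti) => /=; lia.
Qed.

Lemma shift_perm_case y k : (N <= k < N + n /\ N <= shift_perm y k < N + n) \/
  (~~ (N <= k < N + n) /\ shift_perm y k = k).
Proof.
case: (shift_permP k) => [[i ->]|out]; last by right; rewrite shift_perm_out.
by left; rewrite shift_permE; have := ltn_ord i; have := ltn_ord (y i); lia.
Qed.

Lemma shift_permK y : (y * y = 1)%g -> involutive (shift_perm y).
Proof.
move=> yy k; case: (shift_permP k) => [[i ->]|out]; last by rewrite !shift_perm_out.
by rewrite !shift_permE -permM yy perm1.
Qed.

Definition shift_invol y (yy : (y * y = 1)%g) : invol := Invol (shift_permK yy).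

Variables (y : 'S_n) (yy : (y * y = 1)%g).
Let z := shift_invol yy.

Lemma shift_invol_fixes lo : lo <= N -> fixes_outside lo (N + n) z.
Proof. by move=> loN k out; apply: shift_perm_out; lia. Qed.

Lemma shift_invol_vex : vexillary y -> vex z.
Proof.
move=> vy i1 i2 i3 i4; rewrite /z /= => lt123 lt34 /and3P[l1 l2 l3].
have := shift_perm_case y i1; have := shift_perm_case y i2.
have := shift_perm_case y i3; have := shift_perm_case y i4 => c4 c3 c2 c1.
have [r1 r2 r3 r4] : [/\ N <= i1 < N + n, N <= i2 < N + n, N <= i3 < N + n & N <= i4 < N + n].
  by move: lt123 => /andP[? ?]; split; lia.
case: (shift_permP i1) => [[k1 e1]|]; last by lia.
case: (shift_permP i2) => [[k2 e2]|]; last by lia.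
case: (shift_permP i3) => [[k3 e3]|]; last by lia.
case: (shift_permP i4) => [[k4 e4]|]; last by lia.
move: l1 l2 l3 lt123 lt34; rewrite e1 e2 e3 e4 !shift_permE !ltn_add2l => l1 l2 l3 lt123 lt34.
by apply: (vy k1 k2 k3 k4); rewrite ?lt123 ?lt34 // l1 l2 l3.
Qed.

Lemma half_diagram_shift i j : half_diagram z (N + i) (N + j) = ((i, j) \in inv_diagram y).
Proof. by rewrite inE /half_diagram /= !shift_permE /=; lia. Qed.

Lemma half_diagram_shift_range a x : half_diagram z a x -> (N <= a < N + n) && (N <= x < N + n).
Proof.
rewrite /half_diagram /=; have := shift_perm_case y a; have := shift_perm_case y x; lia.
Qed.

Lemma essential_shift a x : essential z a x ->
  exists2 q, essential_set (inv_diagram y) q & (a.+1, x.+1) = (N + q.1, N + q.2).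
Proof.
case/and3P => d nr nd; have := half_diagram_shift_range d.
case: (shift_permP a) => [[i ea]|]; last by lia.
case: (shift_permP x) => [[j ex]|]; last by lia.
move=> _; move: d nr nd; rewrite ea ex half_diagram_shift => d nr nd.
exists (i.+1, j.+1); last by rewrite !addnS.
exists (i, j) => // -[i' j']; rewrite -half_diagram_shift => d' /=.
by split=> -[e1 e2]; move: d'; rewrite e1 e2 ?addnS; apply/negP.
Qed.

Lemma count_shift (p : pred nat) : (forall k, p k -> N <= k < N + n) ->
  count p (iota 0 (N + n)) = #|[pred i : 'I_n | p (N + i)]|.
Proof.
move=> pN; rewrite iotaD count_cat (_ : count p (iota 0 N) = 0); last first.
  by apply/eqP; rewrite eqn0Ngt -has_count; apply/hasPn => k; rewrite mem_iota; apply: contraL => /pN; lia.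
rewrite add0n add0n -{1}[N]addn0 iotaDl count_map -val_enum_ord count_map cardE -size_filter.
by rewrite enumT size_filter.
Qed.

Lemma row_len_shift i : row_len z (N + i) = #|[set j | (i, j) \in inv_diagram y]|.
Proof.
rewrite /row_len; have -> : count (half_diagram z (N + i)) (iota 0 (N + i).+1) =
    count (half_diagram z (N + i)) (iota 0 (N + n)).
  have -> : N + n = (N + i).+1 + (n - i.+1) by have := ltn_ord i; lia.
  rewrite iotaD count_cat [X in _ = _ + X](_ : _ = 0) ?addn0 //.
  apply/eqP; rewrite eqn0Ngt -has_count; apply/hasPn => k; rewrite mem_iota /half_diagram; lia.
rewrite count_shift; last by move=> k /half_diagram_shift_range /andP[].
by rewrite cardsE; apply: eq_card => j; apply: half_diagram_shift.
Qed.

Lemma row_len_shift_out a : ~~ (N <= a < N + n) -> row_len z a = 0.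
Proof.
move=> out; apply/eqP; rewrite eqn0Ngt -has_count; apply/hasPn => x _.
by apply/negP => /half_diagram_shift_range; rewrite (negPf out).
Qed.

Lemma row_count_shift k : row_count (N + n) z k =
  count (fun r => k < r) [seq #|[set j | (i, j) \in inv_diagram y]| | i : 'I_n].
Proof.
rewrite /row_count count_shift => [|a]; last first.
  by case: (boolP (N <= a < N + n)) => // /row_len_shift_out->.
rewrite count_map cardE /enum_mem !size_filter count_filter.
by apply: eq_count => i /=; rewrite unfold_in /= row_len_shift andbT.
Qed.

Lemma has_shape_shift : has_shape (N + n) (inv_shape y) z.
Proof.
rewrite /inv_shape; set mu := sort _ _.
have cnt k : count (fun r => k < r) mu = row_count (N + n) z k.
  rewrite row_count_shift /mu (seq.permP (permEl (perm_sort _ _))) count_filter.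
  by apply: eq_count => r /=; rewrite andbC; case: r.
have so : sorted geq mu by apply: sort_sorted => a b; apply: leq_total.
have hd r : r \in mu -> r <= head 0 mu.
  move: so; case: (mu) => //= h t so; rewrite inE => /orP[/eqP->//|rt].
  have tr : transitive geq by move=> a b c /= ab bc; apply: leq_trans bc ab.
  by have /allP/(_ r rt) := order_path_min tr so.
split=> [k|].
  rewrite /transpose_partition -cnt.
  have [kl|kg] := ltnP k (head 0 mu).
    by rewrite (nth_map 0) ?size_iota // nth_iota.
  rewrite nth_default ?size_map ?size_iota //.
  apply/esym/eqP; rewrite eqn0Ngt -has_count; apply/hasPn => r /hd; lia.
apply/allP => r /mapP[k]; rewrite mem_iota /= add0n => kl ->.
rewrite -has_count; apply/hasP; exists (head 0 mu) => //.
by move: kl; case: (mu) => //= h t _; rewrite mem_head.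
Qed.

(** Each 2-cycle contains exactly one i with i < y i, and its orbit is {i, y i}. *)
Lemma arcs_shift : arcs (N + n) z = cyc y.
Proof.
rewrite /arcs count_shift => [|k]; last by rewrite /=; have := shift_perm_case y k; lia.
have yK i : y (y i) = i by rewrite -permM yy perm1.
have orb i : porbit y i = [set i; y i].
  apply/setP => j; rewrite !inE; apply/porbitP/orP => [[k ->]|[]/eqP->].
  - elim: k => [|k [/eqP IH|/eqP IH]]; first by left; rewrite expg0 perm1.
      by right; rewrite expgSr permM IH.
    by left; rewrite expgSr permM IH yK.
  - by exists 0; rewrite expg0 perm1.
  by exists 1; rewrite expg1.
have -> : #|[pred i : 'I_n | N + i < z (N + i)]| = #|[set i : 'I_n | i < y i]|.
  by rewrite cardsE; apply: eq_card => i; rewrite !inE /= shift_permE ltn_add2l.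
rewrite -(card_in_imset (f := porbit y)) => [|i j]; last first.
  rewrite !inE => li lj; rewrite !orb => e.
  have /set2P[//|ei] : i \in [set j; y j] by rewrite -e set21.
  have /set2P[//|ej] : j \in [set i; y i] by rewrite e set21.
  by rewrite -ej -ei in li lj; lia.
apply: eq_card => C; apply/imsetP/setIdP => [[i]|[]].
  rewrite inE => li ->; rewrite orb cards2; split; first by rewrite -orb imset_f.
  by rewrite (_ : i != y i) //; apply/eqP => e; rewrite -e ltnn in li.
case/imsetP => i _ ->; rewrite orb cards2 eqSS eqb1 => ne.
have [li|li|/val_inj e] := ltngtP i (y i); last by move: ne; rewrite -e eqxx.
  by exists i; rewrite ?inE ?orb.
by exists (y i); rewrite ?inE ?yK // orb yK finset.setUC.
Qed.

End Embedding.

Section EssentialPath.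
Local Open Scope nat_scope.
Variables (n : nat) (y : 'S_n) (P : seq (nat * nat)).
Hypothesis P_ess : essential_path y P.
Let q s := nth (0, 0) P s.

(** The first coordinate minus the second starts at 0, grows by at least 1 at each of the n steps
    and ends at most at n. So it grows by exactly 1 each time. *)
Lemma essential_path_step s : s < n -> path_step (q s) (q s.+1).
Proof.
have [_ bnd decr diag _] := P_ess.
have szP : size P = n.+1 by case: P_ess.
have lo u : u <= n -> (q u).2 + u <= (q u).1.
  elim: u => [|u IH] un; first by rewrite addn0 /q diag.
  have := IH (ltnW un); have [] := decr u un; rewrite /pos_le -/(q u) -/(q u.+1).
  case: (q u) (q u.+1) => [a b] [a' b'] /= le ne; have : (a' == a) && (b' == b) = false.
    by apply/negP => /andP[/eqP e /eqP e']; apply: ne; rewrite e e'.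
  by lia.
have hi u : u <= n -> (q u).1 <= (q u).2 + u.
  move=> un; rewrite -(subKn un).
  elim: (n - u) (leq_subr u n) => [|v IH] vn.
    rewrite subn0; have [] := bnd (q n); first by rewrite mem_nth // szP.
    by move=> le _; apply: leq_trans le (leq_addl _ _).
  have un' : n - v.+1 < n by lia.
  have := IH (ltnW vn); have [] := decr (n - v.+1) un'.
  rewrite -/(q (n - v.+1)) -/(q (n - v.+1).+1) (_ : (n - v.+1).+1 = n - v); last by lia.
  rewrite /pos_le; case: (q (n - v)) (q (n - v.+1)) => [a' b'] [a b] /= le ne.
  have : (a' == a) && (b' == b) = false.
    by apply/negP => /andP[/eqP e /eqP e']; apply: ne; rewrite e e'.
  by lia.
move=> sn; have := lo _ sn; have := hi _ sn; have := lo _ (ltnW sn); have := hi _ (ltnW sn).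
have [] := decr s sn; rewrite /pos_le -/(q s) -/(q s.+1) /path_step.
case: (q s) (q s.+1) => [a b] [a' b'] /= le _ h1 h2 h3 h4.
have [e|e] := eqVneq a' a; first by right; split; [lia | congr (_, _); lia].
by left; congr (_, _); lia.
Qed.

End EssentialPath.

(** * Regularity of the differences of variables *)

Lemma ucmM_inj (i : int) (m m' : {cmonom int}) : (mmul (ucm i) m) = (mmul (ucm i) m') -> m = m'.
Proof.
move=> e; apply/eqP/cmP => k; have := congr1 (fun u : {cmonom int} => u k) e.
by rewrite /= !cmM => /addnI.
Qed.

Lemma mcoeff_xvarM i (p : {malg int[{cmonom int}]}) m : (xvar i * p)@_(mmul (ucm i) m) = p@_m.
Proof.
have le1 : (msupp (xvar i) `<=` [fset ucm i])%fset by rewrite /xvar msuppU1.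
rewrite (mcoeffMlw _ le1 (fsubset_refl _)) big_seq_fset1 mcoeffUU.
have eqE k : (mmul (ucm i) k == mmul (ucm i) m) = (k == m).
  by apply/eqP/eqP => [/ucmM_inj|->].
under eq_bigr => k _ do rewrite eqE mul1r mulrb.
rewrite -big_mkcond; have [ms|ms] := boolP (m \in msupp p).
  by rewrite -big_filter (filter_pred1_uniq (fset_uniq _) ms) big_seq1.
rewrite mcoeff_outdom // big_seq_cond big1 // => k /andP[ks /eqP km].
by rewrite -km ks in ms.
Qed.

Lemma ucm_dvd i (m : {cmonom int}) : i \in finsupp (cmonom_val m) ->
  exists m', m = (mmul (ucm i) m').
Proof.
move=> im; pose f : {fsfun int -> nat with 0%N} :=
  [fsfun k in finsupp (cmonom_val m) => (m k - (i == k))%N].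
exists (CMonom f); apply/eqP/cmP => k; rewrite cmM cmU.
have -> : CMonom f k = (m k - (i == k))%N.
  rewrite [LHS]fsfunE; case: ifP => // /negbT; rewrite -cmE_eq0 => m0.
  by apply/esym/eqP; rewrite subn_eq0 (leq_trans (eq_leq (eqP m0))).
have mi : (0 < m i)%N by rewrite lt0n cmE_neq0.
by have [<-|_] := eqVneq i k; [rewrite subnKC | rewrite subn0].
Qed.

(** If x_i p = x_j p, the coefficient of m in p is that of x_i m in x_j p: it is 0 unless m = x_j
    m', and then it is the coefficient of x_i m' in p. The exponent of x_j has decreased. *)
Lemma lreg_xvarB i j : i != j -> GRing.lreg (xvar i - xvar j).
Proof.
move=> ij; apply: mulrI0_lreg => p /eqP; rewrite mulrBl subr_eq0 => /eqP e.
apply/malgP => m; rewrite mcoeff0; have [d] := ubnP (m j).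
elim: d m => [|d IHd] m md; first by rewrite ltn0 in md.
rewrite -(mcoeff_xvarM i) e; apply/eqP.
apply/negP => /negP nz; have jm := xvar_dvd nz.
have {jm} : j \in finsupp (cmonom_val m).
  by move: jm; rewrite -!cmE_neq0 cmM cmU (negPf ij).
move=> jm; have [m' em] := ucm_dvd jm.
have /negP[] := nz; have -> : mmul (ucm i) m = mmul (ucm j) (mmul (ucm i) m').
  by rewrite em !mulmA (mulmC (ucm i)).
rewrite mcoeff_xvarM; apply/eqP/IHd.
move: md; rewrite em !cmM cmUU cmU (negPf ij); lia.
Qed.

Lemma regular_xvar (f : nat -> int) : injective f -> regular_family (xvar \o f).
Proof. by move=> fI i k ik; apply: lreg_xvarB; apply/eqP => /fI. Qed.

(** * Involution words and strict steps *)

Section InvolutionWords.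
Local Open Scope nat_scope.
Variable n : nat.
Implicit Types (u v w y : 'S_n) (i j : 'I_n.-1) (a b : seq 'I_n.-1) (x : 'I_n).

Definition ascent w i := w (letter_pos i) < w (letter_posS i).

Lemma neq_letter_pos i : letter_pos i != letter_posS i.
Proof. by rewrite -val_eqE /= neq_ltn ltnSn. Qed.

Lemma sreflV i : ((srefl i)^-1 = srefl i)%g.
Proof. exact: tpermV. Qed.

Lemma sreflK i : involutive (srefl i).
Proof. exact: tpermK. Qed.

Lemma srefl_pos i : srefl i (letter_pos i) = letter_posS i.
Proof. exact: tpermL. Qed.

Lemma srefl_posS i : srefl i (letter_posS i) = letter_pos i.
Proof. exact: tpermR. Qed.

Lemma srefl_mul_conj w i j : w (letter_pos j) = letter_pos i -> w (letter_posS j) = letter_posS i ->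
  (w * srefl i)%g = mulrefl w j.
Proof. by rewrite /mulrefl /srefl => <- <-; rewrite -tpermJ conjgE mulKVg. Qed.

Lemma demazure_left w i : demazure (srefl i) w = if ascent w^-1 i then (w * srefl i)%g else w.
Proof.
have [a /eqP <-] := demazure_word_ex w.
elim/last_ind: a => [|a j]; first by rewrite /= demazureg1 /ascent invg1 !perm1 ltnSn mul1g.
rewrite foldl_rcons; move: (foldl _ _ a) => {a}w IHw.
have := demazureA (srefl i) w (srefl j); rewrite !demazure_srefl IHw demazure_reflE.
case: ifP => // asc_j ->; set p := (w^-1)%g (letter_pos i); set q := (w^-1)%g (letter_posS i).
have vE x : ((mulrefl w j)^-1)%g x = srefl j (w^-1 x)%g by rewrite /mulrefl invMg permM sreflV.
rewrite {2}/ascent !vE -/p -/q.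
have wp : w p = letter_pos i by rewrite permKV.
have wq : w q = letter_posS i by rewrite permKV.
(* The exceptional case: s_i w and w s_j are the same permutation, so only one of the two products
   lengthens [w]. *)
have [/eqP[ep eq]|npq] := boolP ((p, q) == (letter_pos j, letter_posS j)).
  rewrite /ascent -/p -/q ep eq /= ltnSn srefl_pos srefl_posS /= ltnNge leqnSn /=.
  rewrite demazure_reflE !permM -ep wp -eq wq srefl_pos srefl_posS /= ltnNge leqnSn /=.
  by apply: srefl_mul_conj; rewrite -?ep -?eq.
have nqp : (q, p) != (letter_pos j, letter_posS j).
  by apply/negP => /eqP[eq ep]; rewrite -eq -ep wq wp /= ltnNge leqnSn in asc_j.
rewrite srefl_ltE // /ascent -/p -/q; case: ifP => _; rewrite demazure_reflE ?asc_j //.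
rewrite !permM srefl_lt //; first by rewrite /mulrefl mulgA.
by apply/negP => /eqP[ep eq]; move: npq; rewrite /p /q -ep -eq !permK eqxx.
Qed.

Definition istep w i : 'S_n := demazure (demazure (srefl i) w) (srefl i).

Definition fixes_letter w i := (w (letter_pos i) == letter_pos i) && (w (letter_posS i) == letter_posS i).

(** A strict step is a conjugation, unless i and i + 1 are both fixed. The multiplication on one
    side then already creates the 2-cycle, and the one on the other side is absorbed. *)
Lemma istepE w i : (w * w = 1)%g -> istep w i =
  if ascent w i then
    if fixes_letter w i then mulrefl w i else (srefl i * w * srefl i)%g
  else w.
Proof.
move=> ww; have wV : (w^-1 = w)%g by apply/eqP; rewrite eq_invg_mul ww.
rewrite /istep demazure_left wV demazure_srefl demazure_reflE -/(ascent w i).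
have [asc|/negPf nasc] := boolP (ascent w i); last by rewrite -/(ascent w i) nasc.
rewrite !permM.
have [/andP[/eqP e1 /eqP e2]|nf] := boolP (fixes_letter w i).
  by rewrite e1 e2 srefl_pos srefl_posS /= ltnNge leqnSn /=; apply: srefl_mul_conj.
by rewrite srefl_lt ?xpair_eqE // /mulrefl mulgA.
Qed.

Lemma istep_asc_inv w i : (w * w = 1)%g -> ascent w i -> istep w i =
  if fixes_letter w i then mulrefl w i else (srefl i * w * srefl i)%g.
Proof. by move=> ww asc; rewrite istepE // asc. Qed.

Lemma fixes_letter_comm w i : fixes_letter w i -> (w * srefl i)%g = mulrefl w i.
Proof. by case/andP => /eqP e1 /eqP e2; apply: srefl_mul_conj. Qed.

Lemma srefl2 i : (srefl i * srefl i = 1)%g.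
Proof. exact: tperm2. Qed.

Lemma istep_invol w i : (w * w = 1)%g -> (istep w i * istep w i = 1)%g.
Proof.
move=> ww; rewrite istepE //; case: ifP => // _; case: ifP => [/fixes_letter_comm c|_].
  by rewrite -{1}c /mulrefl mulgA -(mulgA w) srefl2 mulg1 ww.
by rewrite !mulgA -(mulgA _ (srefl i) (srefl i)) srefl2 mulg1 -(mulgA _ w w) ww mulg1 srefl2.
Qed.

Lemma perm_length_mulrefl w i : ascent w i -> perm_length (mulrefl w i) = (perm_length w).+1.
Proof.
move=> asc; set p := (letter_pos i, letter_posS i).
pose f (q : 'I_n * 'I_n) := (srefl i q.1, srefl i q.2).
have fK : involutive f by move=> [x x']; rewrite /f /= !sreflK.
have p_inv : p \in inversions (mulrefl w i).
  by rewrite inE /= /mulrefl !permM srefl_pos srefl_posS ltnSn.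
rewrite /perm_length (cardsD1 p) p_inv -[in RHS](card_imset _ (inv_inj fK)) add1n; congr _.+1.
apply: eq_card => q; rewrite -{2}[q]fK (mem_imset _ _ (inv_inj fK)).
case: q => x x'; rewrite !inE /= /mulrefl !permM /p.
have [/eqP[-> ->]|nq] := boolP ((x, x') == (letter_pos i, letter_posS i)).
  by rewrite srefl_pos srefl_posS /= ltnNge leqnSn.
have [/eqP[-> ->]|nq'] := boolP ((x', x) == (letter_pos i, letter_posS i)).
  by rewrite srefl_pos srefl_posS; move: asc; rewrite /ascent /=; lia.
by rewrite /= srefl_ltE.
Qed.

Lemma perm_lengthV w : perm_length w^-1 = perm_length w.
Proof.
pose f (q : 'I_n * 'I_n) := (w q.2, w q.1).
have f_inj : injective f by move=> [x x'] [z z'] [/perm_inj-> /perm_inj->].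
rewrite /perm_length -[in RHS](card_imset _ f_inj); apply: eq_card => -[x x'].
apply/idP/imsetP => [|[[z z']]]; rewrite !inE /= => /andP[lt1 lt2].
  by exists ((w^-1)%g x', (w^-1)%g x); rewrite ?inE /f /= ?permKV ?lt1 ?lt2.
by move=> [-> ->]; rewrite !permK lt2.
Qed.

Definition moved w := [set x | w x != x].
(* Every strict step increases the rank by 4: it creates two inversions if it
   conjugates, and one inversion and two moved points if it creates a 2-cycle. *)
Definition rank w := 2 * perm_length w + #|moved w|.

Lemma rank1 : rank 1%g = 0.
Proof.
have l0 : perm_length (1%g : 'S_n) = 0.
  by apply: eq_card0 => -[x x']; rewrite !inE !perm1 /=; case: ltngtP.
have m0 : #|moved 1%g| = 0 by apply: eq_card0 => x; rewrite !inE perm1 eqxx.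
by rewrite /rank l0 m0.
Qed.

Lemma rank_istep w i : (w * w = 1)%g -> rank (istep w i) = if ascent w i then rank w + 4 else rank w.
Proof.
move=> ww; rewrite istepE //; case: ifP => // asc.
have wV : (w^-1 = w)%g by apply/eqP; rewrite eq_invg_mul ww.
case: ifP => [fx|nf].
  case/andP: fx => /eqP e1 /eqP e2.
  have -> : rank (mulrefl w i) = 2 * (perm_length w).+1 + #|moved (mulrefl w i)|.
    by rewrite /rank perm_length_mulrefl.
  have -> : moved (mulrefl w i) = letter_pos i |: (letter_posS i |: moved w).
    apply/setP => x; rewrite !inE /mulrefl !permM.
    have [->|n1] := eqVneq x (letter_pos i); first by rewrite srefl_pos e2 eq_sym neq_letter_pos.
    have [->|n2] := eqVneq x (letter_posS i); first by rewrite srefl_posS e1 neq_letter_pos.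
    by rewrite /srefl tpermD 1?eq_sym.
  by rewrite !cardsU1 !inE e1 e2 !eqxx (negPf (neq_letter_pos i)) /rank /=; lia.
have l1 : perm_length (w * srefl i)%g = (perm_length w).+1.
  rewrite -perm_lengthV invMg sreflV -[w^-1%g]/(w^-1)%g wV -/(mulrefl w i).
  exact: perm_length_mulrefl.
have asc' : ascent (w * srefl i)%g i.
  by rewrite /ascent !permM srefl_lt // xpair_eqE -/(fixes_letter w i) nf.
have -> : (srefl i * w * srefl i)%g = mulrefl (w * srefl i)%g i by rewrite /mulrefl mulgA.
rewrite /rank perm_length_mulrefl // l1.
rewrite (_ : #|moved (mulrefl (w * srefl i)%g i)| = #|moved w|); first by lia.
rewrite -[in RHS](card_imset _ (inv_inj (sreflK i))); apply: eq_card => x.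
rewrite -{2}[x](sreflK i) (mem_imset _ _ (inv_inj (sreflK i))) !inE /mulrefl !permM.
by rewrite -(inj_eq (inv_inj (sreflK i))) sreflK.
Qed.

Lemma demazure_palindrome_rcons a i :
  demazure_palindrome (rcons a i) = istep (demazure_palindrome a) i.
Proof. exact: foldl_rcons. Qed.

Lemma demazure_palindrome_invol a : (demazure_palindrome a * demazure_palindrome a = 1)%g.
Proof.
elim/last_ind: a => [|a i IHa]; first by rewrite /demazure_palindrome mulg1.
by rewrite demazure_palindrome_rcons istep_invol.
Qed.

Lemma rank_palindrome a : rank (demazure_palindrome a) <= 4 * size a.
Proof.
elim/last_ind: a => [|a i IHa]; first by rewrite /demazure_palindrome rank1.
rewrite demazure_palindrome_rcons rank_istep ?demazure_palindrome_invol // size_rcons.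
by case: ifP => _; lia.
Qed.

(** Omit the letters whose step is not strict. *)
Lemma reduced_palindrome a : exists2 b, demazure_palindrome b = demazure_palindrome a &
  rank (demazure_palindrome a) = 4 * size b.
Proof.
elim/last_ind: a => [|a i [b eb rb]]; first by exists [::] => //; rewrite rank1.
have ii := demazure_palindrome_invol a.
have [asc|nasc] := boolP (ascent (demazure_palindrome a) i).
  exists (rcons b i); first by rewrite !demazure_palindrome_rcons eb.
  by rewrite demazure_palindrome_rcons rank_istep // asc rb size_rcons; lia.
have e : istep (demazure_palindrome a) i = demazure_palindrome a by rewrite istepE // (negPf nasc).
by exists b; rewrite demazure_palindrome_rcons e.
Qed.

Lemma involution_wordsP y a :
  involution_words y a <-> y = demazure_palindrome a /\ rank y = 4 * size a.
Proof.
split=> [[ey amin]|[ey ra]].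
  have [b eb rb] := reduced_palindrome a; rewrite -ey in eb rb.
  split=> //; have := rank_palindrome a; have := amin b (esym eb).
  by rewrite -ey; lia.
by split=> // b eb; have := rank_palindrome b; rewrite -eb ra; lia.
Qed.

Variable N : nat.

Lemma sw_shift i x : sw (N + i) (N + x) = N + srefl i x.
Proof.
rewrite /sw eqn_add2l -addnS eqn_add2l.
have [ex|nx] := eqVneq x (letter_pos i); first by rewrite ex srefl_pos eqxx.
have [ex|nx'] := eqVneq x (letter_posS i).
  by rewrite ex srefl_posS /= eqn_leq ltnn eqxx.
have -> : srefl i x = x by rewrite /srefl tpermD 1?eq_sym.
rewrite -!val_eqE /= in nx nx'.
by rewrite (negPf nx) (negPf nx').
Qed.

Lemma desc_shift w (ww : (w * w = 1)%g) i :
  desc (N + i) (shift_invol N ww) = (w (letter_posS i) < w (letter_pos i)).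
Proof.
by rewrite -(ltn_add2l N) -!(shift_permE N w) /desc /= addnS.
Qed.

Lemma down_shift w i (ww : (w * w = 1)%g) (vv : (istep w i * istep w i = 1)%g) : ascent w i ->
  desc (N + i) (shift_invol N vv) /\ down (N + i) (shift_invol N vv) = shift_invol N ww.
Proof.
move=> asc; have vE := istep_asc_inv ww asc; set v := istep w i in vv vE *.
have wK x : w (w x) = x by rewrite -permM ww perm1.
have di : desc (N + i) (shift_invol N vv).
  rewrite desc_shift vE; case: ifP => [|nf].
    by case/andP => /eqP e1 /eqP e2; rewrite !permM srefl_pos srefl_posS e1 e2 /=.
  rewrite !permM srefl_pos srefl_posS srefl_lt // xpair_eqE -/(fixes_letter w i) nf //.
split=> //; apply: invol_eq => k.
have shE x : shift_invol N vv (N + x) = N + v x := shift_permE N v x.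
have shE' x : shift_invol N ww (N + x) = N + w x := shift_permE N w x.
have posE : N + i = N + letter_pos i by [].
have posSE : (N + i).+1 = N + letter_posS i by rewrite /= addnS.
case: (shift_permP n N k) => [[x ->]|out]; last first.
  rewrite down_out; try (have := ltn_predS i; lia).
  by rewrite /= !shift_perm_out // /sw; case: eqP => [?|_]; [|case: eqP => ?];
     have := ltn_predS i; lia.
case: ifP vE => [fx|nf] vE.
  have v1 : shift_invol N vv (N + i) = (N + i).+1.
    by rewrite posSE posE shE vE permM srefl_pos; case/andP: fx => _ /eqP->.
  case/andP: fx => /eqP e1 /eqP e2.
  have [->|n1] := eqVneq x (letter_pos i).
    by rewrite shE' e1 -posE down_l v1 eqxx.
  have [->|n2] := eqVneq x (letter_posS i).
    by rewrite shE' e2 -posSE down_r v1 eqxx.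
  have ne1 : N + x <> N + i by rewrite posE => /addnI/val_inj h; rewrite h eqxx in n1.
  have ne2 : N + x <> (N + i).+1 by rewrite posSE => /addnI/val_inj h; rewrite h eqxx in n2.
  rewrite (down_out _ ne1 ne2).
  rewrite shE shE' sw_shift vE -(fixes_letter_comm (i := i)) ?permM ?sreflK //.
  by rewrite /fixes_letter e1 e2 !eqxx.
have v1 : shift_invol N vv (N + i) <> (N + i).+1.
  rewrite posSE posE shE => /addnI/val_inj; rewrite vE !permM srefl_pos.
  move/(congr1 (srefl i)); rewrite sreflK srefl_posS => e.
  have e' : w (letter_pos i) = letter_posS i by rewrite -e wK.
  by move: asc; rewrite /ascent e e' /= ltnNge leqnSn.
rewrite down_conj // sw_shift shE shE' sw_shift vE !permM !sreflK //.
Qed.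

Lemma up_perm y i : (y * y = 1)%g -> y (letter_posS i) < y (letter_pos i) ->
  exists w, [/\ (w * w = 1)%g, ascent w i & istep w i = y].
Proof.
move=> yy dy; have yK x : y (y x) = x by rewrite -permM yy perm1.
have [e|ne] := eqVneq (y (letter_pos i)) (letter_posS i).
  have e' : y (letter_posS i) = letter_pos i by rewrite -e yK.
  have c : (y * srefl i)%g = mulrefl y i.
    rewrite /mulrefl -{1}[y]mulg1 -(srefl2 i); apply/permP => x; rewrite !permM sreflK.
    have [->|n1] := eqVneq x (letter_pos i); first by rewrite srefl_pos e e' srefl_posS.
    have [->|n2] := eqVneq x (letter_posS i); first by rewrite srefl_posS e e' srefl_pos.
    have -> : srefl i x = x by rewrite /srefl tpermD 1?eq_sym.
    by rewrite /srefl tpermD //; apply/negP => /eqP h; move: n1 n2;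
       rewrite -(yK x) -h ?e ?e' eqxx.
  have asc : ascent (mulrefl y i) i by rewrite /ascent /mulrefl !permM srefl_pos srefl_posS e e' /=.
  have ww : (mulrefl y i * mulrefl y i = 1)%g.
    by rewrite -{1}c /mulrefl mulgA -(mulgA y) srefl2 mulg1 yy.
  exists (mulrefl y i); split=> //; rewrite istepE // asc /fixes_letter /mulrefl !permM.
  by rewrite srefl_pos srefl_posS e e' !eqxx /= mulgA srefl2 mul1g.
pose w := (srefl i * y * srefl i)%g.
have ww : (w * w = 1)%g.
  by rewrite /w !mulgA -(mulgA _ (srefl i) (srefl i)) srefl2 mulg1 -(mulgA _ y y) yy mulg1 srefl2.
have asc : ascent w i.
  rewrite /ascent /w !permM srefl_pos srefl_posS srefl_lt // xpair_eqE negb_and.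
  by apply/orP; right.
exists w; split=> //; rewrite istepE // asc (_ : fixes_letter w i = false).
  by rewrite /w !mulgA srefl2 mul1g -mulgA srefl2 mulg1.
apply/negP => /andP[/eqP e1 /eqP e2]; move: e1 e2; rewrite /w !permM srefl_pos srefl_posS.
move=> /(congr1 (srefl i)) e1 /(congr1 (srefl i)) e2; move: dy.
by rewrite -[y _](sreflK i) e1 -[X in _ < nat_of_ord X](sreflK i) e2 srefl_pos srefl_posS /= ltnNge leqnSn.
Qed.

End InvolutionWords.

(* [w] lists the letters of an involution word from the last to the first. *)
Fixpoint chain (w : seq nat) (z : invol) : bool :=
  if w is k :: w' then desc k z && chain w' (down k z) else `[< is_id z >].

(** Needed for [compatible_subseq]: a repeated letter would admit equal indices in a compatible
    sequence, whereas [moves] lists each pair only once. *)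
Lemma chain_neq w z : chain w z -> sorted [rel k l | k != l] w.
Proof.
elim: w z => // k w IHw z /= /andP[dk cw].
case: w IHw cw => // l w IHw cw; have /= -> := IHw _ cw; rewrite andbT.
by apply/negP => /eqP ekl; move: cw; rewrite /= -ekl desc_down.
Qed.

Section Words.
Local Open Scope nat_scope.
Variables (n N : nat).
Implicit Types (y : 'S_n) (a : seq 'I_n.-1).

Definition shift_word a := [seq N + val k | k <- a].

Lemma chain_word y (yy : (y * y = 1)%g) a :
  chain (rev (shift_word a)) (shift_invol N yy) <-> involution_words y a.
Proof.
rewrite involution_wordsP; elim/last_ind: a y yy => [|a i IHa] y yy.
  rewrite /rev /= asboolE /demazure_palindrome /=; split=> [zid|[-> _] k].
    have e : y = 1%g.
      apply/permP => x; rewrite perm1; apply/val_inj/(@addnI N).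
      by rewrite -shift_permE -/(shift_invol N yy _) zid.
    by rewrite e rank1.
  rewrite /=; case: (shift_permP n N k) => [[x ->]|out]; last exact: shift_perm_out.
  by rewrite shift_permE perm1.
rewrite /shift_word map_rcons rev_rcons demazure_palindrome_rcons /= size_rcons; split.
  case/andP; rewrite (desc_shift N yy) => di; have [w [ww asc e]] := up_perm yy di.
  case: y / e yy di => yy di; have [_ ->] := down_shift N ww yy asc.
  move/(IHa w ww) => [<- rw]; split=> //.
  by rewrite rank_istep // asc rw; lia.
move=> [ey ry]; subst y; have ww := demazure_palindrome_invol a.
have [asc rw] : ascent (demazure_palindrome a) i /\ rank (demazure_palindrome a) = 4 * size a.
  by move: ry (rank_palindrome a); rewrite rank_istep //; case: ifP => _; lia.
have [/= -> ->] := down_shift N ww yy asc.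
by apply/(IHa _ ww).
Qed.

Lemma chain_range y (yy : (y * y = 1)%g) w :
  chain w (shift_invol N yy) -> exists a, w = rev (shift_word a).
Proof.
elim: w y yy => [|k w IHw] y yy /=; first by exists [::].
case/andP=> dk cw; have rk : N <= k /\ k.+1 < N + n.
  move: dk; rewrite /desc /=; have := shift_perm_case N y k; have := shift_perm_case N y k.+1; lia.
have ki : k - N < n.-1 by lia.
have ek : k = N + Ordinal ki by rewrite /=; lia.
rewrite ek in dk cw; have di := dk; move: di; rewrite (desc_shift N yy) => di.
have [v [vv asc e]] := up_perm yy di; case: y / e yy dk di cw => yy dk di.
have [_ ->] := down_shift N vv yy asc => /IHw[a ->].
by exists (rcons a (Ordinal ki)); rewrite /shift_word map_rcons rev_rcons -ek.
Qed.

End Words.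

(** * Subsequences of a sorted list *)

Section Subseqs.
Variable T : eqType.
Implicit Types (L s : seq T).

Fixpoint subseqs L := if L is p :: L' then subseqs L' ++ map (cons p) (subseqs L') else [:: [::]].

Lemma mem_subseqs L s : (s \in subseqs L) = subseq s L.
Proof.
elim: L s => [|p L IHL] s; first by rewrite /= inE; case: s.
rewrite /= mem_cat IHL; case: s => [|q s]; first by rewrite sub0seq.
have [->|nqp] := eqVneq q p.
  rewrite mem_map ?IHL //; last by move=> ? ? [].
  by case: (boolP (subseq (p :: s) L)) => //= /(subseq_trans (subseq_cons s p))->.
rewrite (_ : (_ \in map _ _) = false) ?orbF //.
by apply/negP => /mapP[s' _ [e _]]; rewrite e eqxx in nqp.
Qed.

Lemma uniq_subseqs L : uniq L -> uniq (subseqs L).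
Proof.
elim: L => //= p L IHL /andP[pL uL]; rewrite cat_uniq IHL //= map_inj_uniq ?IHL //; last first.
  by move=> ? ? [].
rewrite andbT; apply/hasPn => _ /mapP[s _ ->]; rewrite mem_subseqs.
by apply: contra pL => /mem_subseq -> //; rewrite mem_head.
Qed.

Lemma subseq_sorted_mem (r : rel T) L s : transitive r -> irreflexive r -> sorted r L ->
  subseq s L = sorted r s && all [in L] s.
Proof.
move=> tr ir sL; apply/idP/andP => [sub|[ss inL]].
  by split; [exact: subseq_sorted sub sL | apply/allP => x; exact: mem_subseq].
have -> : s = [seq x <- L | x \in s].
  apply: (irr_sorted_eq tr ir) => //; first exact: sorted_filter.
  move=> x; rewrite mem_filter; case: (boolP (x \in s)) => // /(allP inL) //.
exact: filter_subseq.
Qed.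

End Subseqs.

(** * Expansion of the operator product *)

Section Expansion.
Variable R : comNzRingType.
Implicit Types (x : nat -> R) (z : invol) (L s : seq (nat * nat)).

Lemma foldr_hop x L z :
  foldr (fun p F => hop p.1 (x p.2) F) (@delta R) L z =
  \sum_(s <- subseqs L) (chain (map fst s) z)%:R * \prod_(p <- s) x p.2.
Proof.
elim: L z => [|p L IHL] z; first by rewrite /= big_seq1 big_nil mulr1.
rewrite /= big_cat big_map /= {1}/hop IHL; congr (_ + _); rewrite /lower.
case: ifP => _; last by rewrite mulr0 big1 // => s _; rewrite mul0r.
rewrite IHL big_distrr; apply: eq_bigr => s _.
by rewrite big_cons mulrCA.
Qed.

(* The pairs (letter, index); compatible sequences, read backwards together with
   their words, are the subsequences of this list that form a chain. *)
Fixpoint moves lo hi k := if k is k'.+1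
  then [seq (l, lo + k')%N | l <- iota (lo + k') (hi - (lo + k').+1)] ++ moves lo hi k' else [::].

Lemma rows_moves lo hi x k F :
  rows lo hi x k F = foldr (fun p F => hop p.1 (x p.2) F) F (moves lo hi k).
Proof.
elim: k => // k IHk; rewrite rowsS IHk /= foldr_cat.
move: (foldr _ F _) => {IHk}F; move: (lo + k)%N (hi - _)%N => i c.
have : forall j, row_desc j c (x i) F =
    foldr (fun p F => hop p.1 (x p.2) F) F [seq (l, i) | l <- iota j c].
  by elim: c => //= c IHc j; rewrite IHc.
by [].
Qed.

Lemma mem_moves lo hi k p :
  (p \in moves lo hi k) = [&& lo <= p.2, p.2 < lo + k, p.2 <= p.1 & p.1.+1 < hi]%N.
Proof.
case: p => l i /=; elim: k => [|k IHk] /=; first by rewrite in_nil; lia.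
rewrite mem_cat IHk; have [ei|ni] := eqVneq i (lo + k)%N.
  rewrite ei mem_map; last by move=> ? ? [].
  by rewrite mem_iota; lia.
rewrite (_ : (_ \in map _ _) = false); first by lia.
by apply/negP => /mapP[u _ [_ e]]; rewrite e eqxx in ni.
Qed.

(** Read backwards along a list with distinct neighbouring letters, this says that the indices
    increase weakly, and strictly where the letter increases. *)
Definition move_lt (p q : nat * nat) := ((q.2 < p.2) || (p.2 == q.2) && (p.1 < q.1))%N.

Lemma move_lt_trans : transitive move_lt.
Proof. by move=> q p r; rewrite /move_lt; lia. Qed.

Lemma move_lt_irr : irreflexive move_lt.
Proof. by move=> p; rewrite /move_lt; lia. Qed.

Lemma sorted_moves lo hi k : sorted move_lt (moves lo hi k).
Proof.
elim: k => // k IHk; rewrite /= (sorted_pairwise move_lt_trans) pairwise_cat.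
rewrite -!(sorted_pairwise move_lt_trans) IHk andbT; apply/andP; split.
  apply/allrelP => p q /mapP[l _ ->]; rewrite mem_moves /move_lt /=; lia.
rewrite sorted_map; apply: (@sub_sorted _ ltn); last exact: iota_ltn_sorted.
by move=> u v /= uv; rewrite /move_lt /= ltnn eqxx.
Qed.

Lemma schub_subseqs hi x z :
  schub 0 hi x z = \sum_(s <- subseqs (moves 0 hi hi)) (chain (map fst s) z)%:R * \prod_(p <- s) x p.2.
Proof. by rewrite /schub subn0 rows_moves foldr_hop. Qed.

End Expansion.

(** * Compatible sequences as subsequences *)

Section Labels.
Variables (n N : nat).
Implicit Types (y : 'S_n) (a : seq 'I_n.-1) (i : seq int) (s : seq (nat * nat)) (z : int).

(** Inverse of [index_of N] on the nonzero integers z >= -N. *)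
Definition label z : nat := if z < 0 then absz (z + N%:Z)%R else absz (z + N%:Z - 1)%R.

Lemma index_ofK k : label (index_of N k) = k.
Proof. by rewrite /label /index_of; have [kN|kN] := ltnP k N; case: ifP => ?; lia. Qed.

Lemma labelK z : z != 0 -> - N%:Z <= z -> index_of N (label z) = z.
Proof. by move=> z0 zN; rewrite /label; have [zn|zp] := ltP z 0; rewrite /index_of; case: ifP => ?; lia. Qed.

Lemma index_of_neq0 k : index_of N k != 0.
Proof. by rewrite /index_of; case: ifP => ?; lia. Qed.

Lemma index_of_ge k : - N%:Z <= index_of N k.
Proof. by rewrite /index_of; case: ifP => ?; lia. Qed.

Lemma index_of_le k l : (index_of N k <= index_of N l) = (k <= l)%N.
Proof. by rewrite /index_of; case: ifP => ?; case: ifP => ?; lia. Qed.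

Lemma index_of_lt k l : (index_of N k < index_of N l) = (k < l)%N.
Proof. by rewrite ltNge index_of_le ltnNge. Qed.

Lemma index_of_le_letter k l : (index_of N k <= l.+1%:Z) = (k <= N + l)%N.
Proof. by rewrite /index_of; case: ifP => ?; lia. Qed.

Lemma map_index_ofK : cancel (map (index_of N)) (map label).
Proof. exact: mapK index_ofK. Qed.

Lemma map_labelK i : (forall z, z \in i -> z != 0 /\ - N%:Z <= z) ->
  map (index_of N) (map label i) = i.
Proof.
move=> ir; rewrite -map_comp -[RHS]map_id; apply/eq_in_map => z /ir[z0 zN].
exact: labelK.
Qed.

Definition unshift_word (w : seq nat) : seq 'I_n.-1 := pmap insub [seq (k - N)%N | k <- w].

Lemma shift_wordK : cancel (shift_word N) unshift_word.
Proof.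
move=> a; rewrite /unshift_word -map_comp (eq_map (g := val)); last by move=> k /=; rewrite addKn.
exact: (map_pK valK).
Qed.

Definition pack s := (unshift_word (rev (map fst s)), map (index_of N) (rev (map snd s))).
Definition unpack (ai : seq 'I_n.-1 * seq int) := rev (zip (shift_word N ai.1) (map label ai.2)).

Lemma packK s a : map fst s = rev (shift_word N a) -> unpack (pack s) = s.
Proof.
move=> es; rewrite /unpack /pack /= map_index_ofK es revK shift_wordK.
rewrite -[shift_word N a]revK -es -rev_zip ?size_map // revK.
exact: zip_unzip.
Qed.

Lemma unpackK a i : size i = size a -> (forall z, z \in i -> z != 0 /\ - N%:Z <= z) ->
  pack (unpack (a, i)) = (a, i).
Proof.
move=> si ir; have sz : size (map label i) = size (shift_word N a) by rewrite !size_map.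
rewrite /pack /unpack !map_rev !revK /= -/(unzip1 _) -/(unzip2 _).
by rewrite unzip1_zip ?unzip2_zip ?sz // shift_wordK map_labelK.
Qed.

Lemma unpack_word a i : size i = size a -> map fst (unpack (a, i)) = rev (shift_word N a).
Proof.
move=> si; have sz : size (map label i) = size (shift_word N a) by rewrite !size_map.
by rewrite /unpack map_rev -/(unzip1 _) unzip1_zip ?sz.
Qed.

Lemma nth_shift_word a r : (r < size a)%N ->
  (nth 0 (shift_word N a) r).+1 = (N + nth 0 [seq (val k).+1 | k <- a] r)%N.
Proof. by elim: a r => // k a IHa [|r] /= ra; [rewrite addnS | exact: IHa]. Qed.

Lemma compatible_subseq a i : sorted [rel k l | k != l] (shift_word N a) ->
    size i = size a -> (forall z, z \in i -> z != 0 /\ - N%:Z <= z) ->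
  compatible a i <-> unpack (a, i) \in subseqs (moves 0 (N + n) (N + n)).
Proof.
move=> /(sortedP 0%N) neq si ir; set i' := map label i; set a' := shift_word N a.
have szi : size i' = size a by rewrite size_map.
have sza : size a' = size a by rewrite size_map.
have nth_i r : (r < size a)%N -> nth 0 i r = index_of N (nth 0%N i' r).
  by move=> ra; rewrite -{1}(map_labelK ir) (nth_map 0%N) // szi.
have nth_a r : (r < size a)%N -> exists2 l, nth 0%N [seq (val k).+1 | k <- a] r = l.+1 &
    nth 0%N a' r = (N + l)%N /\ (l < n.-1)%N.
  move=> ra; have := nth_shift_word ra; have : nth 0%N a' r \in a' by rewrite mem_nth // sza.
  case/mapP => k _ ->; rewrite -addnS => /addnI <-; exists (val k) => //; split=> //; exact: (ltn_ord k).
have szz : size (zip a' i') = size a by rewrite size_zip szi sza minnn.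
rewrite mem_subseqs (subseq_sorted_mem _ move_lt_trans move_lt_irr (sorted_moves _ _ _)).
rewrite /unpack rev_sorted all_rev -/a' -/i'; split.
  case=> _ _ le_a le_i lt_i; apply/andP; split.
    apply/(sortedP (0%N, 0%N)) => r; rewrite szz => ra.
    rewrite !nth_zip ?szi ?sza // /move_lt /=.
    have := neq r; rewrite sza => /(_ ra) /=.
    have := le_i r ra; have := lt_i r ra; rewrite !nth_i ?(ltnW ra) // index_of_le.
    have [l -> [-> _]] := nth_a r (ltnW ra); have [l' -> [-> _]] := nth_a _ ra.
    rewrite index_of_lt; lia.
  apply/(all_nthP (0%N, 0%N)) => r; rewrite szz => ra.
  rewrite nth_zip ?szi ?sza // mem_moves /=.
  have := le_a r ra; rewrite nth_i //; have [l -> [-> ln]] := nth_a r ra.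
  rewrite index_of_le_letter; lia.
case/andP => /(sortedP (0%N, 0%N)) so /(all_nthP (0%N, 0%N)) al.
have st r : (r.+1 < size a)%N -> move_lt (nth 0%N a' r.+1, nth 0%N i' r.+1) (nth 0%N a' r, nth 0%N i' r).
  by move=> ra; have := so r; rewrite szz => /(_ ra); rewrite !nth_zip ?szi ?sza.
split=> //.
- by move=> z /ir[].
- move=> r ra; have := al r; rewrite szz => /(_ ra); rewrite nth_zip ?szi ?sza // mem_moves /=.
  rewrite nth_i //; have [l -> [-> ln]] := nth_a r ra; rewrite index_of_le_letter; lia.
- move=> r ra; rewrite !nth_i ?(ltnW ra) // index_of_le; have := st r ra; rewrite /move_lt /=; lia.
move=> r ra; have := st r ra; rewrite !nth_i ?(ltnW ra) //.
have [l -> [-> _]] := nth_a r (ltnW ra); have [l' -> [-> _]] := nth_a _ ra.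
by rewrite index_of_lt /move_lt /=; lia.
Qed.

End Labels.

(** A compatible sequence contributes to the coefficient of [m] only if all its variables divide
    [m], hence only with indices at least -N. Such pairs of a word and a sequence are matched by
    [pack] with the chains among the subsequences of [moves]. *)
Lemma inv_schubert_truncated n N (y : 'S_n) (yy : (y * y = 1)%g) (m : {cmonom int}) :
    (forall z, z \in finsupp (cmonom_val m) -> - N%:Z <= z) ->
  inv_schubert y m = (schub 0 (N + n) (xvar \o index_of N) (shift_invol N yy))@_m.
Proof.
move=> suppN; set z := shift_invol N yy; set L := moves 0 (N + n) (N + n).
pose S := [seq s <- subseqs L | chain (map fst s) z].
have uS : uniq S by rewrite filter_uniq // uniq_subseqs // (sorted_uniq move_lt_trans move_lt_irr) // sorted_moves.
have wS s : s \in S -> exists a : seq 'I_n.-1, map fst s = rev (shift_word N a).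
  by rewrite mem_filter => /andP[cs _]; exact: chain_range cs.
have prodE s : \prod_(k <- (pack n N s).2) xvar k = \prod_(p <- s) xvar (index_of N p.2).
  by rewrite big_map (perm_big (map snd s)) ?perm_rev // big_map.
have packS s : s \in S -> inv_schubert_index y (pack n N s).
  move=> sS; have [a ea] := wS _ sS; have ui := packK ea.
  move: sS; rewrite mem_filter => /andP[cs sub].
  have si : size (pack n N s).2 = size a.
    by rewrite /pack /= size_map size_rev size_map -(size_map fst) ea size_rev size_map.
  have ea' : (pack n N s).1 = a by rewrite /pack /= ea revK shift_wordK.
  have ir k : k \in (pack n N s).2 -> k != 0 /\ - N%:Z <= k.
    by case/mapP => u _ ->; rewrite index_of_neq0 index_of_ge.
  split; first by apply/(chain_word N yy); rewrite ea' -ea.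
  apply/(compatible_subseq (N := N)) => //.
  - have := chain_neq cs; rewrite ea' ea rev_sorted; apply: sub_sorted => u v /=.
    by rewrite eq_sym.
  - by rewrite ea'.
  by rewrite -surjective_pairing ui.
rewrite schub_subseqs /inv_schubert /series_sum (fsbigE (map (pack n N) S)).
- rewrite big_map raddf_sum /= /S big_filter_cond big_mkcond.
  rewrite [LHS]big_seq [RHS]big_seq; apply: eq_bigr => s sL.
  have [cs|ncs] := boolP (chain (map fst s) z); last by rewrite mul0r mcoeff0.
  rewrite mul1r prodE (_ : _ \in _) //; rewrite inE; apply: packS.
  by rewrite mem_filter cs.
- rewrite map_inj_in_uniq // => s s' /wS[a ea] /wS[a' ea'] e.
  by rewrite -(packK ea) e (packK ea').
- by move=> ai /mapP[s /packS + ->].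
move=> [a i] /= [wa ci]; apply: contraNeq => nz.
have ir k : k \in i -> k != 0 /\ - N%:Z <= k.
  move=> ki; split; first by case: ci => _ + _ _ _; apply.
  apply: suppN; apply: (@xvar_dvd _ (\prod_(k' <- rem k i) xvar k')).
  by rewrite (perm_big _ (perm_to_rem ki)) big_cons in nz.
have si : size i = size a by case: ci.
have cw : chain (rev (shift_word N a)) z by apply/(chain_word N yy).
rewrite -(unpackK si ir); apply: map_f; rewrite mem_filter unpack_word // cw /=.
apply/compatible_subseq => //.
have := chain_neq cw; rewrite rev_sorted; apply: sub_sorted => u v /=.
by rewrite eq_sym.
Qed.

(** * Specialization to an essential path and a fixed monomial *)

Lemma eq_gpoly (R : comNzRingType) (t t' : nat -> R) r :
  (forall s, (2 <= s < r.+1)%N -> t s = t' s) -> gpoly t r = gpoly t' r.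
Proof. by move=> e; rewrite /gpoly; congr (_ * _); apply: eq_big_nat => s sr; rewrite e. Qed.

Lemma index_of_inj N : injective (index_of N).
Proof. by apply: can_inj; apply: index_ofK. Qed.

Lemma mem_gtn_head la r : sorted gtn la -> r \in la -> (r <= head 0 la)%N.
Proof.
case: la => //= h la so; rewrite inE => /orP[/eqP->//|rla].
by apply: ltnW; apply: (allP (order_path_min (rev_trans ltn_trans) so)).
Qed.

Lemma step_var_param N (q : nat -> nat * nat) u : path_step (q u) (q u.+1) ->
  - step_var (q u) (q u.+1) =
  path_param (fun s => ((N + (q s).1)%N, (N + (q s).2)%N)) (xvar \o index_of N) u.+2.
Proof.
rewrite /path_param /step_var /= -addnS eqn_add2l => -[e|[q0 e]]; rewrite e /=.
  by rewrite eqxx; congr (- xvar _); rewrite /index_of; case: ifP; lia.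
rewrite (_ : (_ == _) = false); last by lia.
by rewrite opprK; congr xvar; rewrite /index_of; case: ifP; lia.
Qed.

Lemma finsupp_bound (m : {cmonom int}) :
  exists N : nat, forall z, z \in finsupp (cmonom_val m) -> - N%:Z <= z.
Proof.
exists (\max_(z <- finsupp (cmonom_val m)) absz z)%N => z zm.
have := @leq_bigmax_seq _ (enum_fset (finsupp (cmonom_val m))) xpredT absz z zm isT.
by move: (bigop _ _ _) => b; lia.
Qed.

Lemma shape_head_bound n N (y : 'S_n) (yy : (y * y = 1)%g) : vexillary y ->
  (head 0 (inv_shape y) <= n)%N /\
  forall k, (shift_invol N yy k <= k + head 0 (inv_shape y))%N.
Proof.
move=> vy; have fixy := shift_invol_fixes yy (leqnn N).
have [[zid ->]|[r0 [b eb] mx]] :=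
  shape_head (leqnn _) fixy (shift_invol_vex vy) (has_shape_shift N yy).
  by split=> // k; rewrite zid addn0.
by split=> //; move: eb (shift_perm_case N y b) => /= ->; lia.
Qed.

Theorem theorem7p3 (n : nat) (y : 'S_n) (la : seq nat) (P : seq (nat * nat))
    (j : nat) (y_inv : (y * y = 1)%g) (y_vex : vexillary y)
    (y_shape : inv_shape y = la) (P_ess : essential_path y P)
    (P_start : nth (0, 0)%N P 0 = (j, j)) (m : {cmonom int}) :
  2 ^+ cyc y * inv_schubert y m = ivanovQ la j (fun r => - path_var P r) m.
Proof.
have [N suppN] := finsupp_bound m.
have szP : size P = n.+1 by case: P_ess.
set q := nth (0, 0)%N P in P_start.
pose p s := ((N + (q s).1)%N, (N + (q s).2)%N).
have q_step s : (s.+1 < n.+1)%N -> path_step (q s) (q s.+1) := @essential_path_step _ _ _ P_ess s.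
have q_diff s : (s < n.+1)%N -> (q s).1 = ((q s).2 + s)%N.
  by apply: path_diff q_step; rewrite P_start.
have shape := has_shape_shift N y_inv; rewrite y_shape in shape.
have [hd_n hd_max] := shape_head_bound N y_inv y_vex; rewrite y_shape in hd_n hd_max.
have p0 : p 0%N = ((N + j)%N, (N + j)%N) by rewrite /p P_start.
have p_step s : (s.+1 < head 0 la)%N -> path_step (p s) (p s.+1).
  move=> sh; have sn : (s.+1 < n.+1)%N by lia.
  rewrite /p /path_step; case: (q_step s sn) => [->|[q0 ->]] /=; [left|right].
    by rewrite addnS.
  by split; [lia | congr (_, _); lia].
have p_ess a b : essential (shift_invol N y_inv) a b ->
    exists2 s, (s < head 0 la)%N & p s = (a.+1, b.+1).
  move=> ess; have [c c_ess e] := essential_shift ess.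
  have cP := ess_path_ess P_ess c_ess.
  have sP : (index c P < n.+1)%N by rewrite -szP index_mem.
  have qs : q (index c P) = c by rewrite /q nth_index.
  exists (index c P); last by rewrite /p qs.
  have := q_diff _ sP; rewrite qs; case: e => e1 e2 d.
  by case/andP: ess => /and3P[_ _ lt] _; have := hd_max b; lia.
have fixy := shift_invol_fixes y_inv (leq0n N).
have [so sz main] := @schub_qfun {malg int[{cmonom int}]} _ _ _ _ _ _ _ (leqnn _) fixy (shift_invol_vex y_vex) shape p0 p_step p_ess.
have := main _ (regular_xvar (@index_of_inj N)); rewrite sz arcs_shift => {}main.
rewrite (inv_schubert_truncated y_inv suppN) (@ivanovQ_truncated la j N _ m) //; first last.
- by rewrite /path_var /= oppr0.
- by case: shape.
have -> : map xvar (letters_upto N j) = variables 0 (N + j) (xvar \o index_of N).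
  by rewrite /letters_upto /variables subn0 -map_rev -map_comp.
have -> : map (gpoly (fun r => - path_var P r)) la =
    map (gpoly (path_param p (xvar \o index_of N))) la.
  (* Only t_2, ..., t_r with r <= n occur in a row polynomial, and each of them belongs to a genuine
     step of the path. *)
  apply/eq_in_map => r rla; have rn : (r <= n)%N := leq_trans (mem_gtn_head so rla) hd_n.
  apply: eq_gpoly => s /andP[s1 sr].
  have sn : (s <= n.+1)%N by lia.
  rewrite /path_var szP s1 sn.
  have [u su] : exists u, s = u.+2 by exists s.-2; lia.
  rewrite su; apply: step_var_param; apply: q_step; lia.
rewrite -main -!natrX !mulr_natl mcoeffMn //.
Qed.
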